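(* Suppose $\theta>0$ and $\alpha>-1$, let $N\in\mathbb{N}$, and put $a:=\theta(\alpha+1)-1$. Then, for any partition $\lambda$ with $l(\lambda)\le N$ and any $\mathbf{x}_N\in W_{\ge}^N$, $$[\Lambda_{\theta,\alpha,N}^{N}L_\lambda^{a}(\cdot\,;\theta^{-1})](\mathbf{x}_N)=L_\lambda^{a+\theta}(\mathbf{x}_N;\theta^{-1})\,c(\lambda,N,\theta;\alpha).$$
   Context: $W_{\ge}^N=\{(x_1,\dots,x_N)\in[0,\infty)^N: x_1\le\cdots\le x_N\}$; $(x)_r=\Gamma(x+r)/\Gamma(x)$; for a partition $\lambda=(\lambda_1\ge\lambda_2\ge\cdots)$, $l(\lambda)$ is its length and $|\lambda|=\sum_i\lambda_i$. For a kernel $K$ and function $f$, $[Kf](\mathbf{x})=\int f(\mathbf{y})K(\mathbf{x},d\mathbf{y})$. $1_N$ is the $N$-vector with all entries $1$. Constant: $c(\lambda,N,\theta;\alpha)=\prod_{i=1}^{N}\frac{((N+\alpha+1-i)\theta)_{\lambda_i}}{((N+\alpha+2-i)\theta)_{\lambda_i}}$. Kernel $\Lambda_{\theta,\alpha,N}^{N}$ (from $W_{\ge}^N$ to $W_{\ge}^N$): for $\mathbf{x}=(x_1,\dots,x_N)\in W_{\ge}^N$, put $x_0=0$; $\Lambda_{\theta,\alpha,N}^{N}(\mathbf{x},\cdot)$ is the distribution on $W_{\ge}^N$ of the (ordered) roots of the random polynomial $y\mapsto\sum_{i=0}^{N}w_i\prod_{0\le j\le N,\,j\ne i}(y-x_j)$,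 where $(w_0,\dots,w_N)$ has the Dirichlet distribution with parameters $(s_0,\dots,s_N)$, $s_0=(\alpha+1)\theta$, $s_1=\cdots=s_N=\theta$. Jack polynomial $P_\lambda^\theta(\mathbf{x}_N)$, $l(\lambda)\le N$: the symmetric polynomial in $N$ variables of the form $x_1^{\lambda_1}\cdots x_N^{\lambda_N}+\cdots$ (monomial symmetric function $m_\lambda$ with coefficient $1$ plus a combination of $m_\mu$, $|\mu|=|\lambda|$, $\mu$ strictly below $\lambda$ in dominance order) that is an eigenfunction of $D_2^N=\sum_{i=1}^N x_i^2\frac{\partial^2}{\partial x_i^2}+2\theta\sum_{i=1}^N\sum_{j\ne i}\frac{x_i^2}{x_i-x_j}\frac{\partial}{\partial x_i}$, with eigenvalue $2B(\lambda')-2\theta B(\lambda)+2\theta(N-1)|\lambda|$, where $B(\lambda)=\sum_i(i-1)\lambda_i$ and $\lambda'$ is the conjugate partition. Generalised binomial coefficients $\binom{\lambda}{\rho}_\theta$ are defined by $$\frac{P_\lambda^\theta(1_N+\mathbf{x}_N)}{P_\lambda^\theta(1_N)}=\sum_{m=0}^{|\lambda|}\sum_{|\rho|=m}\binom{\lambda}{\rho}_\theta\frac{P_\rho^\theta(\mathbf{x}_N)}{P_\rho^\theta(1_N)}.$$ Multivariate Laguerre polynomial, for $l(\lambda)\le N$: $$L_\lambda^{a}(\mathbf{x}_N;\theta^{-1})=\frac{1}{|\lambda|!}\sum_{\mu\subseteq\lambda}(-1)^{|\mu|}\binom{\lambda}{\mu}_\theta\prod_{i=1}^{N}\frac{(a+1+\theta(N-i))_{\lambda_i}}{(a+1+\theta(N-i))_{\mu_i}}\frac{P_\mu^\theta(\mathbf{x}_N)}{P_\mu^\theta(1_N)}.$$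 *)

(* Defs.v *)
From HB Require Import structures.
From mathcomp Require Import all_boot all_order all_algebra.
(* Only the structure instances of mpoly are imported: its notations clash with
   those of MathComp-Analysis. *)
From mathcomp Require Import (coercions, canonicals) mpoly.
From mathcomp Require Import all_classical all_reals all_analysis.

Set Implicit Arguments.
Unset Strict Implicit.
Unset Printing Implicit Defensive.

Import Order.TTheory GRing.Theory Num.Theory.
Import numFieldNormedType.Exports.

Local Open Scope classical_set_scope.
Local Open Scope ring_scope.

(* A partition is a weakly decreasing sequence of positive integers, so that
   [size la] is its length l(la) and [sumn la] is its weight |la|. *)
Definition is_partition (la : seq nat) : bool :=
  sorted geq la && (0%N \notin la).

(* Parts are numbered from 1, and la_i = 0 for i > l(la). *)
Definition part (la : seq nat) (i : nat) : nat := nth 0%N la i.-1.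

Definition conj_part (la : seq nat) : seq nat :=
  [seq count (leq i) la | i <- iota 1 (head 0%N la)].

Definition B_stat (la : seq nat) : nat :=
  (\sum_(1 <= i < (size la).+1) i.-1 * part la i)%N.

Definition part_sub (mu la : seq nat) : Prop :=
  forall i : nat, (0 < i)%N -> (part mu i <= part la i)%N.

Definition dominated (mu la : seq nat) : Prop :=
  sumn mu = sumn la /\
  forall k : nat, (sumn (take k mu) <= sumn (take k la))%N.

(* m_mu: mu is padded with zeros to length N, and [permutations] lists its
   distinct rearrangements once each. *)
Definition msym_monomial (R : realType) (N : nat) (mu : seq nat) :
    mpoly.mpoly N R :=
  \sum_(t <- permutations (mkseq (nth 0%N mu) N))
    mpoly.mpolyX R (mpoly.Multinom [tuple nth 0%N t i | i < N]).

(* D_2^N at a point z with pairwise distinct coordinates. *)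
Definition D2 (R : realType) (theta : R) (N : nat) (P : mpoly.mpoly N R)
    (z : 'I_N -> R) : R :=
  \sum_(i < N) z i ^+ 2 * mpoly.meval z (mpoly.mderiv i (mpoly.mderiv i P)) +
  2 * theta * \sum_(i < N) \sum_(j < N | j != i)
    z i ^+ 2 / (z i - z j) * mpoly.meval z (mpoly.mderiv i P).

Definition jack_eigenvalue (R : realType) (theta : R) (N : nat)
    (la : seq nat) : R :=
  2 * (B_stat (conj_part la))%:R - 2 * theta * (B_stat la)%:R
  + 2 * theta * (N%:R - 1) * (sumn la)%:R.

Definition is_jack (R : realType) (theta : R) (N : nat) (la : seq nat)
    (P : mpoly.mpoly N R) : Prop :=
  [/\ P \is @mpoly.symmetric N R,
      exists c : seq nat -> R,
        P = msym_monomial R N la +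
            \sum_(mu \in [set mu : seq nat |
                [/\ is_partition mu, (size mu <= N)%N, dominated mu la
                  & mu <> la]])
              c mu *: msym_monomial R N mu &
      forall z : 'I_N -> R, injective z ->
        D2 theta P z = jack_eigenvalue theta N la * mpoly.meval z P].

(* The unique polynomial satisfying [is_jack] (theta > 0, l(la) <= N). *)
Definition jack (R : realType) (theta : R) (N : nat) (la : seq nat) :
    mpoly.mpoly N R :=
  xget 0 [set P | is_jack theta la P].

Definition jack_at (R : realType) (theta : R) (N : nat) (la : seq nat)
    (x : N.-tuple R) : R :=
  mpoly.meval (tnth x) (jack theta N la).

Definition ones (R : realType) (N : nat) : N.-tuple R := [tuple of nseq N 1].

Definition normalized_jack (R : realType) (theta : R) (N : nat)
    (la : seq nat) (x : N.-tuple R) : R :=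
  jack_at theta la x / jack_at theta la (ones R N).

(* rho ranges over the partitions with at most N parts, those for which the
   Jack polynomial in N variables is defined; since these polynomials are
   linearly independent, the expansion determines all coefficients b rho
   occurring in it. *)
Definition is_gbinom (R : realType) (theta : R) (N : nat) (la : seq nat)
    (b : seq nat -> R) : Prop :=
  forall x : N.-tuple R,
    jack_at theta la [tuple 1 + tnth x i | i < N] / jack_at theta la (ones R N)
    = \sum_(0 <= m < (sumn la).+1)
        \sum_(rho \in [set rho : seq nat |
            [/\ is_partition rho, (size rho <= N)%N & sumn rho = m]])
          b rho * normalized_jack theta rho x.

Definition gbinom (R : realType) (theta : R) (N : nat) (la mu : seq nat) : R :=
  xget (fun=> 0) [set b : seq nat -> R | is_gbinom theta N la b] mu.

Definition Gamma (R : realType) (x : R) : R :=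
  \int[lebesgue_measure]_(t in `]0, +oo[) (t `^ (x - 1) * expR (- t)).

Definition poch (R : realType) (x : R) (r : nat) : R :=
  Gamma (x + r%:R) / Gamma x.

(* L_la^a (x; theta^-1) *)
Definition laguerre (R : realType) (theta a : R) (N : nat) (la : seq nat)
    (x : N.-tuple R) : R :=
  ((sumn la)`!%:R)^-1 *
  \sum_(mu \in [set mu : seq nat | is_partition mu /\ part_sub mu la])
    (-1) ^+ sumn mu * gbinom theta N la mu *
    (\prod_(1 <= i < N.+1)
       (poch (a + 1 + theta * (N%:R - i%:R)) (part la i) /
        poch (a + 1 + theta * (N%:R - i%:R)) (part mu i))) *
    normalized_jack theta mu x.

Definition c_const (R : realType) (la : seq nat) (N : nat)
    (theta alpha : R) : R :=
  \prod_(1 <= i < N.+1)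
    (poch ((N%:R + alpha + 1 - i%:R) * theta) (part la i) /
     poch ((N%:R + alpha + 2 - i%:R) * theta) (part la i)).

(* Lebesgue measure on R^n, as an iterated product measure. *)
Fixpoint lebesgue_tuple (R : realType) (n : nat) :
    set (n.-tuple (measurableTypeR R)) -> \bar R :=
  match n with
  | 0 => \d_ [tuple]
  | m.+1 => pushforward (lebesgue_measure \x @lebesgue_tuple R m)%E
              (fun p : measurableTypeR R * m.-tuple (measurableTypeR R) =>
                 [tuple of p.1 :: p.2])
  end.

(* (v_1, ..., v_n) |-> (1 - v_1 - ... - v_n, v_1, ..., v_n) *)
Definition simplex_chart (R : realType) (n : nat) (v : n.-tuple R) :
    n.+1.-tuple R :=
  [tuple of (1 - \sum_(i < n) tnth v i) :: v].

Definition dirichlet_density (R : realType) (n : nat) (s w : n.+1.-tuple R) :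
    R :=
  Gamma (\sum_(i < n.+1) tnth s i) / \prod_(i < n.+1) Gamma (tnth s i) *
  \prod_(i < n.+1) tnth w i `^ (tnth s i - 1).

(* The Dirichlet distribution is carried by the open simplex, where it is
   given by its density in the coordinates (w_1, ..., w_n). *)
Definition dirichlet (R : realType) (n : nat) (s : n.+1.-tuple R) :
    set (n.+1.-tuple (measurableTypeR R)) -> \bar R :=
  fun A =>
    (\int[@lebesgue_tuple R n]_(v in [set v : n.-tuple (measurableTypeR R) |
         (forall i, 0 < tnth (simplex_chart v) i)%R /\ A (simplex_chart v)])
       (dirichlet_density s (simplex_chart v))%:E)%E.

Definition weyl (R : realType) (N : nat) : set (N.-tuple R) :=
  [set x | all (fun t => 0 <= t) x /\ sorted <=%R x].

(* Increasing list of the roots, with multiplicity, of a polynomial of degree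
   N with only real roots; the default value serves all other polynomials. *)
Definition ordered_roots (R : realType) (N : nat) (p : {poly R}) :
    N.-tuple R :=
  xget [tuple of nseq N 0]
    [set y : N.-tuple R | sorted <=%R y /\
       p = lead_coef p *: \prod_(i < N) ('X - (tnth y i)%:P)].

Definition weighted_poly (R : realType) (N : nat) (x : N.-tuple R)
    (w : N.+1.-tuple R) : {poly R} :=
  let x0 : N.+1.-tuple R := [tuple of 0 :: x] in
  \sum_(i < N.+1) tnth w i *: \prod_(j < N.+1 | j != i) ('X - (tnth x0 j)%:P).

(* Lambda x is the law of the ordered roots, as a measure on R^N carried by
   [weyl]; almost every w is in the open simplex, and there [weighted_poly x w]
   is monic of degree N with N real roots, since it has nonnegative weights. *)
Definition Lambda (R : realType) (theta alpha : R) (N : nat)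
    (x : N.-tuple R) : set (N.-tuple (measurableTypeR R)) -> \bar R :=
  pushforward (dirichlet [tuple of (alpha + 1) * theta :: nseq N theta])
    (fun w => ordered_roots N (weighted_poly x w)).

Definition kernel_act (R : realType) (N : nat)
    (K : N.-tuple R -> set (N.-tuple (measurableTypeR R)) -> \bar R)
    (f : N.-tuple R -> R) (x : N.-tuple R) : \bar R :=
  (\int[K x]_(y in @weyl R N) (f y)%:E)%E.

(* Main.v *)
From HB Require Import structures.
Require Import Defs.
From mathcomp Require Import all_boot all_order all_algebra.
From mathcomp Require Import ring lra zify.
From mathcomp Require perm ssrcomplements mpoly bigenough.
Set Implicit Arguments. Unset Strict Implicit. Unset Printing Implicit Defensive.
Import Order.TTheory GRing.Theory Num.Theory.

(** The kernel maps every eigenfunction [P] of [D_2] with leading monomial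
    [x^mu] to a multiple of itself: [Lambda P = c(mu) P], where [c(mu)] is
    [c_const] at [mu].  The theorem follows term by term, because
    [a + 1 + theta (N - i) = (N + alpha + 1 - i) theta], so that the Pochhammer
    quotients of [laguerre] recombine with [c(mu)].  Neither the existence of
    Jack polynomials nor that of the binomial coefficients is needed: the
    default value [0] satisfies the same identity.

    The elementary symmetric polynomials of the random roots [y] are polynomials
    in the points [x], with coefficients affine in the weights [w].  Hence
    [P(y) = F(x, w)] for a polynomial [F], and [D_2 P (y) = (D_2 - K_x) F (x, w)]
    for an operator [K_x] acting on the weights: both sides are second-order
    operators, so it is enough to compare them, and their carre du champ, on the
    elementary symmetric polynomials.  An integration by parts shows that the
    Dirichlet mean kills [K_x F], so the mean of [F(x, w)] is again an
    eigenfunction, with the eigenvalue of [P].  It is supported on monomials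
    below [x^mu] in dominance order, where the eigenvalue of [D_2] is strictly
    smaller, so it is a multiple of [P], and the factor is the mean of the
    coefficient of [x^mu].

    On the analytic side, the moments of the Dirichlet density come from
    iterated Beta integrals, and the [k]-th root is a measurable function of the
    weights since it is separated from the others by two consecutive points. *)

(** The roots [y] are only implicit functions of [(x, w)], and they are never differentiated. With
    [p(u) = \prod_j (u - y_j)], the value of [D_2 - K_x] at [p(u)] and that of its carre du champ at
    [p(u), p(v)] are expressions in the polynomial [p] alone ([jop_gell], [gam_gell]), whatever
    points and weights produce [p]. The roots themselves are such data, with points [y] and weights
    [0], and for zero weights [K] vanishes. So [D_2] in the roots is a special case of the operator
    in [(x, w)], and equal polynomials give equal values. The coefficients [z_i z_j / (z_i - z_j)^2]
    of [K] fit because [p(u)] is affine in the weights, and its derivative along an exchange of mass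
    between two points has the factor [z_i - z_j]. The constant comes from leading coefficients:
    that of the lift of [e_c] is [1 - w_1 - ... - w_c], and the Dirichlet mean of a product of such
    tails factors as in stick-breaking. The operator identities require distinct points; the final
    one is between polynomials in [x], so it also holds where points coincide. *)

Module JackLift.

Import perm ssrcomplements mpoly bigenough BigEnough.
Local Open Scope ring_scope.

(** * The elementary symmetric polynomials of the roots *)

Section Generators.
Context (R : realFieldType) (N : nat).
Notation S := {mpoly R[N]}.
Implicit Types (F G : {mpoly S[N]}) (z w : 'I_N -> R) (u v : R).

Definition beta (h : {set 'I_N}) : S := 1 - \sum_(i in h) 'X_i.

(* [F : {mpoly S[N]}] is a polynomial in the points [z], with coefficients in the
   weights [w] of these points.  [ell a] is the [a]-th elementary symmetric
   polynomial of the roots of [genfun z w], up to the evaluation at [z] and [w]. *)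
Definition ell (a : nat) : {mpoly S[N]} :=
  \sum_(h : {set 'I_N} | #|h| == a) beta h *: 'X_[mesym1 h].

(* [weighted_poly], for the weights [w] of the points [z] and the weight
   [1 - \sum_i w i] of the point [0]; so [genfun y 0] has the roots [y]. *)
Definition genfun (z w : 'I_N -> R) : {poly R} :=
  (1 - \sum_i w i) *: \prod_j ('X - (z j)%:P) +
  \sum_i w i *: ('X * \prod_(j | j != i) ('X - (z j)%:P)).

(* [genfun z w] at [u], as a polynomial in [z] and [w]. *)
Definition gell (u : R) : {mpoly S[N]} :=
  \sum_(a < N.+1) ((-1) ^+ a * u ^+ (N - a))%:MP *: ell a.

Lemma card_notin (h : {set 'I_N}) : #|[pred j | j \notin h]| = (N - #|h|)%N.
Proof.
have E := cardC (mem h); rewrite card_ord in E.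
by rewrite -[X in (X - _)%N]E addKn; apply: eq_card => j.
Qed.

(** Expanding the products over subsets [h], the term of the point [i] contributes to the monomial
    of [h] only if [i \notin h], since its own factor there is [u] in place of [u - x_i]. What
    remains is the weight of [0] and of the points outside [h], that is [beta h]. *)
Lemma gellE u : gell u =
  (1 - \sum_i 'X_i : S) *: \prod_j (u%:MP%:MP - 'X_j) +
  \sum_i (u *: 'X_i : S) *: \prod_(j | j != i) (u%:MP%:MP - 'X_j).
Proof.
have E (I : {set 'I_N}) : \prod_(i in I) (- 'X_i : {mpoly S[N]}) =
    (-1) ^+ #|I| * 'X_[mesym1 I].
  have -> : 'X_[mesym1 I] = \prod_(i in I) 'X_i :> {mpoly S[N]}.
    rewrite mprodXE; congr 'X_[_].
    apply/mnmP=> i; rewrite mnmE mnm_sumE big_mkcond /= (bigD1 i) //=.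
    rewrite mnmE eqxx big1 ?addn0; first by case: (_ \in _).
    by move=> j ne_ji; case: (_ \in _); rewrite // mnmE (negbTE ne_ji).
  by rewrite prodrN.
have D i : (u *: 'X_i : S) *: \prod_(j | j != i) (u%:MP%:MP - 'X_j) =
    \sum_(h : {set 'I_N}) (if i \in h then 0 else
     ('X_i * ((-1) ^+ #|h| * u ^+ (N - #|h|))%:MP) *: 'X_[mesym1 h]) :> {mpoly S[N]}.
  rewrite -mul_mpolyC.
  have -> : (u *: 'X_i)%:MP * \prod_(j | j != i) (u%:MP%:MP - 'X_j) =
     ('X_i)%:MP * \prod_j (u%:MP%:MP + (if j == i then 0 else - 'X_j)) :> {mpoly S[N]}.
    rewrite [in RHS](bigD1 i) //= eqxx addr0 mulrA -mpolyCM mulrC -mul_mpolyC.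
    rewrite [u%:MP * _]mulrC [RHS]mulrC; congr (_ * _).
    by apply: eq_bigr => j /negbTE ->.
  under eq_bigr do rewrite addrC.
  rewrite bigA_distr mulr_sumr; apply: eq_bigr => h _.
  case: ifP => ih.
    by rewrite (bigD1 i) //= ih eqxx mul0r mulr0.
  rewrite -mul_mpolyC mpolyCM -mulrA; congr (_ * _).
  rewrite (bigID (mem h)) /= (eq_bigr (fun j => - 'X_j)); last first.
    by move=> j jh; rewrite jh; case: eqP => // ji; rewrite -ji jh in ih.
  rewrite E (eq_bigr (fun=> u%:MP%:MP)); last by move=> j /negbTE ->.
  rewrite prodr_const mpolyCM mpolyCM.
  rewrite [RHS]mulrAC.
  rewrite card_notin.
  rewrite !rmorphXn /= !rmorphN1.
  by [].
have D0 : (1 - \sum_i 'X_i : S) *: \prod_j (u%:MP%:MP - 'X_j) =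
    \sum_(h : {set 'I_N}) ((1 - \sum_i 'X_i)  * ((-1) ^+ #|h| * u ^+ (N - #|h|))%:MP) *: 'X_[mesym1 h] :> {mpoly S[N]}.
  under eq_bigr do rewrite addrC.
  rewrite bigA_distr scaler_sumr; apply: eq_bigr => h _.
  rewrite -scalerA; congr (_ *: _).
  rewrite (bigID (mem h)) /= (eq_bigr (fun j => - 'X_j)); last by move=> j ->.
  rewrite E (eq_bigr (fun=> u%:MP%:MP)); last by move=> j /negbTE ->.
  rewrite prodr_const -mul_mpolyC !mpolyCM mulrAC.
  rewrite card_notin.
  by rewrite !rmorphXn /= !rmorphN1.
rewrite D0 (eq_bigr _ (fun i _ => D i)) exchange_big -big_split /=.
rewrite /gell.
transitivity (\sum_(a < N.+1) \sum_(h : {set 'I_N} | #|h| == a)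
    (((-1) ^+ a * u ^+ (N - a))%:MP * beta h) *: 'X_[mesym1 h] : {mpoly S[N]}).
  apply: eq_bigr => a _; rewrite /ell scaler_sumr.
  by apply: eq_bigr => h _; rewrite scalerA.
rewrite [RHS](partition_big (fun h : {set 'I_N} => inord #|h| : 'I_N.+1) xpredT) //=.
apply: eq_bigr => a _.
have cardP (h : {set 'I_N}) : (inord #|h| == a) = (#|h| == a).
  rewrite -val_eqE /= inordK // ltnS.
  by rewrite (leq_trans (max_card _)) ?card_ord.
rewrite (eq_bigl _ _ cardP); apply: eq_bigr => h /eqP ha.
rewrite ha.
rewrite (eq_bigr (fun i => (if i \in h then 0 else 'X_i * ((-1) ^+ a * u ^+ (N - a))%:MP) *: 'X_[mesym1 h])); last first.
  by move=> i _; case: ifP; rewrite ?scale0r.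
rewrite -scaler_suml -scalerDl; congr (_ *: _).
rewrite [X in _ = _ + X](eq_bigr (fun i => (if i \in h then 0 else 'X_i) * ((-1) ^+ a * u ^+ (N - a))%:MP)); last first.
  by move=> i _; case: ifP; rewrite ?mul0r.
rewrite -mulr_suml -mulrDl mulrC; congr (_ * _).
rewrite /beta [\sum_i 'X_i](bigID (mem h)) /=.
rewrite [X in _ = _ + X](bigID (mem h)) /= [X in _ = _ + (X + _)]big1 ?add0r; last by move=> i ->.
rewrite [X in _ = _ + X](eq_bigr (fun i => 'X_i)); last by move=> i /negbTE ->.
ring.
Qed.
End Generators.

(** * The operator D_2 in the roots, the points and the weights *)

Section Operators.
Context (R : realFieldType) (N : nat) (theta : R).
Notation S := {mpoly R[N]}.
Implicit Types (F G H : {mpoly S[N]}) (f g : S) (z w : 'I_N -> R).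

Definition dop (P : S) (z : 'I_N -> R) : R :=
  \sum_(i < N) z i ^+ 2 * meval z (mderiv i (mderiv i P)) +
  2 * theta * \sum_(i < N) \sum_(j < N | j != i)
    z i ^+ 2 / (z i - z j) * meval z (mderiv i P).

Definition evw w F : S := map_mpoly (meval w) F.
Definition evz z F : S := meval (fun i => (z i)%:MP) F.

Lemma evwM w F G : evw w (F * G) = evw w F * evw w G.
Proof. exact: rmorphM. Qed.

Lemma evzM z F G : evz z (F * G) = evz z F * evz z G.
Proof. exact: rmorphM. Qed.

Lemma ev_comm z w F : (evz z F).@[w] = (evw w F).@[z].
Proof.
elim/mpolyind: F => [|c m F _ _ IH]; first by rewrite /evz /evw !raddf0.
have -> : evz z (c *: 'X_[m] + F) = evz z (c *: 'X_[m]) + evz z F by exact: raddfD.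
have -> : evw w (c *: 'X_[m] + F) = evw w (c *: 'X_[m]) + evw w F by exact: raddfD.
rewrite !mevalD IH; congr (_ + _).
rewrite /evz /evw map_mpolyZ map_mpolyX mevalZ mevalX mevalM mevalZ mevalX.
rewrite rmorph_prod /=; congr (_ * _).
by apply: eq_bigr => i _; rewrite rmorphXn /= mevalC.
Qed.

(** The derivative in the direction that moves mass from [j] to [i]; it leaves the weight of the
    point [0] unchanged. *)
Definition dd i j f : S := f^`M(i) - f^`M(j).

Lemma ddM i j f g : dd i j (f * g) = dd i j f * g + f * dd i j g.
Proof. by rewrite /dd !mderivM; ring. Qed.

Lemma ddD i j f g : dd i j (f + g) = dd i j f + dd i j g.
Proof. by rewrite /dd !mderivD; ring. Qed.

Lemma ddZ i j c f : dd i j (c *: f) = c *: dd i j f.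
Proof. by rewrite /dd !mderivZ scalerBr. Qed.

Lemma dd_lin i j c f g : dd i j (c *: f + g) = c *: dd i j f + dd i j g.
Proof. by rewrite ddD ddZ. Qed.

(* The operator [K_z] on functions of the weights, with the cross terms
   [- 2 z_i z_j / (z_i - z_j)^2] split evenly between [(i, j)] and [(j, i)]. *)
Definition kop z f : S := \sum_(i < N) \sum_(j < N | j != i)
  (- (z i * z j) / (z i - z j) ^+ 2) *:
    ('X_i * 'X_j * dd i j (dd i j f) + theta *: (('X_j - 'X_i) * dd i j f)).

(** [dsum], [ksum] and [gsum] are [dop], [kop] and the carre du champ with arbitrary families in
    place of the values of the derivatives, so that the product rules become identities between
    numbers. *)
Definition dsum (z a b : 'I_N -> R) : R :=
  \sum_(i < N) z i ^+ 2 * a i +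
  2 * theta * \sum_(i < N) \sum_(j < N | j != i) z i ^+ 2 / (z i - z j) * b i.

Definition ksum (z w : 'I_N -> R) (a b : 'I_N -> 'I_N -> R) : R :=
  \sum_(i < N) \sum_(j < N | j != i)
  (- (z i * z j) / (z i - z j) ^+ 2) * (w i * w j * a i j + theta * ((w j - w i) * b i j)).

Definition gsum (z w : 'I_N -> R) (a b : 'I_N -> R) (c d : 'I_N -> 'I_N -> R) : R :=
  \sum_(i < N) z i ^+ 2 * (a i * b i) +
  \sum_(i < N) \sum_(j < N | j != i) z i * z j / (z i - z j) ^+ 2 *
    (w i * w j * (c i j * d i j)).

Lemma dsumM z (f g : R) (a b c d : 'I_N -> R) :
  dsum z (fun i => a i * g + f * c i + 2 * (b i * d i)) (fun i => b i * g + f * d i) =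
  dsum z a b * g + f * dsum z c d + 2 * \sum_(i < N) z i ^+ 2 * (b i * d i).
Proof.
rewrite /dsum; set T := \sum_(i < N) \sum_(j < N | _) _.
have -> : T = (\sum_(i < N) \sum_(j < N | j != i) z i ^+ 2 / (z i - z j) * b i) * g
  + f * (\sum_(i < N) \sum_(j < N | j != i) z i ^+ 2 / (z i - z j) * d i).
  rewrite mulr_suml mulr_sumr -big_split; apply: eq_bigr => i _.
  rewrite mulr_suml mulr_sumr -big_split; apply: eq_bigr => j _ /=.
  ring.
set U := \sum_(i < N) _ * (_ + _).
have -> : U = (\sum_(i < N) z i ^+ 2 * a i) * g
  + f * (\sum_(i < N) z i ^+ 2 * c i)
  + 2 * \sum_(i < N) z i ^+ 2 * (b i * d i).
  rewrite mulr_suml !mulr_sumr -!big_split; apply: eq_bigr => i _ /=.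
  ring.
ring.
Qed.

Lemma ksumM z w (f g : R) (a b c d : 'I_N -> 'I_N -> R) :
  ksum z w (fun i j => a i j * g + f * c i j + 2 * (b i j * d i j))
    (fun i j => b i j * g + f * d i j) =
  ksum z w a b * g + f * ksum z w c d
  - 2 * \sum_(i < N) \sum_(j < N | j != i) z i * z j / (z i - z j) ^+ 2 *
    (w i * w j * (b i j * d i j)).
Proof.
rewrite /ksum mulr_suml !mulr_sumr -sumrN -!big_split.
apply: eq_bigr => i _ /=.
rewrite mulr_suml !mulr_sumr -sumrN -!big_split.
apply: eq_bigr => j _ /=; ring.
Qed.

Lemma gsumC z w a b c d : gsum z w a b c d = gsum z w b a d c.
Proof.
rewrite /gsum; congr (_ + _); apply: eq_bigr => i _; first by rewrite (mulrC (a i)).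
by apply: eq_bigr => j _; rewrite (mulrC (c i j)).
Qed.

Lemma gsumDr z w (f g : R) a b b' c d d' :
  gsum z w a (fun i => b i * g + f * b' i) c (fun i j => d i j * g + f * d' i j) =
  gsum z w a b c d * g + f * gsum z w a b' c d'.
Proof.
rewrite /gsum !mulrDl !mulrDr addrACA; congr (_ + _).
  by rewrite mulr_suml mulr_sumr -big_split; apply: eq_bigr => i _ /=; ring.
rewrite mulr_suml mulr_sumr -big_split; apply: eq_bigr => i _ /=.
by rewrite mulr_suml mulr_sumr -big_split; apply: eq_bigr => j _ /=; ring.
Qed.

Lemma dsum_lin z (g : R) a b a' b' :
  dsum z (fun i => g * a i + a' i) (fun i => g * b i + b' i) =
  g * dsum z a b + dsum z a' b'.
Proof.
rewrite /dsum mulrDr addrACA; congr (_ + _).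
  by rewrite mulr_sumr -big_split; apply: eq_bigr => i _ /=; ring.
rewrite mulrCA -mulrDr; congr (_ * _).
rewrite mulr_sumr -big_split; apply: eq_bigr => i _ /=.
by rewrite mulr_sumr -big_split; apply: eq_bigr => j _ /=; ring.
Qed.

Lemma eq_dsum z a b a' b' : a =1 a' -> b =1 b' -> dsum z a b = dsum z a' b'.
Proof.
move=> Ha Hb; rewrite /dsum (eq_bigr _ (fun i _ => congr1 _ (Ha i))).
congr (_ + _ * _); apply: eq_bigr => i _; apply: eq_bigr => j _.
by rewrite Hb.
Qed.

Lemma eq_ksum z w a b a' b' : a =2 a' -> b =2 b' -> ksum z w a b = ksum z w a' b'.
Proof.
move=> Ha Hb; apply: eq_bigr => i _; apply: eq_bigr => j _.
by rewrite Ha Hb.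
Qed.

Lemma eq_gsum z w a b c d a' b' c' d' : a =1 a' -> b =1 b' -> c =2 c' -> d =2 d' ->
  gsum z w a b c d = gsum z w a' b' c' d'.
Proof.
move=> Ha Hb Hc Hd; rewrite /gsum; congr (_ + _); apply: eq_bigr => i _.
  by rewrite Ha Hb.
by apply: eq_bigr => j _; rewrite Hc Hd.
Qed.

Lemma kop_ksum z w f : (kop z f).@[w] =
  ksum z w (fun i j => (dd i j (dd i j f)).@[w]) (fun i j => (dd i j f).@[w]).
Proof.
rewrite /kop raddf_sum; apply: eq_bigr => i _; rewrite raddf_sum; apply: eq_bigr => j _ /=.
move: (dd i j f) (dd i j (dd i j f)) => A B.
by rewrite !(mevalZ, mevalB, mevalD, mevalM, mevalXU).
Qed.

Definition jop z w F : R := dop (evw w F) z - (kop z (evz z F)).@[w].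

(* The carre du champ of [jop]: see [jopM]. *)
Definition gam z w F G : R :=
  gsum z w (fun i => (evw w F)^`M(i).@[z]) (fun i => (evw w G)^`M(i).@[z])
    (fun i j => (dd i j (evz z F)).@[w]) (fun i j => (dd i j (evz z G)).@[w]).

Lemma gamC z w F G : gam z w F G = gam z w G F.
Proof. exact: gsumC. Qed.

Lemma dopE f z : dop f z = dsum z (fun i => f^`M(i)^`M(i).@[z]) (fun i => f^`M(i).@[z]).
Proof. by []. Qed.

Lemma dopM f g z : dop (f * g) z = dop f z * g.@[z] + f.@[z] * dop g z +
  2 * \sum_(i < N) z i ^+ 2 * (f^`M(i).@[z] * g^`M(i).@[z]).
Proof.
rewrite !dopE -dsumM; apply: eq_dsum => i.
  rewrite mderivM mderivD !mderivM.
  move: (f^`M(i)) (g^`M(i)) (f^`M(i)^`M(i)) (g^`M(i)^`M(i)) => A B C D.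
  by rewrite !mevalD !mevalM; ring.
rewrite mderivM; move: (f^`M(i)) (g^`M(i)) => A B.
by rewrite mevalD !mevalM.
Qed.

Lemma kopM z w f g : (kop z (f * g)).@[w] =
  (kop z f).@[w] * g.@[w] + f.@[w] * (kop z g).@[w]
  - 2 * \sum_(i < N) \sum_(j < N | j != i) z i * z j / (z i - z j) ^+ 2 *
    (w i * w j * ((dd i j f).@[w] * (dd i j g).@[w])).
Proof.
rewrite !kop_ksum -ksumM; apply: eq_ksum => i j.
  rewrite ddM ddD !ddM.
  move: (dd i j f) (dd i j g) (dd i j (dd i j f)) (dd i j (dd i j g)) => A B C D.
  by rewrite !mevalD !mevalM; ring.
rewrite ddM; move: (dd i j f) (dd i j g) => A B.
by rewrite mevalD !mevalM.
Qed.

Lemma leibniz_rearrange (A B C D E E' T1 T2 : R) :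
  A * E' + E * B + 2 * T1 - (C * E' + E * D - 2 * T2) =
  (A - C) * E' + E * (B - D) + 2 * (T1 + T2).
Proof. by ring. Qed.

Lemma linear_rearrange (c A B C D : R) :
  c * A + B - (c * C + D) = c * (A - C) + (B - D).
Proof. by ring. Qed.

Lemma jopM z w F G : jop z w (F * G) =
  jop z w F * (evw w G).@[z] + (evw w F).@[z] * jop z w G + 2 * gam z w F G.
Proof.
rewrite /jop evwM evzM dopM kopM !ev_comm /gam /gsum.
exact: leibniz_rearrange.
Qed.

Lemma gamM z w H F G : gam z w H (F * G) =
  gam z w H F * (evw w G).@[z] + (evw w F).@[z] * gam z w H G.
Proof.
rewrite /gam -gsumDr; apply: eq_gsum => // [i|i j].
  rewrite evwM mderivM; move: ((evw w F)^`M(i)) ((evw w G)^`M(i)) => A B.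
  by rewrite mevalD !mevalM.
rewrite evzM ddM; move: (dd i j (evz z F)) (dd i j (evz z G)) => A B.
by rewrite mevalD !mevalM !ev_comm.
Qed.

Lemma evw_lin w (c : R) F G :
  evw w (c%:MP *: F + G) = c *: evw w F + evw w G.
Proof. by rewrite /evw raddfD /= map_mpolyZ /= mevalC. Qed.

Lemma evz_lin z (c : R) F G :
  evz z (c%:MP *: F + G) = c *: evz z F + evz z G.
Proof. by rewrite /evz mevalD mevalZ mul_mpolyC. Qed.

Lemma dop_lin z c f g : dop (c *: f + g) z = c * dop f z + dop g z.
Proof.
rewrite !dopE -dsum_lin; by apply: eq_dsum => i; rewrite !linearP.
Qed.

Lemma kop_lin z c f g : kop z (c *: f + g) = c *: kop z f + kop z g.
Proof.
rewrite /kop scaler_sumr -big_split; apply: eq_bigr => i _ /=.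
rewrite scaler_sumr -big_split; apply: eq_bigr => j _ /=.
rewrite !dd_lin.
move: (dd i j f) (dd i j g) (dd i j (dd i j f)) (dd i j (dd i j g)) => A B C D.
rewrite -!mul_mpolyC.
ring.
Qed.

Lemma jop_lin z w (c : R) F G :
  jop z w (c%:MP *: F + G) = c * jop z w F + jop z w G.
Proof.
rewrite /jop evw_lin evz_lin dop_lin kop_lin mevalD mevalZ.
exact: linear_rearrange.
Qed.

Lemma gam_lin z w (c : R) H F G :
  gam z w H (c%:MP *: F + G) = c * gam z w H F + gam z w H G.
Proof.
rewrite mulrC -[gam z w H G in RHS]mul1r /gam -gsumDr; apply: eq_gsum => // [i|i j].
  rewrite evw_lin mderivD mderivZ; move: ((evw w F)^`M(i)) ((evw w G)^`M(i)) => A B.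
  by rewrite mevalD mevalZ mul1r mulrC.
rewrite evz_lin dd_lin; move: (dd i j (evz z F)) (dd i j (evz z G)) => A B.
by rewrite mevalD mevalZ mul1r mulrC.
Qed.

Lemma evw0 w : evw w 0 = 0. Proof. exact: raddf0. Qed.
Lemma evz0 z : evz z 0 = 0. Proof. exact: raddf0. Qed.

Lemma evw1 w : evw w 1 = 1. Proof. exact: rmorph1. Qed.
Lemma jop0 z w : jop z w 0 = 0.
Proof. by have := jop_lin z w 1 0 0; rewrite scaler0 addr0 mul1r -[LHS]addr0 => /addrI. Qed.

Lemma gam0 z w H : gam z w H 0 = 0.
Proof. by have := gam_lin z w 1 H 0 0; rewrite scaler0 addr0 mul1r -[LHS]addr0 => /addrI. Qed.

Lemma jop1 z w : jop z w 1 = 0.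
Proof.
rewrite /jop /evw /evz !rmorph1 /dop /kop big1 ?add0r; last first.
  by move=> i _; rewrite -mpolyC1 mderivC mderiv0 meval0 mulr0.
rewrite big1 ?mulr0 ?sub0r; last first.
  by move=> i _; rewrite big1 // => j _; rewrite -mpolyC1 mderivC meval0 mulr0.
rewrite big1 ?meval0 ?oppr0 // => i _; rewrite big1 // => j _.
by rewrite /dd -mpolyC1 !mderivC subrr !mderiv0 subrr !mulr0 scaler0 addr0 scaler0.
Qed.

Lemma gam1 z w H : gam z w H 1 = 0.
Proof.
by have := gamM z w H 1 1; rewrite mulr1 /evw rmorph1 meval1 mulr1 mul1r -[LHS]addr0 => /addrI.
Qed.

(* A second-order operator is determined on products of generators by its
   values and those of its carre du champ on the generators. *)
Lemma jop_prod_transfer z w z' w' (I : Type) (s : seq I) (L : I -> {mpoly S[N]}) :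
  (forall a, (evw w (L a)).@[z] = (evw w' (L a)).@[z']) ->
  (forall a, jop z w (L a) = jop z' w' (L a)) ->
  (forall a b, gam z w (L a) (L b) = gam z' w' (L a) (L b)) ->
  (evw w (\prod_(a <- s) L a)).@[z] = (evw w' (\prod_(a <- s) L a)).@[z'] /\
  jop z w (\prod_(a <- s) L a) = jop z' w' (\prod_(a <- s) L a).
Proof.
move=> Hev Hj Hg.
suff : [/\ (evw w (\prod_(a <- s) L a)).@[z] = (evw w' (\prod_(a <- s) L a)).@[z'],
  jop z w (\prod_(a <- s) L a) = jop z' w' (\prod_(a <- s) L a) &
  forall b, gam z w (L b) (\prod_(a <- s) L a) = gam z' w' (L b) (\prod_(a <- s) L a)].
  by move=> [H1 H2 _]; exact: (conj H1 H2).
elim: s => [|a s [IH1 IH2 IH3]].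
  rewrite big_nil; split; first by rewrite !evw1 !meval1.
    by rewrite !jop1.
  by move=> b; rewrite !gam1.
rewrite !big_cons; split.
- rewrite 2!evwM 2!mevalM Hev IH1; exact: erefl.
- rewrite 2!jopM Hev Hj IH1 IH2 IH3; exact: erefl.
- move=> b; rewrite 2!gamM Hev Hg IH1 IH3; exact: erefl.
Qed.

End Operators.

Section DoubleSums.
Context (R : realFieldType) (N : nat).
Implicit Types (a b : 'I_N -> R).

Lemma sum_offdiag_mul a b :
  \sum_(i < N) \sum_(j < N | j != i) a i * b j =
  (\sum_i a i) * (\sum_i b i) - \sum_i a i * b i.
Proof.
rewrite mulr_suml -sumrB; apply: eq_bigr => i _.
by rewrite [in RHS](bigD1 i) //= mulrDr addrAC subrr add0r mulr_sumr.
Qed.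

Lemma sum_offdiag_const (c : R) :
  \sum_(i < N) \sum_(j < N | j != i) c = N%:R * (N%:R - 1) * c.
Proof.
have := sum_offdiag_mul (fun=> 1) (fun=> c).
under eq_bigr do under eq_bigr do rewrite mul1r.
move=> ->; under [X in _ - X]eq_bigr do rewrite mul1r.
by rewrite !sumr_const card_ord -[c *+ N]mulr_natl; ring.
Qed.

Lemma sum_offdiag_sym (f : 'I_N -> 'I_N -> R) :
  \sum_(i < N) \sum_(j < N | j != i) f i j =
  \sum_(i < N) \sum_(j < N | j != i) (f i j + f j i) / 2.
Proof.
have E : \sum_(i < N) \sum_(j < N | j != i) f i j =
         \sum_(i < N) \sum_(j < N | j != i) f j i.
  rewrite (exchange_big_dep xpredT) //=; apply: eq_bigr => i _.
  by apply: eq_bigl => j; rewrite eq_sym.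
under [RHS]eq_bigr => i _ do rewrite -mulr_suml big_split /=.
by rewrite -mulr_suml big_split /= -E; field.
Qed.

End DoubleSums.

(** * Derivatives of the generating polynomial *)

Section GeneratorValues.
Context (R : realFieldType) (N : nat) (theta : R).
Notation S := {mpoly R[N]}.
Implicit Types (z w : 'I_N -> R) (u v : R).

Lemma meval_sum (I : Type) (r : seq I) (P : pred I) (F : I -> S) w :
  (\sum_(i <- r | P i) F i).@[w] = \sum_(i <- r | P i) (F i).@[w].
Proof. exact: raddf_sum. Qed.

Lemma mderiv_sum (I : Type) (r : seq I) (P : pred I) (F : I -> S) k :
  (\sum_(i <- r | P i) F i)^`M(k) = \sum_(i <- r | P i) (F i)^`M(k).
Proof. exact: raddf_sum. Qed.

Definition vprod z u : R := \prod_j (u - z j).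
(** The quotient of [genfun z w] by [\prod_j ('X - z j)] at [u], in partial fractions. *)
Definition vrho z w u : R := 1 + \sum_i w i * z i / (u - z i).

Lemma vprodD1 z u (i : 'I_N) : u != z i ->
  \prod_(j | j != i) (u - z j) = vprod z u / (u - z i).
Proof.
by move=> ui; rewrite /vprod [in RHS](bigD1 i) //= mulrAC divff ?mul1r // subr_eq0.
Qed.

Lemma vrhoE z w u : (forall i, u != z i) ->
  vrho z w u = (1 - \sum_i w i) + u * \sum_i w i / (u - z i).
Proof.
move=> uz; rewrite -addrA; congr (_ + _).
rewrite mulr_sumr addrC -sumrB; apply: eq_bigr => i _.
field; by rewrite subr_eq0.
Qed.

Lemma evw_gell w u : evw w (gell N u) =
  (1 - \sum_i w i) *: \prod_j (u%:MP - 'X_j : S) +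
  \sum_i (u * w i) *: \prod_(j | j != i) (u%:MP - 'X_j : S).
Proof.
have E (P : pred 'I_N) : map_mpoly (meval w) (\prod_(j | P j) (u%:MP%:MP - 'X_j)) =
   \prod_(j | P j) (u%:MP - 'X_j : S).
  rewrite rmorph_prod /=; apply: eq_bigr => j _.
  by rewrite rmorphB /= map_mpolyC map_mpolyX /= mevalC.
rewrite /evw gellE raddfD /= map_mpolyZ /= E; congr (_ *: _ + _).
  by rewrite mevalB meval1 meval_sum; congr (_ - _); apply: eq_bigr => i _ /=; rewrite mevalXU.
rewrite (raddf_sum (map_mpoly (meval w))); apply: eq_bigr => i _ /=.
by rewrite map_mpolyZ /= E mevalZ mevalXU.
Qed.

Lemma evz_gell z u : evz z (gell N u) =
  vprod z u *: (1 - \sum_i 'X_i : S) +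
  \sum_i (u * \prod_(j | j != i) (u - z j)) *: 'X_i.
Proof.
have E (P : pred 'I_N) : meval (fun i => (z i)%:MP) (\prod_(j | P j) (u%:MP%:MP - 'X_j)) =
   (\prod_(j | P j) (u - z j))%:MP :> S.
  rewrite rmorph_prod rmorph_prod /=; apply: eq_bigr => j _.
  by rewrite mevalB mevalC mevalXU mpolyCB.
rewrite /evz gellE mevalD mevalZ E mulrC mul_mpolyC; congr (_ *: _ + _).
rewrite (raddf_sum (meval (fun i => (z i)%:MP))); apply: eq_bigr => i _ /=.
by rewrite mevalZ E mulrC mul_mpolyC scalerA mulrC.
Qed.

Lemma mderiv_prod_XsubC u (k : 'I_N) (P : pred 'I_N) :
  (\prod_(j | P j) (u%:MP - 'X_j : S))^`M(k) =
  if P k then - \prod_(j | P j && (j != k)) (u%:MP - 'X_j : S) else 0.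
Proof.
have D0 (Q : pred 'I_N) : ~~ Q k -> (\prod_(j | Q j) (u%:MP - 'X_j : S))^`M(k) = 0.
  move=> Qk; apply: (big_ind (fun p : S => p^`M(k) = 0)).
  - by rewrite -mpolyC1 mderivC.
  - by move=> p q pk qk; rewrite mderivM pk qk mul0r mulr0 addr0.
  - move=> j Qj; rewrite mderivB mderivC sub0r mderivX mnmE.
    by case: eqP Qj Qk => [->->//|_ _ _]; rewrite scale0r oppr0.
case: ifP => [Pk|/negbT /D0 //].
rewrite (bigD1 k) //= mderivM D0 ?eqxx ?andbF // mulr0 addr0.
rewrite mderivB mderivC sub0r mderivX mnmE eqxx scale1r.
suff -> : (U_(k) - U_(k))%MM = 0%MM :> 'X_{1..N} by rewrite mpolyX0 mulN1r.
by apply/mnmP => i; rewrite mnmBE subnn mnm0E.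
Qed.

Lemma meval_prod_XsubC u z (P : pred 'I_N) :
  (\prod_(j | P j) (u%:MP - 'X_j : S)).@[z] = \prod_(j | P j) (u - z j).
Proof.
rewrite rmorph_prod; apply: eq_bigr => j _ /=.
by rewrite mevalB mevalC mevalXU.
Qed.

Lemma evw_gell_val z w u : (forall i, u != z i) ->
  (evw w (gell N u)).@[z] = vprod z u * vrho z w u.
Proof.
move=> uz; rewrite evw_gell mevalD mevalZ meval_prod_XsubC vrhoE // -/(vprod z u).
rewrite mulrDr [_ * vprod _ _]mulrC; congr (_ + _).
rewrite meval_sum !mulr_sumr; apply: eq_bigr => i _ /=.
rewrite mevalZ meval_prod_XsubC vprodD1 //; field; by rewrite subr_eq0.
Qed.

Lemma evw_gell_deriv z w u k : (forall i, u != z i) ->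
  (evw w (gell N u))^`M(k).@[z] =
  - (vprod z u / (u - z k)) * (vrho z w u - u * w k / (u - z k)).
Proof.
move=> uz; rewrite evw_gell mderivD mderivZ mderiv_prod_XsubC /=.
rewrite mevalD mevalZ mevalN meval_prod_XsubC vprodD1 // mderiv_sum meval_sum /=.
rewrite [X in _ + X = _](bigD1 k) //= mderivZ mderiv_prod_XsubC eqxx /= scaler0 meval0 add0r.
rewrite vrhoE // [\sum_i w i / _](bigD1 k) //=.
set T := (X in _ + X = _).
have -> : T = - (vprod z u / (u - z k)) * (u * \sum_(i | i != k) w i / (u - z i)).
  rewrite !mulr_sumr; apply: eq_bigr => i ik.
  rewrite mderivZ mderiv_prod_XsubC eq_sym ik mevalZ mevalN meval_prod_XsubC.
  have -> : \prod_(j | (j != i) && (j != k)) (u - z j) = vprod z u / (u - z k) / (u - z i).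
    rewrite -vprodD1 // [in RHS](bigD1 i) //= mulrAC divff ?subr_eq0 // mul1r.
    by apply: eq_bigl => j; rewrite andbC.
  field; by rewrite !subr_eq0 !uz.
field; by rewrite !subr_eq0 !uz.
Qed.

(** [gell] has degree at most one in each point, so the second-order part of [D_2] vanishes on
    it. *)
Lemma evw_gell_deriv2 z w u k : (evw w (gell N u))^`M(k)^`M(k).@[z] = 0.
Proof.
have D (P : pred 'I_N) : (\prod_(j | P j) (u%:MP - 'X_j : S))^`M(k)^`M(k) = 0.
  rewrite mderiv_prod_XsubC; case: ifP => _; last by rewrite mderiv0.
  by rewrite mderivN mderiv_prod_XsubC eqxx andbF oppr0.
rewrite evw_gell !mderivD !mderivZ D scaler0 add0r.
set T := \sum_(i < N) _.
suff -> : T^`M(k)^`M(k) = 0 by rewrite meval0.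
apply: (big_ind (fun p : S => p^`M(k)^`M(k) = 0)).
- by rewrite !mderiv0.
- by move=> p q p0 q0; rewrite !mderivD p0 q0 addr0.
- by move=> i _; rewrite !mderivZ D scaler0.
Qed.

Lemma mderiv_affine (c : R) (d : 'I_N -> R) k :
  (c *: (1 - \sum_i 'X_i : S) + \sum_i d i *: 'X_i)^`M(k) = (d k - c)%:MP.
Proof.
have DX i : ('X_i : S)^`M(k) = (i == k)%:R%:MP.
  rewrite mderivX mnmE; case: eqP => [->|_]; last by rewrite scale0r mpolyC0.
  suff -> : (U_(k) - U_(k))%MM = 0%MM :> 'X_{1..N} by rewrite mpolyX0 scale1r mpolyC1.
  by apply/mnmP => j; rewrite mnmBE subnn mnm0E.
rewrite mderivD mderivZ mderivB -mpolyC1 mderivC sub0r !mderiv_sum.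
rewrite (bigD1 k) //= DX eqxx big1 ?addr0; last by move=> i /negbTE ik; rewrite DX ik mpolyC0.
rewrite (bigD1 k) //= mderivZ DX eqxx big1 ?addr0; last first.
  by move=> i /negbTE ik; rewrite mderivZ DX ik mpolyC0 scaler0.
by rewrite mpolyCB -[d k in RHS]mulr1 mpolyCM mul_mpolyC addrC scalerN -[c in RHS]mulr1 mpolyCM mul_mpolyC.
Qed.

(** For fixed points [gell] is affine in the weights: [dd] of it is a constant, and the second-order
    part of [kop] vanishes on it. *)
Lemma dd_gell z u i j : (forall i, u != z i) ->
  dd i j (evz z (gell N u)) = (u * vprod z u * (z i - z j) / ((u - z i) * (u - z j)))%:MP.
Proof.
move=> uz; rewrite /dd evz_gell !mderiv_affine -mpolyCB; congr (_%:MP).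
rewrite !vprodD1 //; field; by rewrite !subr_eq0 !uz.
Qed.

Lemma genfunE z w : genfun z w =
  \prod_j ('X - (z j)%:P) + \sum_i (w i * z i) *: \prod_(j | j != i) ('X - (z j)%:P).
Proof.
rewrite /genfun scalerBl scale1r -addrA; congr (_ + _).
rewrite scaler_suml addrC -sumrB; apply: eq_bigr => i _.
rewrite -scalerBr -scalerA; congr (_ *: _).
rewrite [in X in _ - X](bigD1 i) //= -mulrBl opprB addrC subrK.
by rewrite mul_polyC.
Qed.

Lemma deriv_prod_XsubC_seq z u (s : seq 'I_N) : (forall i, u != z i) ->
  let Q := \prod_(j <- s) ('X - (z j)%:P) in
  [/\ Q^`().[u] = Q.[u] * \sum_(j <- s) (u - z j)^-1 &
  Q^`()^`().[u] = Q.[u] * ((\sum_(j <- s) (u - z j)^-1) ^+ 2 - \sum_(j <- s) (u - z j)^-1 ^+ 2)].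
Proof.
move=> uz; elim: s => [|i s [IH1 IH2]] /=.
  by rewrite !big_nil derivC deriv0 !horner0 mulr0 expr0n subrr mulr0.
have ui : u - z i != 0 by rewrite subr_eq0.
rewrite !big_cons; split.
  rewrite derivM derivXsubC mul1r hornerD !hornerM IH1 hornerXsubC; field.
  by rewrite ui.
rewrite !derivM derivXsubC mul1r derivD derivM derivXsubC mul1r !hornerD !hornerM IH1 IH2.
rewrite hornerXsubC; field; by rewrite ui.
Qed.

Lemma deriv_prod_XsubC z u (P : pred 'I_N) : (forall i, u != z i) ->
  let Q := \prod_(j | P j) ('X - (z j)%:P) in
  [/\ Q.[u] = \prod_(j | P j) (u - z j),
   Q^`().[u] = Q.[u] * \sum_(j | P j) (u - z j)^-1 &
   Q^`()^`().[u] = Q.[u] * ((\sum_(j | P j) (u - z j)^-1) ^+ 2 - \sum_(j | P j) (u - z j)^-1 ^+ 2)].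
Proof.
move=> uz /=; split; first by rewrite horner_prod; apply: eq_bigr => j _; rewrite hornerXsubC.
  by rewrite -!(big_filter _ P); case: (deriv_prod_XsubC_seq [seq i <- index_enum _ | P i] uz).
by rewrite -!(big_filter _ P); case: (deriv_prod_XsubC_seq [seq i <- index_enum _ | P i] uz).
Qed.

(** [xi1] is the logarithmic derivative of [vprod], while [vrho] has first derivative [- tau 2] and
    second derivative [2 tau 3]. *)
Definition xi1 z u : R := \sum_i (u - z i)^-1.
Definition xi2 z u : R := \sum_i (u - z i)^-1 ^+ 2.
Definition tau z w (k : nat) u : R := \sum_i w i * z i * (u - z i)^-1 ^+ k.

Lemma vrho_tau z w u : vrho z w u = 1 + tau z w 1 u.
Proof. by []. Qed.

Lemma genfun_val z w u : (forall i, u != z i) ->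
  (genfun z w).[u] = vprod z u * vrho z w u.
Proof.
move=> uz; rewrite genfunE hornerD horner_sum.
have [-> _ _] := deriv_prod_XsubC xpredT uz; rewrite mulrDr mulr1; congr (_ + _).
rewrite mulr_sumr; apply: eq_bigr => i _; rewrite hornerZ.
have [-> _ _] := deriv_prod_XsubC (fun j => j != i) uz.
rewrite vprodD1 //; field; by rewrite subr_eq0.
Qed.

Lemma genfun_deriv z w u : (forall i, u != z i) ->
  (genfun z w)^`().[u] = vprod z u * (xi1 z u * vrho z w u - tau z w 2 u).
Proof.
move=> uz; rewrite genfunE derivD raddf_sum hornerD horner_sum /=.
have [A B _] := deriv_prod_XsubC xpredT uz.
rewrite B A vrho_tau (mulrDr (xi1 z u)) mulr1 -addrA [RHS]mulrDr; congr (_ + _).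
rewrite /tau mulr_sumr -sumrB mulr_sumr; apply: eq_bigr => i _; rewrite derivZ hornerZ.
have [A1 B1 _] := deriv_prod_XsubC (fun j => j != i) uz; rewrite B1 A1.
rewrite vprodD1 // /xi1 [in RHS](bigD1 i) //=.
have ui : u - z i != 0 by rewrite subr_eq0.
by field; rewrite ui.
Qed.

Lemma genfun_deriv2 z w u : (forall i, u != z i) ->
  (genfun z w)^`()^`().[u] = vprod z u *
    (vrho z w u * (xi1 z u ^+ 2 - xi2 z u) - 2 * (xi1 z u * tau z w 2 u - tau z w 3 u)).
Proof.
move=> uz; rewrite genfunE !derivD ![in LHS]raddf_sum hornerD horner_sum /=.
have [A _ B] := deriv_prod_XsubC xpredT uz.
rewrite B A vrho_tau mulrDl mul1r -addrA [RHS]mulrDr; congr (_ + _).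
rewrite /tau mulr_suml !mulr_sumr -sumrB !mulr_sumr -sumrB mulr_sumr.
apply: eq_bigr => i _; rewrite !derivZ hornerZ.
have [A1 _ B1] := deriv_prod_XsubC (fun j => j != i) uz; rewrite B1 A1.
have X1 : xi1 z u = (u - z i)^-1 + \sum_(j | j != i) (u - z j)^-1 by rewrite /xi1 (bigD1 i).
have X2 : xi2 z u = (u - z i)^-1 ^+ 2 + \sum_(j | j != i) (u - z j)^-1 ^+ 2 by rewrite /xi2 (bigD1 i).
rewrite vprodD1 // X1 X2.
have ui : u - z i != 0 by rewrite subr_eq0.
by field; rewrite ui.
Qed.

End GeneratorValues.

(** * From points and weights to roots *)

Section Transfer.
Context (R : realFieldType) (N : nat) (theta : R).
Notation S := {mpoly R[N]}.
Implicit Types (z w : 'I_N -> R) (u v : R).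

(** The right-hand side depends on [z] and [w] only through [genfun z w]; the transfer to the roots
    rests on this. *)
Lemma gam_gell z w u v : injective z -> (forall i, u != z i) -> (forall i, v != z i) ->
  (v - u) * gam z w (gell N u) (gell N v) =
  u ^+ 2 * (genfun z w)^`().[u] * (genfun z w).[v]
  - v ^+ 2 * (genfun z w).[u] * (genfun z w)^`().[v]
  + N%:R * (v - u) * (genfun z w).[u] * (genfun z w).[v].
Proof.
move=> injz uz vz; have [->|uv] := eqVneq u v; first by rewrite subrr; ring.
have d0 : v - u != 0 by rewrite subr_eq0 eq_sym.
have u0 i : u - z i != 0 by rewrite subr_eq0.
have v0 i : v - z i != 0 by rewrite subr_eq0.
rewrite !genfun_val // !genfun_deriv //.
pose A := \sum_i z i ^+ 2 / (u - z i) / (v - z i).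
pose B := \sum_i w i * z i ^+ 2 / (u - z i) ^+ 2 / (v - z i).
pose C := \sum_i w i * z i ^+ 2 / (u - z i) / (v - z i) ^+ 2.
pose Q := \sum_i w i * z i / (u - z i) / (v - z i).
pose U := vprod z u; pose V := vprod z v.
pose ru := vrho z w u; pose rv := vrho z w v.
have -> : gam z w (gell N u) (gell N v) =
   U * V * (ru * rv * A - u * rv * B - v * ru * C + u * v * Q ^+ 2).
  have -> : gam z w (gell N u) (gell N v) = gsum z w
      (fun i => - (U / (u - z i)) * (ru - u * w i / (u - z i)))
      (fun i => - (V / (v - z i)) * (rv - v * w i / (v - z i)))
      (fun i j => u * U * (z i - z j) / ((u - z i) * (u - z j)))
      (fun i j => v * V * (z i - z j) / ((v - z i) * (v - z j))).
    apply: eq_gsum => [i|i|i j|i j].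
    - exact: evw_gell_deriv.
    - exact: evw_gell_deriv.
    - by rewrite dd_gell // mevalC.
    - by rewrite dd_gell // mevalC.
  rewrite /gsum.
  (* The squares collected in [D] are the diagonal that the double sum over [j != i] lacks; together
     they give [Q ^+ 2]. *)
  pose D := \sum_i (z i * w i) ^+ 2 / (u - z i) ^+ 2 / (v - z i) ^+ 2.
  rewrite (eq_bigr (fun i => U * V * (ru * rv * (z i ^+ 2 / (u - z i) / (v - z i))
     - u * rv * (w i * z i ^+ 2 / (u - z i) ^+ 2 / (v - z i))
     - v * ru * (w i * z i ^+ 2 / (u - z i) / (v - z i) ^+ 2)
     + u * v * ((z i * w i) ^+ 2 / (u - z i) ^+ 2 / (v - z i) ^+ 2)))); last first.
    move=> i _; have := u0 i; have := v0 i.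
    move: (z i) (w i) U V ru rv => zi wi U' V' ru' rv' a b; field; by rewrite a b.
  rewrite -mulr_sumr big_split /= !sumrB -!mulr_sumr -/A -/B -/C -/D.
  rewrite (eq_bigr (fun i => \sum_(j < N | j != i) (u * v * U * V) *
     ((w i * z i / (u - z i) / (v - z i)) * (w j * z j / (u - z j) / (v - z j))))); last first.
    move=> i _; apply: eq_bigr => j ji.
    field; rewrite !u0 !v0 subr_eq0 /=; apply: contraNneq ji => /injz ->; by rewrite eqxx.
  under eq_bigr do rewrite -mulr_sumr.
  rewrite -mulr_sumr sum_offdiag_mul -/Q.
  have -> : \sum_i w i * z i / (u - z i) / (v - z i) * (w i * z i / (u - z i) / (v - z i)) = D.
    by apply: eq_bigr => i _; field; rewrite u0 v0.
  ring.
pose s1 := \sum_i z i; pose tu1 := tau z w 1 u; pose tv1 := tau z w 1 v.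
pose tu2 := tau z w 2 u; pose tv2 := tau z w 2 v; pose xu := xi1 z u; pose xv := xi1 z v.
(* Multiplying by powers of [v - u] separates the two variables by partial fractions, leaving only
   sums at [u] and sums at [v]. *)
have eA : (v - u) * A = (u ^+ 2 * xu - v ^+ 2 * xv) - (u - v) * N%:R.
  rewrite /A /xu /xv /xi1 !mulr_sumr -sumrB.
  rewrite -[N in N%:R]card_ord -sum1_card natr_sum mulr_sumr -sumrB.
  by apply: eq_bigr => i _; field; rewrite u0 v0.
have eQ : (v - u) * Q = tu1 - tv1.
  rewrite /Q /tu1 /tv1 /tau mulr_sumr -sumrB.
  by apply: eq_bigr => i _; field; rewrite u0 v0.
have eB : (v - u) ^+ 2 * B = (v - u) * (u * tu2 - tu1) - (u * tu1 - v * tv1).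
  rewrite /B /tu1 /tv1 /tu2 /tau !mulr_sumr -!sumrB mulr_sumr -sumrB.
  by apply: eq_bigr => i _; field; rewrite u0 v0.
have eC : (v - u) ^+ 2 * C = (u - v) * (v * tv2 - tv1) - (v * tv1 - u * tu1).
  rewrite /C /tu1 /tv1 /tv2 /tau !mulr_sumr -!sumrB mulr_sumr -sumrB.
  by apply: eq_bigr => i _; field; rewrite u0 v0.
apply: (mulfI d0).
have ru1 : ru = 1 + tu1 by [].
have rv1 : rv = 1 + tv1 by [].
rewrite -/U -/V -/ru -/rv -/xu -/xv -/tu2 -/tv2.
transitivity (U * V * (ru * rv * (v - u) * ((v - u) * A) - u * rv * ((v - u) ^+ 2 * B)
   - v * ru * ((v - u) ^+ 2 * C) + u * v * ((v - u) * Q) ^+ 2)); first by ring.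
rewrite eA eB eC eQ ru1 rv1; ring.
Qed.

(** Again an expression in [genfun z w] alone, to which only the first-order parts of [dop] and
    [kop] contribute. *)
Lemma jop_gell z w u : injective z -> (forall i, u != z i) ->
  jop theta z w (gell N u) =
  - theta * u ^+ 2 * (genfun z w)^`()^`().[u]
  + theta * N%:R * (N%:R - 1) * (genfun z w).[u].
Proof.
move=> injz uz.
have u0 i : u - z i != 0 by rewrite subr_eq0.
have zz i j : j != i -> z i - z j != 0.
  by rewrite subr_eq0 => ji; apply: contraNneq ji => /injz ->.
rewrite genfun_val // genfun_deriv2 //.
pose U := vprod z u; pose r := vrho z w u; rewrite -/U -/r.
rewrite /jop dopE kop_ksum /dsum /ksum big1 ?add0r; last first.
  by move=> i _; rewrite evw_gell_deriv2 mulr0.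
have dd2 i j : dd i j (dd i j (evz z (gell N u))) = 0.
  by rewrite dd_gell // /dd !mderivC subrr.
transitivity (theta * U * \sum_(i < N) \sum_(j < N | j != i)
   (- 2 * z i ^+ 2 / (z i - z j) / (u - z i) * (r - u * w i / (u - z i))
    + u * z i * z j / (z i - z j) * (w j - w i) / (u - z i) / (u - z j))).
  rewrite !mulr_sumr -sumrB; apply: eq_bigr => i _.
  rewrite !mulr_sumr -sumrB; apply: eq_bigr => j ji.
  rewrite dd2 meval0 (evw_gell_deriv w i uz) dd_gell // mevalC -/U -/r.
  by field; rewrite !u0 zz.
(* Averaging the terms of [(i, j)] and [(j, i)] cancels the denominators [z i - z j]. *)
rewrite sum_offdiag_sym.
rewrite (eq_bigr (fun i => \sum_(j < N | j != i)
  (r - r * u ^+ 2 * ((u - z i)^-1 * (u - z j)^-1) +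
   u ^+ 2 * (w i * z i * (u - z i)^-1 ^+ 2 * (u - z j)^-1)
   + u ^+ 2 * ((u - z i)^-1 * (w j * z j * (u - z j)^-1 ^+ 2))))); last first.
  move=> i _; apply: eq_bigr => j ji.
  have ij : i != j by rewrite eq_sym.
  have := zz i j ji; have := zz j i ij; have := u0 i; have := u0 j.
  move: (z i) (w i) (z j) (w j) r => zi wi zj wj r' a b c d; field.
  by rewrite a b c d.
rewrite (eq_bigr (fun i => (\sum_(j < N | j != i) r
  - r * u ^+ 2 * \sum_(j < N | j != i) ((u - z i)^-1 * (u - z j)^-1) +
   u ^+ 2 * (\sum_(j < N | j != i) w i * z i * (u - z i)^-1 ^+ 2 * (u - z j)^-1)
   + u ^+ 2 * (\sum_(j < N | j != i) (u - z i)^-1 * (w j * z j * (u - z j)^-1 ^+ 2))))); last first.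
  by move=> i _; rewrite !big_split sumrN /= -!mulr_sumr.
rewrite !big_split sumrN /= -!mulr_sumr sum_offdiag_const !sum_offdiag_mul.
rewrite -/(xi1 z u) -/(tau z w 2 u).
have -> : \sum_i (u - z i)^-1 * (u - z i)^-1 = xi2 z u.
  by apply: eq_bigr => i _; rewrite expr2.
have -> : \sum_i w i * z i * (u - z i)^-1 ^+ 2 * (u - z i)^-1 = tau z w 3 u.
  by apply: eq_bigr => i _; rewrite -mulrA -exprSr.
have -> : \sum_i (u - z i)^-1 * (w i * z i * (u - z i)^-1 ^+ 2) = tau z w 3 u.
  by apply: eq_bigr => i _; rewrite mulrCA -exprS.
ring.
Qed.

Lemma poly_finite_zeros (p : {poly R}) (s : seq R) :
  (forall u, u \notin s -> p.[u] = 0) -> p = 0.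
Proof.
move=> H; apply/eqP; apply: contraT => p0.
pose M := \sum_(x <- s) `|x|.
have sM x : x \in s -> x <= M.
  move=> xs; rewrite /M (big_rem x) //= (le_trans (ler_norm x)) // lerDl.
  exact: sumr_ge0.
pose t := [seq M + 1 + n%:R | n <- iota 0 (size p)].
have : (size t < size p)%N.
  apply: max_poly_roots => //.
    apply/allP => _ /mapP[n _ ->]; apply/rootP; apply: H; apply/negP => /sM.
    by have := ler0n R n; lra.
  rewrite map_inj_uniq ?iota_uniq // => n m /addrI /eqP.
  by rewrite eqr_nat => /eqP.
by rewrite size_map size_iota ltnn.
Qed.

(** Up to sign the generators [ell a] are the coefficients of [gell u] in [u], so an identity valid
    for all [u] outside a finite set passes to each of them. *)
Lemma gell_coef_eq (f g : nat -> R) (s : seq R) :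
  (forall u, u \notin s -> \sum_(a < N.+1) (-1) ^+ a * u ^+ (N - a) * f a =
     \sum_(a < N.+1) (-1) ^+ a * u ^+ (N - a) * g a) ->
  forall a, (a <= N)%N -> f a = g a.
Proof.
move=> H a aN.
pose p := \sum_(b < N.+1) ((-1) ^+ b * (f b - g b)) *: 'X^(N - b).
have p0 : p = 0.
  apply: (@poly_finite_zeros _ s) => u us; rewrite /p horner_sum.
  have /eqP := H u us; rewrite -subr_eq0 -sumrB => /eqP; apply: etrans.
  by apply: eq_bigr => b _; rewrite hornerZ hornerXn; ring.
have := congr1 (fun q : {poly R} => q`_(N - a)) p0; rewrite coef0 /p coef_sum.
rewrite (bigD1 (inord a)) //= big1 => [|b].
  rewrite inordK // addr0 coefZ coefXn eqxx mulr1 => /eqP.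
  by rewrite mulf_eq0 signr_eq0 /= subr_eq0 => /eqP.
rewrite -val_eqE /= inordK // => ba; rewrite coefZ coefXn.
case: eqP => [E|]; last by rewrite mulr0.
by case/negP: ba; have := ltn_ord b; lia.
Qed.

Lemma evw_gell_sum w u z : (evw w (gell N u)).@[z] =
  \sum_(a < N.+1) (-1) ^+ a * u ^+ (N - a) * (evw w (ell R N a)).@[z].
Proof.
rewrite /gell /evw (raddf_sum (map_mpoly (meval w))) meval_sum /=.
by apply: eq_bigr => a _; rewrite map_mpolyZ /= mevalZ mevalC.
Qed.

Lemma jop_gell_sum z w u : jop theta z w (gell N u) =
  \sum_(a < N.+1) (-1) ^+ a * u ^+ (N - a) * jop theta z w (ell R N a).
Proof.
rewrite /gell; elim: (index_enum _) => [|a s IH]; first by rewrite !big_nil jop0.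
by rewrite !big_cons jop_lin IH.
Qed.

Lemma gam_gell_sum z w F u : gam z w F (gell N u) =
  \sum_(a < N.+1) (-1) ^+ a * u ^+ (N - a) * gam z w F (ell R N a).
Proof.
rewrite /gell; elim: (index_enum _) => [|a s IH]; first by rewrite !big_nil gam0.
by rewrite !big_cons gam_lin IH.
Qed.

Lemma ell_big a : (N < a)%N -> ell R N a = 0.
Proof.
move=> aN; rewrite /ell big1 // => h /eqP ha.
by move: aN; rewrite -ha ltnNge (leq_trans (max_card _)) // card_ord.
Qed.

Variables (z w z' w' : 'I_N -> R).
Hypothesis gen_eq : genfun z w = genfun z' w'.

Let sz := [seq z i | i : 'I_N] ++ [seq z' i | i : 'I_N].

Let notin_sz u : u \notin sz -> (forall i, u != z i) /\ (forall i, u != z' i).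
Proof.
rewrite mem_cat negb_or => /andP[A B]; split=> i.
  by apply: contraNneq A => ->; apply/mapP; exists i => //; rewrite mem_enum.
by apply: contraNneq B => ->; apply/mapP; exists i => //; rewrite mem_enum.
Qed.

Lemma ev_ell_transfer a : (evw w (ell R N a)).@[z] = (evw w' (ell R N a)).@[z'].
Proof.
have [aN|aN] := leqP a N; last by rewrite (ell_big aN) !evw0 !meval0.
pose f a := (evw w (ell R N a)).@[z].
pose g a := (evw w' (ell R N a)).@[z'].
apply: (@gell_coef_eq f g sz) aN => u /notin_sz[uz uz'].
apply: (etrans (esym (evw_gell_sum w u z))); apply: etrans (evw_gell_sum w' u z').
by rewrite (evw_gell_val w uz) (evw_gell_val w' uz') -(genfun_val w uz) -(genfun_val w' uz') gen_eq.
Qed.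

Hypotheses (injz : injective z) (injz' : injective z').

Lemma jop_ell_transfer a : jop theta z w (ell R N a) = jop theta z' w' (ell R N a).
Proof.
have [aN|aN] := leqP a N; last by rewrite (ell_big aN) !jop0.
pose f a := jop theta z w (ell R N a).
pose g a := jop theta z' w' (ell R N a).
apply: (@gell_coef_eq f g sz) aN => u /notin_sz[uz uz'].
apply: (etrans (esym (jop_gell_sum z w u))); apply: etrans (jop_gell_sum z' w' u).
by rewrite (jop_gell w injz uz) (jop_gell w' injz' uz') gen_eq.
Qed.

Lemma gam_ell_transfer a b :
  gam z w (ell R N a) (ell R N b) = gam z' w' (ell R N a) (ell R N b).
Proof.
have [bN|bN] := leqP b N; last by rewrite (ell_big bN) !gam0.
pose f b := gam z w (ell R N a) (ell R N b).
pose g b := gam z' w' (ell R N a) (ell R N b).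
apply: (@gell_coef_eq f g sz) bN => v /notin_sz[vz vz'].
apply: (etrans (esym (gam_gell_sum z w _ v))); apply: etrans (gam_gell_sum z' w' _ v).
rewrite gamC [RHS]gamC.
have [aN|aN] := leqP a N; last by rewrite (ell_big aN) !gam0.
pose f' a := gam z w (gell N v) (ell R N a).
pose g' a := gam z' w' (gell N v) (ell R N a).
(* Here [v] joins the excluded values, because [gam_gell] carries the factor [v - u]. *)
apply: (@gell_coef_eq f' g' (v :: sz)) aN => u.
rewrite inE negb_or => /andP[uv /notin_sz[uz uz']].
apply: (etrans (esym (gam_gell_sum z w _ u))); apply: etrans (gam_gell_sum z' w' _ u).
rewrite gamC [RHS]gamC.
have d0 : v - u != 0 by rewrite subr_eq0 eq_sym.
apply: (mulfI d0).
apply: etrans (gam_gell w injz uz vz) _; apply: etrans _ (esym (gam_gell w' injz' uz' vz')).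
by rewrite gen_eq.
Qed.

Lemma prod_ell_transfer (s : seq nat) :
  (evw w (\prod_(a <- s) ell R N a)).@[z] = (evw w' (\prod_(a <- s) ell R N a)).@[z'] /\
  jop theta z w (\prod_(a <- s) ell R N a) = jop theta z' w' (\prod_(a <- s) ell R N a).
Proof.
exact: (jop_prod_transfer s ev_ell_transfer jop_ell_transfer gam_ell_transfer).
Qed.

End Transfer.

(** * Moments of the Dirichlet distribution *)

Section Rising.
Context (R : realFieldType).
Implicit Types (x : R).

Definition rise x (n : nat) : R := \prod_(j < n) (x + j%:R).

Lemma rise0 x : rise x 0 = 1. Proof. by rewrite /rise big_ord0. Qed.

Lemma riseS x n : rise x n.+1 = rise x n * (x + n%:R).
Proof. by rewrite /rise big_ord_recr. Qed.

Lemma rise_gt0 x n : 0 < x -> 0 < rise x n.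
Proof. by move=> x0; apply: prodr_gt0 => j _; rewrite ltr_pwDl. Qed.

End Rising.

Section Moments.
Context (R : realFieldType) (N : nat) (theta s0 : R).
Hypotheses (theta_gt0 : 0 < theta) (s0_gt0 : 0 < s0).
Notation S := {mpoly R[N]}.
Implicit Types (f g : S) (z w : 'I_N -> R) (m : 'X_{1..N}).

Let sg : R := s0 + N%:R * theta.

Definition dmom (m : 'X_{1..N}) : R :=
  (\prod_(i < N) rise theta (m i)) / rise (s0 + N%:R * theta) (mdeg m).

(** The Dirichlet mean, as the linear form on polynomials with moments [dmom]. This keeps the
    algebra over an arbitrary ordered field; [poly_moment] identifies it with an integral. *)
Definition dirf (g : S) : R := \sum_(m <- msupp g) g@_m * dmom m.

Lemma dirfE g i : (msize g <= i)%N ->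
  dirf g = \sum_(m : 'X_{1..N < i}) g@_m * dmom m.
Proof.
move=> le_pi; set I : subFinType _ := 'X_{1..N < i}.
rewrite /dirf (big_mksub I) ?msupp_uniq //=; first last.
  by move=> x /msize_mdeg_lt /leq_trans; apply.
rewrite big_rmcond //= => j /memN_msupp_eq0 ->.
by rewrite mul0r.
Qed.

Lemma dirf_lin (c : R) f g : dirf (c *: f + g) = c * dirf f + dirf g.
Proof.
pose_big_enough i.
  rewrite !(@dirfE _ i) // mulr_sumr -big_split; apply: eq_bigr => m _ /=.
  by rewrite mcoeffD mcoeffZ mulrDl -mulrA.
by close.
Qed.

Lemma dirf0 : dirf 0 = 0.
Proof. by rewrite /dirf msupp0 big_nil. Qed.

Lemma dirfZ (c : R) f : dirf (c *: f) = c * dirf f.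
Proof. by have := dirf_lin c f 0; rewrite !addr0 dirf0 addr0. Qed.

Lemma dirfD f g : dirf (f + g) = dirf f + dirf g.
Proof. by rewrite -[f]scale1r dirf_lin mul1r scale1r. Qed.

Lemma dirfB f g : dirf (f - g) = dirf f - dirf g.
Proof. by rewrite dirfD -scaleN1r dirfZ mulN1r. Qed.

Lemma dirf_is_additive : additive dirf. Proof. exact: dirfB. Qed.
HB.instance Definition _ := GRing.isAdditive.Build {mpoly R[N]} R dirf dirf_is_additive.

Lemma dirf_sum (I : Type) (r : seq I) (P : pred I) (F : I -> S) :
  dirf (\sum_(i <- r | P i) F i) = \sum_(i <- r | P i) dirf (F i).
Proof. exact: raddf_sum. Qed.

Lemma dirfX m : dirf 'X_[m] = dmom m.
Proof. by rewrite /dirf msuppX big_seq1 mcoeffX eqxx mul1r. Qed.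

Lemma dirf_eq0 (L : S -> S) :
  (forall c f g, L (c *: f + g) = c *: L f + L g) ->
  (forall m, dirf (L 'X_[m]) = 0) -> forall g, dirf (L g) = 0.
Proof.
move=> Llin LX; elim/mpolyind => [|c m g _ _ IH].
  have : L 0 = 0 by have := Llin 1 0 0; rewrite !scaler0 addr0 scale1r -{1}[L 0]addr0 => /addrI.
  by move=> ->; rewrite dirf0.
by rewrite Llin dirf_lin LX IH mulr0 addr0.
Qed.

Lemma sg_gt0 : 0 < sg.
Proof. by rewrite ltr_pwDl // mulr_ge0 // ltW. Qed.

Lemma dmomU m i : dmom (m + U_(i)) = dmom m * (theta + (m i)%:R) / (sg + (mdeg m)%:R).
Proof.
rewrite /dmom mdegD mdeg1 addn1 riseS (bigD1 i) //= [in RHS](bigD1 i) //=.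
rewrite mnmDE mnm1E eqxx addn1 riseS.
rewrite (eq_bigr (fun j => rise theta (m j))); last first.
  by move=> j /negbTE ji; rewrite mnmDE mnm1E eq_sym ji addn0.
rewrite -/sg; have := @rise_gt0 _ sg (mdeg m) sg_gt0; move: (rise sg _) => r r0.
have s1 : 0 < sg + (mdeg m)%:R by rewrite ltr_pwDl // sg_gt0.
by field; rewrite !gt_eqF.
Qed.

Lemma dmom0 : dmom 0%MM = 1.
Proof.
by rewrite /dmom mdeg0 rise0 divr1 big1 // => i _; rewrite mnm0E rise0.
Qed.

Lemma mulX_mderivX i m : 'X_i * ('X_[m])^`M(i) = (m i)%:R *: 'X_[m] :> S.
Proof.
rewrite mderivX -scalerAr -mpolyXD; case: (posnP (m i)) => [->|mi]; first by rewrite !scale0r.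
by rewrite addmC submK // lep1mP -lt0n.
Qed.

Lemma dirf_mulX i m : dirf ('X_i * 'X_[m]) = dmom m * (theta + (m i)%:R) / (sg + (mdeg m)%:R).
Proof. by rewrite -mpolyXD addmC dirfX dmomU. Qed.

(* Integration by parts against the Dirichlet density, read off the moments. *)
Lemma dirf_ibp i j g :
  dirf ('X_i * 'X_j * dd i j g + theta *: (('X_j - 'X_i) * g)) = 0.
Proof.
pose L g : S := 'X_i * 'X_j * dd i j g + theta *: (('X_j - 'X_i) * g).
rewrite -/(L g); apply: dirf_eq0 => [c f h|m]; rewrite /L.
  by rewrite dd_lin; move: (dd i j f) (dd i j h) => A B; rewrite -!mul_mpolyC; ring.
have -> : 'X_i * 'X_j * dd i j 'X_[m] = 'X_j * ('X_i * 'X_[m]^`M(i)) - 'X_i * ('X_j * 'X_[m]^`M(j)) :> S.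
  by rewrite /dd; ring.
rewrite !mulX_mderivX -!scalerAr mulrBl scalerBr dirfD !dirfB !dirfZ !dirf_mulX.
have s1 : sg + (mdeg m)%:R != 0 by rewrite gt_eqF // ltr_pwDl // sg_gt0.
by field.
Qed.

(** Each summand of [kop] is a multiple of the expression in [dirf_ibp] at [g = dd i j f]; this
    dictates the first-order part of [kop]. *)
Lemma dirf_kop z f : dirf (kop theta z f) = 0.
Proof.
rewrite /kop dirf_sum big1 // => i _; rewrite dirf_sum big1 // => j _.
by rewrite dirfZ dirf_ibp mulr0.
Qed.

Definition w0 : S := 1 - \sum_i 'X_i.

(** Integration by parts for an exchange of mass between the points [i] and [0]. The weight [w0] is
    not a coordinate, so this direction is the partial derivative in [w_i] alone. *)
Lemma dirf_ibp0 i g :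
  dirf ('X_i * w0 * g^`M(i) + theta *: (w0 * g) - s0 *: ('X_i * g)) = 0.
Proof.
pose L g : S := 'X_i * w0 * g^`M(i) + theta *: (w0 * g) - s0 *: ('X_i * g).
rewrite -/(L g); apply: dirf_eq0 => [c f h|m]; rewrite /L.
  by rewrite mderivD mderivZ; move: (f^`M(i)) (h^`M(i)) => A B; rewrite -!mul_mpolyC; ring.
rewrite mulrAC mulX_mderivX -scalerAl [_ * w0]mulrC -scalerDl dirfB !dirfZ dirf_mulX.
have -> : dirf (w0 * 'X_[m]) = dmom m * (s0 / (sg + (mdeg m)%:R)).
  rewrite /w0 mulrBl mul1r dirfB dirfX mulr_suml dirf_sum.
  under eq_bigr do rewrite dirf_mulX.
  rewrite -mulr_suml -mulr_sumr big_split /= -natr_sum -mdegE.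
  rewrite sumr_const card_ord -[theta *+ N]mulr_natl /sg.
  have s1 : s0 + N%:R * theta + (mdeg m)%:R != 0 by rewrite gt_eqF // ltr_pwDl // sg_gt0.
  by field.
have s1 : sg + (mdeg m)%:R != 0 by rewrite gt_eqF // ltr_pwDl // sg_gt0.
by field.
Qed.

(* The coefficient of the leading monomial of [ell c], see
   [mcoeff_ell_initseg]. *)
Definition btail (c : nat) : S := 1 - \sum_(j < N | (j < c)%N) 'X_j.

Lemma btail0 : btail 0 = 1.
Proof. by rewrite /btail big1 ?subr0. Qed.

Lemma btail_tail (i : 'I_N) : btail i.+1 = w0 + \sum_(j < N | (i < j)%N) 'X_j.
Proof.
rewrite /btail /w0 [\sum_i _](bigID (fun j : 'I_N => (j < i.+1)%N)) /=.
under [\sum_(j < N | (i < j)%N) _]eq_bigl => j do rewrite ltnNge -ltnS.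
ring.
Qed.

Lemma btailS (i : 'I_N) : btail i.+1 = btail i - 'X_i.
Proof.
rewrite /btail (bigD1 i) ?ltnS //= opprD addrCA addrC; congr (_ - _ - _).
by apply: eq_bigl => j; rewrite ltnS -val_eqE /= ltn_neqAle andbC.
Qed.

(** The sum of the Dirichlet parameters of the weights that make up [btail i.+1]. *)
Definition sgi (i : nat) : R := s0 + (N - i.+1)%:R * theta.

(** Mass is exchanged between [w_i] and the whole block [btail i.+1]: the sum of [dirf_ibp0] and of
    [dirf_ibp] over all [j > i]. *)
Lemma dirf_ibp_tail (i : 'I_N) g :
  dirf ('X_i * (btail i.+1 * g^`M(i) - \sum_(j < N | (i < j)%N) 'X_j * g^`M(j))
    + theta *: (btail i.+1 * g) - sgi i *: ('X_i * g)) = 0.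
Proof.
have c : \sum_(j < N | (i < j)%N) (1 : R) = (N - i.+1)%:R.
  have A : (\sum_(j < N | (j < i.+1)%N) 1 = i.+1)%N.
    by rewrite -(big_ord_widen N (fun=> 1%N)) // sum1_card card_ord.
  have : (\sum_(j < N) 1 = N)%N by rewrite sum1_card card_ord.
  rewrite (bigID (fun j : 'I_N => (j < i.+1)%N)) /= A => E.
  rewrite sumr_const -[X in (X - _)%N]E addKn sum1_card; congr (_ *+ _).
  by apply: eq_card => j; rewrite !unfold_in -ltnNge ltnS.
transitivity (dirf ('X_i * w0 * g^`M(i) + theta *: (w0 * g) - s0 *: ('X_i * g))
  + \sum_(j < N | (i < j)%N) dirf ('X_i * 'X_j * dd i j g + theta *: (('X_j - 'X_i) * g))).
  rewrite -dirf_sum -dirfD; congr dirf.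
  rewrite big_split /= -scaler_sumr -mulr_suml sumrB.
  have -> : \sum_(j < N | (i < j)%N) 'X_i * 'X_j * dd i j g =
    'X_i * ((\sum_(j < N | (i < j)%N) 'X_j) * g^`M(i) - \sum_(j < N | (i < j)%N) 'X_j * g^`M(j)).
    by rewrite mulr_suml -sumrB mulr_sumr; apply: eq_bigr => j _; rewrite /dd; ring.
  have -> : \sum_(j < N | (i < j)%N) 'X_i = (N - i.+1)%:R *: 'X_i :> S.
    by rewrite -c scaler_suml; apply: eq_bigr => j _; rewrite scale1r.
  rewrite btail_tail /sgi.
  move: (\sum_(j < N | (i < j)%N) 'X_j) (\sum_(j < N | (i < j)%N) 'X_j * g^`M(j)) => A B.
  rewrite -!mul_mpolyC; ring.
by rewrite dirf_ibp0 add0r big1 // => j _; rewrite dirf_ibp.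
Qed.

Lemma mderiv_btail c (j : 'I_N) : (btail c)^`M(j) = - (j < c)%:R%:MP.
Proof.
rewrite /btail mderivB -mpolyC1 mderivC sub0r; congr (- _).
rewrite mderiv_sum; case: (ltnP j c) => jc.
  rewrite (bigD1 j) //= big1 => [|k /andP[_ kj]]; last first.
    by rewrite mderivX mnmE (negbTE kj) scale0r.
  rewrite mderivX mnmE eqxx addr0 scale1r.
  suff -> : (U_(j) - U_(j))%MM = 0%MM :> 'X_{1..N} by rewrite mpolyX0 mpolyC1.
  by apply/mnmP => k; rewrite mnmBE subnn mnm0E.
rewrite big1 ?mpolyC0 // => k kc.
rewrite mderivX mnmE; case: eqP => [E|]; last by rewrite scale0r.
by move: kc; rewrite E ltnNge jc.
Qed.

(** The vector field takes mass from the block after [i] in proportion to its weights and gives it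
    to [w_i]. A tail [btail c] lies inside the block if [i < c], and is then scaled with factor
    [-1]; otherwise it contains both the block and [w_i] and is unchanged. *)
Lemma euler_btail (i : 'I_N) (s : seq nat) :
  let g := \prod_(c <- s) btail c in
  btail i.+1 * g^`M(i) - \sum_(j < N | (i < j)%N) 'X_j * g^`M(j) =
  - (count (fun c => (i < c)%N) s)%:R *: g.
Proof.
elim: s => [|c s IH] /=.
  rewrite big_nil -mpolyC1 mderivC mulr0 oppr0 scale0r.
  by rewrite big1 ?subr0 // => j _; rewrite mderivC mulr0.
rewrite big_cons; set g := \prod_(c <- s) _ in IH *.
transitivity (btail c * (btail i.+1 * g^`M(i) - \sum_(j < N | (i < j)%N) 'X_j * g^`M(j))
  + (btail i.+1 * (btail c)^`M(i) - \sum_(j < N | (i < j)%N) 'X_j * (btail c)^`M(j)) * g).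
  rewrite mderivM.
  rewrite [\sum_(j < N | (i < j)%N) 'X_j * (_ * _)^`M(j)](eq_bigr (fun j => btail c * ('X_j * g^`M(j)) + 'X_j * (btail c)^`M(j) * g)); last first.
    by move=> j _; rewrite mderivM; ring.
  rewrite big_split /= -mulr_sumr -mulr_suml.
  move: (btail c) (btail i.+1) (g^`M(i)) => A B C; ring.
rewrite IH.
have -> : btail i.+1 * (btail c)^`M(i) - \sum_(j < N | (i < j)%N) 'X_j * (btail c)^`M(j) =
   - (i < c)%:R *: btail c.
  rewrite mderiv_btail; under eq_bigr do rewrite mderiv_btail.
  case: (ltnP i c) => ic /=; last first.
    rewrite mpolyC0 oppr0 mulr0 sub0r oppr0 scale0r big1 ?oppr0 // => j ij.
    by rewrite ltnNge (leq_trans ic (ltnW ij)) /= mpolyC0 oppr0 mulr0.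
  rewrite mpolyC1 mulrN1 scaleN1r.
  have E : \sum_(j < N | (j < c)%N) 'X_j = \sum_(j < N | (j < i.+1)%N) 'X_j + \sum_(j < N | (i < j)%N && (j < c)%N) 'X_j :> S.
    rewrite (bigID (fun j : 'I_N => (j < i.+1)%N)) /=; congr (_ + _); apply: eq_bigl => j.
      by apply/andb_idl => /leq_trans; apply.
    by rewrite -ltnNge ltnS andbC.
  have -> : \sum_(j < N | (i < j)%N) 'X_j * - (j < c)%:R%:MP =
      - \sum_(j < N | (i < j)%N && (j < c)%N) 'X_j :> S.
    rewrite big_mkcondr -sumrN; apply: eq_bigr => j _ /=.
    by case: (j < c)%N; rewrite ?mpolyC1 ?mulrN1 // mpolyC0 oppr0 mulr0.
  rewrite /btail E.
  move: (\sum_(j < N | (j < i.+1)%N) 'X_j) (\sum_(j < N | _ && _) 'X_j) => A B; ring.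
by rewrite natrD opprD scalerDl -!scalerAl -!scalerAr addrC.
Qed.

(** In stick-breaking terms [btail i.+1 / btail i] has a Beta distribution with parameters [sgi i]
    and [theta]; the factors of [g] with [i < c] contribute its power [mu], and the ratio is that of
    two consecutive moments. *)
Lemma dirf_btail (i : 'I_N) (s : seq nat) :
  let g := \prod_(c <- s) btail c in
  let mu := (count (fun c => (i < c)%N) s)%:R in
  dirf (btail i.+1 * g) = (sgi i + mu) / (sgi i + mu + theta) * dirf (btail i * g).
Proof.
move=> g mu; have := dirf_ibp_tail i g; rewrite (euler_btail i s) -/g -/mu.
have -> : 'X_i = btail i - btail i.+1 by rewrite btailS; ring.
move: (btail i) (btail i.+1) => A B.
have -> : (A - B) * (- mu *: g) + theta *: (B * g) - sgi i *: ((A - B) * g) =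
    (- mu - sgi i) *: (A * g) + (mu + theta + sgi i) *: (B * g).
  by rewrite -!mul_mpolyC !(mpolyCD, mpolyCB, mpolyCN); ring.
rewrite dirfD !dirfZ => H.
have p0 : 0 < sgi i + mu + theta.
  by rewrite ltr_wpDl // addr_ge0 ?ler0n // addr_ge0 ?(ltW s0_gt0) // mulr_ge0 ?ler0n // ltW.
rewrite mulrAC; apply: (canRL (mulfK (lt0r_neq0 p0))).
by apply/eqP; rewrite -subr_eq0; apply/eqP; rewrite -{}H; ring.
Qed.

Definition cfact (mu : nat -> nat) : R :=
  \prod_(i < N) (rise (sgi i) (mu i) / rise (sgi i + theta) (mu i)).

Lemma dirf_prod_btail (s : seq nat) : all (fun c => (c <= N)%N) s ->
  dirf (\prod_(c <- s) btail c) = cfact (fun i => count (fun c => (i < c)%N) s).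
Proof.
elim: s => [_|c s IH /= /andP[cN /IH sN]].
  rewrite big_nil -[1]mpolyX0 dirfX dmom0 /cfact big1 // => i _.
  by rewrite /= !rise0 divr1.
rewrite big_cons; set g := \prod_(c <- s) _.
pose mu i : R := (count (fun c => (i < c)%N) s)%:R.
(* The factor [btail k] is lowered step by step to [btail 0 = 1], each step giving one quotient. *)
have H k : (k <= N)%N -> dirf (btail k * g) =
    \prod_(i < N | (i < k)%N) ((sgi i + mu i) / (sgi i + mu i + theta)) * dirf g.
  elim: k => [_|k IHk kN]; first by rewrite btail0 mul1r big_pred0 ?mul1r.
  rewrite (dirf_btail (Ordinal kN)) /= IHk ?(ltnW kN) // mulrA; congr (_ * _).
  rewrite [in RHS](bigD1 (Ordinal kN)) ?ltnS //=; congr (_ * _).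
  by apply: eq_bigl => j; rewrite ltnS -val_eqE /= ltn_neqAle andbC.
rewrite H // sN /cfact (big_mkcond (fun i : 'I_N => (i < c)%N)) -big_split /=.
apply: eq_bigr => i _; case: ifP => ic; last by rewrite add0n mul1r.
rewrite add1n !riseS /mu.
have sp : 0 < sgi i by rewrite ltr_pwDl // mulr_ge0 // ltW.
have r1 := @rise_gt0 _ (sgi i + theta) (count (fun c => (i < c)%N) s) (addr_gt0 sp theta_gt0).
move: (rise _ _) (rise _ _) r1 => A B B0.
have p0 : 0 < sgi i + theta + (count (fun c => (i < c)%N) s)%:R by rewrite ltr_pwDl // addr_gt0.
rewrite [sgi i + _ + theta]addrAC.
by field; rewrite !gt_eqF.
Qed.

End Moments.

(** * Dominance order and eigenfunctions of D_2 *)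

Section Dominance.
Context (N : nat).
Implicit Types (m : 'X_{1..N}) (I h : {set 'I_N}) (s : seq nat).

Definition tsum m (r : nat) : nat := (\sum_(i < N | (i < r)%N) m i)%N.

(** Since [I] is arbitrary, the largest entries of [m] are compared with the first entries of [m']:
    rearranging [m] changes nothing. *)
Definition domle m m' : Prop :=
  mdeg m = mdeg m' /\ forall I, (\sum_(i in I) m i <= tsum m' #|I|)%N.

Definition msorted m : Prop := forall i j : 'I_N, (i <= j)%N -> (m j <= m i)%N.

Definition initseg (r : nat) : {set 'I_N} := [set i : 'I_N | (i < r)%N].

Lemma card_initseg r : (r <= N)%N -> #|initseg r| = r.
Proof.
move=> rN; rewrite -sum1dep_card -(big_ord_widen _ (fun=> 1%N)) //.
by rewrite sum1_card card_ord.
Qed.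

Lemma tsum_initseg m r : tsum m r = (\sum_(i in initseg r) m i)%N.
Proof. by apply: eq_bigl => i; rewrite inE. Qed.

Lemma card_leN I : (#|I| <= N)%N.
Proof. by rewrite (leq_trans (max_card _)) ?card_ord. Qed.

Lemma domle_tsum m m' r : (r <= N)%N -> domle m m' -> (tsum m r <= tsum m' r)%N.
Proof. by move=> rN [_ /(_ (initseg r))]; rewrite card_initseg // (tsum_initseg m). Qed.

Lemma domle_trans m1 m2 m3 : domle m1 m2 -> domle m2 m3 -> domle m1 m3.
Proof.
move=> H1 H2; split; first by case: H1 => ->; case: H2.
by move=> I; case: H1 => _ /(_ I) /leq_trans; apply; apply: domle_tsum H2; exact: card_leN.
Qed.

Lemma tsumS m (i : 'I_N) : tsum m i.+1 = (tsum m i + m i)%N.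
Proof.
rewrite /tsum (bigD1 i) //= addnC; congr (_ + _)%N.
by apply: eq_bigl => j; rewrite ltnS -val_eqE /= ltn_neqAle andbC.
Qed.

Lemma domle_anti m m' : domle m m' -> domle m' m -> m = m'.
Proof.
move=> H H'; apply/mnmP => i.
have E r : (r <= N)%N -> tsum m r = tsum m' r.
  by move=> rN; apply/eqP; rewrite eqn_leq !domle_tsum.
by apply/eqP; rewrite -(eqn_add2l (tsum m i)) -tsumS E // tsumS E // ltnW.
Qed.

(* The conjugate partition. *)
Definition cols m : seq nat :=
  [seq #|[set i | (k < m i)%N]| | k <- iota 0 (mdeg m)].

Lemma cols_leN m : all (fun c => (c <= N)%N) (cols m).
Proof. by apply/allP => _ /mapP[k _ ->]; exact: card_leN. Qed.

Lemma colset_initseg m k : msorted m ->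
  [set i | (k < m i)%N] = initseg #|[set i | (k < m i)%N]|.
Proof.
move=> ms; set A := [set i | _]; apply/setP => i; rewrite !inE.
have cl (j j' : 'I_N) : j \in A -> (j' <= j)%N -> j' \in A.
  by rewrite !inE => jA /ms; apply: leq_trans.
have aux : (i \in A) = (i < #|A|)%N; last by rewrite -aux !inE.
case: (boolP (i \in A)) => iA; apply/esym.
  have : initseg i.+1 \subset A.
    by apply/subsetP => j; rewrite inE ltnS; exact: cl.
  by move=> /subset_leq_card; rewrite card_initseg.
apply/negbTE; rewrite -leqNgt -(card_initseg (ltnW (ltn_ord i))) subset_leq_card //.
apply/subsetP => j jA; rewrite inE ltnNge; apply: contra iA => ij.
exact: cl jA ij.
Qed.

Lemma count_cols m (i : 'I_N) : msorted m -> count (fun c => (i < c)%N) (cols m) = m i.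
Proof.
move=> ms; rewrite /cols count_map.
rewrite (eq_count (a2 := fun k => (k < m i)%N)); last first.
  move=> k /=; have := colset_initseg k ms; set c := #|_|.
  by move=> /setP /(_ i); rewrite !inE => ->.
have mi : (m i <= mdeg m)%N by rewrite mdegE (bigD1 i) //= leq_addr.
rewrite -(subnKC mi) iotaD count_cat add0n.
rewrite (eq_in_count (a2 := predT)); last by move=> k; rewrite mem_iota add0n.
rewrite count_predT size_iota (eq_in_count (a2 := pred0)) ?count_pred0 ?addn0 //.
by move=> k; rewrite mem_iota => /andP[+ _] /=; rewrite ltnNge => ->.
Qed.

(** The exponents in a product of elementary symmetric polynomials with degrees in [s]: a set of [c]
    variables meets [I] in at most [minn #|I| c] of them. *)
Definition colbound s m : Prop :=
  mdeg m = sumn s /\ forall I, (\sum_(i in I) m i <= sumn [seq minn #|I| c | c <- s])%N.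

Lemma sumn_minn_cols m r : msorted m -> (r <= N)%N ->
  sumn [seq minn r c | c <- cols m] = tsum m r.
Proof.
move=> ms rN.
have -> : tsum m r = (\sum_(i < N | (i < r)%N) \sum_(c <- cols m) (i < c)%N)%N.
  by apply: eq_bigr => i _; rewrite -(count_cols _ ms) -sum1_count big_mkcond.
rewrite exchange_big sumnE big_map big_seq [in RHS]big_seq; apply: eq_bigr => c.
move=> /(allP (cols_leN m)) cN.
rewrite -big_mkcondr /= sum1dep_card /=.
rewrite -(@card_initseg (minn r c)) ?geq_min ?rN //.
by apply: eq_card => i; rewrite !inE leq_min.
Qed.

Lemma sumn_cols m : msorted m -> sumn (cols m) = mdeg m.
Proof.
move=> ms; have := sumn_minn_cols ms (leqnn N).
rewrite /tsum (eq_bigl xpredT) => [|i]; last by rewrite ltn_ord.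
rewrite -mdegE => <-; congr sumn.
rewrite -[LHS]map_id; apply/eq_in_map => c /(allP (cols_leN m)) cN.
by apply/esym/minn_idPr.
Qed.

Lemma colbound_cols m m' : msorted m -> colbound (cols m) m' -> domle m' m.
Proof.
move=> ms [d H]; split; first by rewrite d sumn_cols.
by move=> I; rewrite -sumn_minn_cols // card_leN.
Qed.

Lemma sum_mesym1 h I : (\sum_(i in I) mesym1 h i = #|I :&: h|)%N.
Proof.
rewrite -sum1_card.
have -> : (\sum_(i in I :&: h) 1 = \sum_(i | (i \in I) && (i \in h)) 1)%N.
  by apply: eq_bigl => i; rewrite inE.
rewrite big_mkcondr /=.
by apply: eq_bigr => i _; rewrite mnmE; case: (_ \in h).
Qed.

Lemma colbound_prod (A : comRingType) (f : nat -> {mpoly A[N]}) s :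
  (forall c m, m \in msupp (f c) -> exists2 h : {set 'I_N}, #|h| = c & m = mesym1 h) ->
  forall m, m \in msupp (\prod_(c <- s) f c) -> colbound s m.
Proof.
move=> Hf; elim: s => [|c s IH] m.
  rewrite big_nil -mpolyX0 msuppX mem_seq1 => /eqP ->; split; first by rewrite mdeg0.
  by move=> I; rewrite big1 // => i _; rewrite mnm0E.
rewrite big_cons => /msuppM_le /allpairsP[[m1 m2] /= [/Hf[h hc ->] /IH[d H] ->]].
split; first by rewrite mdegD mdeg_mesym1 hc d.
move=> I /=; under eq_bigr do rewrite mnmDE.
rewrite big_split /= leq_add // sum_mesym1 leq_min -hc.
by rewrite !subset_leq_card ?subsetIl ?subsetIr.
Qed.

Lemma mesym1_max h : (mesym1 h <= mesym1 (initseg #|h|))%O.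
Proof.
have -> : mesym1 (initseg #|h|) = mlead (mesym N int #|h|).
  rewrite mlead_mesym ?card_leN //; apply/mnmP => i.
  by rewrite !mnmE inE.
by apply: msupp_le_mlead; exact: mem_mesym1_mesym.
Qed.

Lemma sum_mesym1_cols m : msorted m ->
  (\big[+%MM/0%MM]_(c <- cols m) mesym1 (initseg c))%MM = m.
Proof.
move=> ms; apply/mnmP => i; rewrite mnm_sumE -[RHS](count_cols i ms) -sum1_count.
by rewrite [RHS]big_mkcond; apply: eq_bigr => c _; rewrite mnmE inE; case: ltnP.
Qed.

Lemma lead_prod_cols (A : comRingType) (f : nat -> {mpoly A[N]}) s :
  (forall c m, m \in msupp (f c) -> exists2 h : {set 'I_N}, #|h| = c & m = mesym1 h) ->
  let M := (\big[+%MM/0%MM]_(c <- s) mesym1 (initseg c))%MM in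
  (mlead (\prod_(c <- s) f c) <= M)%O /\
  (\prod_(c <- s) f c)@_M = \prod_(c <- s) (f c)@_(mesym1 (initseg c)).
Proof.
move=> Hf /=.
have Hl c : (mlead (f c) <= mesym1 (initseg c))%O.
  have [->|f0] := eqVneq (f c) 0; first by rewrite mlead0 le0m.
  by have /Hf[h <- ->] := mlead_supp f0; exact: mesym1_max.
elim: s => [|c s [IH1 IH2]]; first by rewrite !big_nil mlead1 mcoeff1 eqxx.
rewrite !big_cons; split.
  by rewrite (le_trans (mleadM_le _ _)) // lem_add.
by rewrite mleadcMW // IH2.
Qed.

End Dominance.

(** * Lifting symmetric polynomials of the roots *)

Section Lift.
Context (R : realFieldType) (N : nat) (theta s0 : R).
Hypotheses (theta_gt0 : 0 < theta) (s0_gt0 : 0 < s0).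
Notation S := {mpoly R[N]}.
Implicit Types (m : 'X_{1..N}) (s : seq nat).

Lemma mcoeff_ell c m : (ell R N c)@_m =
  if mechar c m then beta R [set i | m i != 0%N] else 0.
Proof.
rewrite /ell raddf_sum /=.
rewrite (eq_bigr (fun h => if m == mesym1 h then beta R h else 0)); last first.
  by move=> h _; rewrite mcoeffZ mcoeffX eq_sym; case: eqP; rewrite ?mulr1 ?mulr0.
case: (boolP (mechar c m)) => [|/negbTE mc].
  rewrite mecharP => /existsP[h /andP[/eqP mh /eqP hc]].
  have -> : [set i | m i != 0%N] = h by apply/setP => i; rewrite inE mh mnmE; case: (_ \in _).
  rewrite (bigD1 h) ?hc //= mh eqxx big1 ?addr0 // => k /andP[_ kh].
  by rewrite (inj_eq (@inj_mesym1 N)) eq_sym (negbTE kh).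
rewrite big1 // => h hc; case: eqP => // mh.
suff : mechar c m by rewrite mc.
by rewrite mecharP; apply/existsP; exists h; rewrite -mh hc eqxx.
Qed.

Lemma msupp_ell c m : m \in msupp (ell R N c) -> exists2 h : {set 'I_N}, #|h| = c & m = mesym1 h.
Proof.
rewrite mcoeff_msupp mcoeff_ell; case: ifP => [|_]; last by rewrite eqxx.
rewrite mecharP => /existsP[h /andP[/eqP mh /eqP hc]] _; by exists h.
Qed.

Lemma msupp_mesym_set c m : m \in msupp (mesym N R c) -> exists2 h : {set 'I_N}, #|h| = c & m = mesym1 h.
Proof. by rewrite msupp_mesymP => /existsP[h /andP[/eqP hc /eqP mh]]; exists h. Qed.

Lemma mcoeff_ell_initseg c : (c <= N)%N -> (ell R N c)@_(mesym1 (initseg N c)) = btail R N c.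
Proof.
move=> cN; rewrite mcoeff_ell.
have -> : mechar c (mesym1 (initseg N c)).
  by rewrite mecharP; apply/existsP; exists (initseg N c); rewrite card_initseg // !eqxx.
have -> : [set i | mesym1 (initseg N c) i != 0%N] = initseg N c.
  by apply/setP => i; rewrite inE mnmE; case: (_ \in _).
by rewrite /beta /btail; congr (_ - _); apply: eq_bigl => i; rewrite inE.
Qed.

Lemma mcoeff_mesym_initseg c : (c <= N)%N -> (mesym N R c)@_(mesym1 (initseg N c)) = 1.
Proof.
move=> cN; rewrite mcoeff_mesym.
suff -> : mechar c (mesym1 (initseg N c)) by [].
by rewrite mecharP; apply/existsP; exists (initseg N c); rewrite card_initseg // !eqxx.
Qed.

Lemma evw0_ell c : evw (fun=> 0) (ell R N c) = mesym N R c.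
Proof.
apply/mpolyP => m; rewrite /evw mcoeff_map_mpoly /= mcoeff_mesym mcoeff_ell.
case: ifP => _; last by rewrite meval0.
rewrite /beta mevalB meval1 meval_sum big1 ?subr0 // => i _; exact: mevalXU.
Qed.

Lemma evw_prod w s : evw w (\prod_(c <- s) ell R N c) = \prod_(c <- s) evw w (ell R N c).
Proof. exact: rmorph_prod. Qed.

(* [F] represents the symmetric polynomial [P] of the roots as a polynomial in
   the points (variables) and the Dirichlet weights (coefficients). *)
Lemma sym_lift (mu : 'X_{1..N}) (P : S) : msorted mu -> P \is symmetric ->
  (forall m, m \in msupp P -> domle m mu) ->
  exists F : {mpoly S[N]},
  [/\ evw (fun=> 0) F = P,
      forall z w z' w', genfun z w = genfun z' w' -> (evw w F).@[z] = (evw w' F).@[z'],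
      forall z w z' w', genfun z w = genfun z' w' -> injective z -> injective z' ->
        jop theta z w F = jop theta z' w' F,
      forall m, m \in msupp F -> domle m mu &
      dirf theta s0 F@_mu = cfact N theta s0 (fun i => nth 0%N mu i) * P@_mu].
Proof.
move=> musort; elim/mleadrect: P => P IH Psym Psupp.
have [P0|P0] := eqVneq P 0.
  rewrite P0; exists 0; split.
  - by rewrite evw0.
  - by move=> z w z' w' _; rewrite !evw0 !meval0.
  - by move=> z w z' w' _ _ _; rewrite !jop0.
  - by move=> m; rewrite msupp0.
  - by rewrite !mcoeff0 dirf0 mulr0.
(* As in the fundamental theorem on symmetric polynomials, a product of [mesym] removes the leading
   term of [P]; the lift collects the corresponding products of [ell]. *)
pose m := mlead P; pose c := P@_m.
have msort : msorted m by move=> i j; exact: mlead_msym_sorted.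
have mmu : domle m mu by apply/Psupp/mlead_supp.
pose E : S := \prod_(a <- cols m) mesym N R a.
pose L : {mpoly S[N]} := \prod_(a <- cols m) ell R N a.
have EL : evw (fun=> 0) L = E by rewrite /L evw_prod; apply: eq_bigr => a _; exact: evw0_ell.
have Esupp k : k \in msupp E -> domle k m.
  by move=> /(colbound_prod msupp_mesym_set) /(colbound_cols msort).
have Lsupp k : k \in msupp L -> domle k m.
  by move=> /(colbound_prod msupp_ell) /(colbound_cols msort).
have [Elead Ecoef] := lead_prod_cols (cols m) msupp_mesym_set.
have [_ Lcoef] := lead_prod_cols (cols m) msupp_ell.
rewrite sum_mesym1_cols // -/E in Elead; rewrite sum_mesym1_cols // -/E in Ecoef.
rewrite sum_mesym1_cols // -/L in Lcoef.
have {}Ecoef : E@_m = 1.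
  rewrite Ecoef big_seq big1 // => a /(allP (cols_leN m)); exact: mcoeff_mesym_initseg.
have {}Lcoef : L@_m = \prod_(a <- cols m) btail R N a.
  rewrite Lcoef big_seq [RHS]big_seq; apply: eq_bigr => a /(allP (cols_leN m)).
  exact: mcoeff_ell_initseg.
have Esym : E \is symmetric by apply: rpred_prod => a _; exact: mesym_sym.
pose q := P - c *: E.
have qsym : q \is symmetric by rewrite rpredB // rpredZ.
have qsupp k : k \in msupp q -> domle k mu.
  move=> /msuppB_le; rewrite mem_cat => /orP[/Psupp //|/msuppZ_le /Esupp] H.
  exact: domle_trans H mmu.
have [F [F1 F2 F3 F4 F5]] : exists F : {mpoly S[N]},
  [/\ evw (fun=> 0) F = q,
      forall z w z' w', genfun z w = genfun z' w' -> (evw w F).@[z] = (evw w' F).@[z'],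
      forall z w z' w', genfun z w = genfun z' w' -> injective z -> injective z' ->
        jop theta z w F = jop theta z' w' F,
      forall m, m \in msupp F -> domle m mu &
      dirf theta s0 F@_mu = cfact N theta s0 (fun i => nth 0%N mu i) * q@_mu].
  have [q0|q0] := eqVneq q 0.
    rewrite q0; exists 0; split.
    - by rewrite evw0.
    - by move=> z w z' w' _; rewrite !evw0 !meval0.
    - by move=> z w z' w' _ _ _; rewrite !jop0.
    - by move=> k; rewrite msupp0.
    - by rewrite !mcoeff0 dirf0 mulr0.
  (* The coefficients of [m] cancel in [q], so the leading monomial drops strictly. *)
  apply: IH => //; rewrite lt_neqAle; apply/andP; split.
    apply/eqP => Eq; have := mlead_supp q0; rewrite mcoeff_msupp Eq.
    by rewrite /q mcoeffB mcoeffZ -/m Ecoef mulr1 subrr eqxx.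
  rewrite (le_trans (mleadB_le _ _)) // leUx lexx /=.
  by rewrite (le_trans (mleadZ_le _ _)).
exists (c%:MP *: L + F); split.
- by rewrite evw_lin F1 EL /q addrC subrK.
- move=> z w z' w' H; rewrite (evw_lin w) (evw_lin w') mevalD mevalZ.
  rewrite (F2 _ _ _ _ H) [RHS]mevalD mevalZ; congr (_ * _ + _).
  rewrite evw_prod (evw_prod w') (rmorph_prod (meval z)) (rmorph_prod (meval z')).
  apply: eq_bigr => a _; exact: ev_ell_transfer.
- move=> z w z' w' H iz iz'; rewrite (jop_lin _ z w) (jop_lin _ z' w').
  by rewrite (F3 _ _ _ _ H iz iz') (prod_ell_transfer theta H iz iz' (cols m)).2.
- move=> k /msuppD_le; rewrite mem_cat => /orP[/msuppZ_le /Lsupp H|/F4 //].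
  exact: domle_trans H mmu.
- rewrite mcoeffD mcoeffZ mul_mpolyC dirf_lin F5 /q mcoeffB mcoeffZ.
  (* Only the product with [m = mu] contains the monomial [mu]: for the others all monomials lie
     below [m], hence strictly below [mu]. *)
  have [emu|nmu] := eqVneq m mu.
    rewrite -emu Ecoef Lcoef dirf_prod_btail ?cols_leN //.
    have -> : cfact N theta s0 (fun i => count (fun c => (i < c)%N) (cols m)) =
       cfact N theta s0 (fun i => nth 0%N m i).
      by apply: eq_bigr => i _; rewrite count_cols // (mnm_nth 0%N).
    by rewrite mulr1; ring.
  have nsupp (A : nzRingType) (Q : {mpoly A[N]}) :
      (forall k, k \in msupp Q -> domle k m) -> Q@_mu = 0.
    move=> H; apply: memN_msupp_eq0; apply: contra nmu => /H H'.
    by apply/eqP/domle_anti.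
  by rewrite (nsupp _ _ Lsupp) (nsupp _ _ Esupp) dirf0 !mulr0 add0r subr0.
Qed.

End Lift.

(** * Strict monotonicity of the eigenvalue *)

Section EigenvalueOrder.
Context (N : nat).
Implicit Types (m : 'X_{1..N}).

Lemma sum_subS_bin (n D : nat) : (n <= D)%N -> (\sum_(k < D) (n - k.+1) = 'C(n, 2))%N.
Proof.
elim: D n => [|D IH] [|n] nD //.
- by rewrite big_ord0.
- by rewrite big1.
rewrite big_ord_recl /= subn1 /= binS bin1 addnC; congr (_ + _)%N.
by rewrite -IH.
Qed.

(** Truncated subtraction is the positive part of [m i - k]. It is carried by the set [I] where it
    is positive, and there the bound on sums over [I] applies. *)
Lemma domle_sum_sub m m' k : domle m m' ->
  (\sum_(i < N) (m i - k) <= \sum_(i < N) (m' i - k))%N.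
Proof.
move=> [_ H]; pose I : {set 'I_N} := [set i | (k < m i)%N].
have -> : (\sum_(i < N) (m i - k) = \sum_(i in I) (m i - k))%N.
  rewrite [RHS]big_mkcond; apply: eq_bigr => i _; rewrite inE; case: ltnP => // h.
  by apply/eqP; rewrite subn_eq0.
apply: (@leq_trans (\sum_(i < N | (i < #|I|)%N) (m' i - k))%N); last first.
  by rewrite big_mkcond; apply: leq_sum => i _; case: ifP.
have cI : (\sum_(i < N | (i < #|I|)%N) k = #|I| * k)%N.
  by rewrite -(big_ord_widen N (fun=> k)) ?card_leN // sum_nat_const card_ord.
rewrite -(leq_add2r (#|I| * k)%N) -{2}cI -big_split /= -sum_nat_const -big_split /=.
rewrite (eq_bigr m); last first.
  by move=> i; rewrite inE => h; rewrite subnK // ltnW.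
apply: (leq_trans (H I)); apply: leq_sum => i _; lia.
Qed.

(** Convexity: ['C(x, 2)] is the sum of the positive parts of [x - k.+1], and each of these is
    monotone for dominance. *)
Lemma domle_sum_bin m m' : domle m m' ->
  (\sum_(i < N) 'C(m i, 2) <= \sum_(i < N) 'C(m' i, 2))%N.
Proof.
move=> H; pose D := (mdeg m + mdeg m')%N.
have mD (k : 'X_{1..N}) i : (k i <= mdeg k)%N by rewrite mdegE (bigD1 i) //= leq_addr.
have E (k : 'X_{1..N}) : (mdeg k <= D)%N ->
    (\sum_(i < N) 'C(k i, 2) = \sum_(j < D) \sum_(i < N) (k i - j.+1))%N.
  move=> kD; rewrite exchange_big; apply: eq_bigr => i _.
  by rewrite sum_subS_bin // (leq_trans (mD k i)).
rewrite !E ?leq_addr ?leq_addl //; apply: leq_sum => j _; exact: domle_sum_sub.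
Qed.

Lemma sum_tsum m : (\sum_(r < N) tsum m r = \sum_(i < N) (N - i.+1) * m i)%N.
Proof.
rewrite /tsum (exchange_big_dep xpredT) //=; apply: eq_bigr => i _.
rewrite sum_nat_const; congr (_ * _)%N.
have -> : #|[pred r : 'I_N | (i < r)%N]| = #|~: initseg N i.+1|.
  by apply: eq_card => r; rewrite !inE -ltnNge ltnS.
by rewrite cardsCs setCK card_initseg // card_ord.
Qed.

Lemma domle_sum_tsum_lt m m' : domle m m' -> m <> m' ->
  (\sum_(r < N) tsum m r < \sum_(r < N) tsum m' r)%N.
Proof.
move=> H ne; rewrite ltn_neqAle; apply/andP; split; last first.
  by apply: leq_sum => r _; apply: domle_tsum H; exact: ltnW.
apply/eqP => E; apply: ne.
have Er (r : 'I_N) : tsum m r = tsum m' r.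
  have le (r' : 'I_N) : (tsum m r' <= tsum m' r')%N by apply: domle_tsum H; exact: ltnW.
  move: E; rewrite (bigD1 r) //= [in RHS](bigD1 r) //=.
  have : (\sum_(i < N | i != r) tsum m i <= \sum_(i < N | i != r) tsum m' i)%N by apply: leq_sum.
  have := le r; move: (tsum m r) (tsum m' r) => A B AB.
  move: (\sum_(i < N | i != r) tsum m i)%N (\sum_(i < N | i != r) tsum m' i)%N => C C'; lia.
have EN : tsum m N = tsum m' N.
  have D (k : 'X_{1..N}) : tsum k N = mdeg k by rewrite mdegE /tsum; apply: eq_bigl => i; exact: ltn_ord.
  by rewrite !D; case: H.
have Ea r : (r <= N)%N -> tsum m r = tsum m' r.
  by rewrite leq_eqVlt => /predU1P[->//|rN]; exact: (Er (Ordinal rN)).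
apply/mnmP => i; apply/eqP; rewrite -(eqn_add2l (tsum m i)) -tsumS Ea // tsumS Ea //.
exact: ltnW.
Qed.

Context (R : realFieldType) (theta : R).
Hypothesis theta_gt0 : 0 < theta.

Definition eigE m : R := \sum_(i < N) (m i)%:R * ((m i)%:R - 1) +
  2 * theta * \sum_(i < N) (N - i.+1)%:R * (m i)%:R.

(** The quadratic part is monotone by convexity; strictness comes from the linear part, a positive
    multiple of the sum of the partial sums [tsum]. *)
Lemma eigE_lt m m' : domle m m' -> m <> m' -> eigE m < eigE m'.
Proof.
move=> H ne.
have Q (k : 'X_{1..N}) : \sum_(i < N) (k i)%:R * ((k i)%:R - 1) = 2 * (\sum_(i < N) 'C(k i, 2))%:R :> R.
  rewrite natr_sum mulr_sumr; apply: eq_bigr => i _.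
  rewrite -natrM mul2n -bin2_sum // => {H ne}.
  have -> : ((\sum_(0 <= i0 < k i) i0).*2 = k i * (k i).-1)%N.
    rewrite bin2_sum bin2 -[RHS]odd_double_half.
    by rewrite oddM; case: (k i) => [|n] //=; rewrite andNb.
  by case: (k i) => [|n]; rewrite ?mul0r // natrM /= -natr1 addrK.
have T (k : 'X_{1..N}) : \sum_(i < N) (N - i.+1)%:R * (k i)%:R = (\sum_(r < N) tsum k r)%:R :> R.
  by rewrite sum_tsum natr_sum; apply: eq_bigr => i _; rewrite natrM.
rewrite /eigE !Q !T ler_ltD //.
  by rewrite ler_pM2l // ler_nat domle_sum_bin.
by rewrite ltr_pM2l ?mulr_gt0 // ltr_nat domle_sum_tsum_lt.
Qed.

End EigenvalueOrder.

(** * Identities on positive increasing points *)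

Section Vanishing.
Context (R : realFieldType) (N : nat).
Notation S := {mpoly R[N]}.

(** The points at which the interlacing roots are pairwise distinct; see [roots_exist]. *)
Definition pos_incr (z : 'I_N -> R) : Prop :=
  (forall i, 0 < z i) /\ (forall i j : 'I_N, (i < j)%N -> z i < z j).

Lemma pos_incr_inj z : pos_incr z -> injective z.
Proof.
move=> [_ H] i j E; apply: val_inj => /=.
by case: (ltngtP i j) => // /H; rewrite E ltxx.
Qed.

Lemma poly_zeros_gt (p : {poly R}) (B : R) : (forall u, B < u -> p.[u] = 0) -> p = 0.
Proof.
move=> H; apply/eqP; apply: contraT => p0.
pose t := [seq B + 1 + n%:R | n <- iota 0 (size p)].
have : (size t < size p)%N.
  apply: max_poly_roots => //.
    apply/allP => _ /mapP[n _ ->]; apply/rootP; apply: H.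
    by have := ler0n R n; lra.
  rewrite map_inj_uniq ?iota_uniq // => n m /addrI /eqP.
  by rewrite eqr_nat => /eqP.
by rewrite size_map size_iota ltnn.
Qed.

Lemma digits_inj (d n : nat) (f g : nat -> nat) :
  (forall i, (i < n)%N -> (f i < d)%N) -> (forall i, (i < n)%N -> (g i < d)%N) ->
  (\sum_(i < n) f i * d ^ i = \sum_(i < n) g i * d ^ i)%N ->
  forall i, (i < n)%N -> f i = g i.
Proof.
elim: n f g => [//|n IH] f g Hf Hg.
rewrite !big_ord_recl !expn0 !muln1.
have E h : (\sum_(i < n) h (bump 0 i) * d ^ bump 0 i = d * \sum_(i < n) h i.+1 * d ^ i)%N.
  by rewrite big_distrr; apply: eq_bigr => i _ /=; rewrite expnS mulnCA.
rewrite !E => H.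
have f0 : (f 0%N < d)%N by exact: Hf.
have g0 : (g 0%N < d)%N by exact: Hg.
have d0 : (0 < d)%N by exact: leq_ltn_trans f0.
have E0 : f 0%N = g 0%N.
  by have := congr1 (modn^~ d) H; rewrite /= (addnC (f _)) (addnC (g _)) !(mulnC d) !modnMDl !modn_small.
move=> [_|i /= iN]; first exact: E0.
apply: (IH (f \o succn) (g \o succn)) => //=.
- by move=> j jn; apply: Hf.
- by move=> j jn; apply: Hg.
by move/eqP: H; rewrite /= E0 eqn_add2l eqn_pmul2l // => /eqP.
Qed.

(* Kronecker substitution z_i = t ^ (d ^ i). *)
Lemma mpoly_zero_on_pos_incr (Q : S) : (forall z, pos_incr z -> Q.@[z] = 0) -> Q = 0.
Proof.
(* [d] exceeds every exponent of [Q], so distinct monomials get distinct powers of [t]; as [d > 1]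
   and [t > 1], the substituted point is strictly increasing. *)
move=> H; pose d := (msize Q).+2.
pose k (m : 'X_{1..N}) := (\sum_(i < N) m i * d ^ i)%N.
pose q : {poly R} := \sum_(m <- msupp Q) Q@_m *: 'X^(k m).
have q0 : q = 0.
  apply: (@poly_zeros_gt _ 1) => t t1.
  rewrite -(H (fun i => t ^+ (d ^ i))).
    rewrite mevalE /q horner_sum; apply: eq_bigr => m _.
    rewrite hornerZ hornerXn /k -prodrXr; congr (_ * _).
    by apply: eq_bigr => i _; rewrite -exprM mulnC.
  have t0 : 0 < t by apply: lt_trans t1.
  split=> [i|i j ij]; first by rewrite exprn_gt0.
  by rewrite ltr_eXn2l // ltn_exp2l.
apply/mpolyP => m; rewrite mcoeff0.
case: (boolP (m \in msupp Q)) => [mQ|]; last exact: memN_msupp_eq0.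
have := congr1 (fun p : {poly R} => p`_(k m)) q0; rewrite coef0 /q coef_sum.
rewrite (bigD1_seq m) ?msupp_uniq //= coefZ coefXn eqxx mulr1 big_seq_cond big1 ?addr0 //.
move=> m' /andP[m'Q m'm]; rewrite coefZ coefXn; case: eqP => [E|]; last by rewrite mulr0.
have md (m1 : 'X_{1..N}) i : m1 \in msupp Q -> (nth 0%N m1 i < d)%N.
  move=> /msize_mdeg_lt h; rewrite ltnS; apply: (@leq_trans (mdeg m1)); last by apply: ltnW; apply: leqW.
  have [iN|iN] := ltnP i N; last by rewrite nth_default // size_tuple.
  by rewrite -(mnm_nth 0%N m1 (Ordinal iN)) mdegE (bigD1 (Ordinal iN)) //= leq_addr.
case/eqP: m'm; apply/mnmP => i; rewrite !(mnm_nth 0%N); apply: (@digits_inj d N) => //.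
- by move=> j _; exact: md.
- by move=> j _; exact: md.
by move: E; rewrite /k => /esym; under eq_bigr do rewrite (mnm_nth 0%N); under [in RHS]eq_bigr do rewrite (mnm_nth 0%N).
Qed.

End Vanishing.

(** * Reading the eigenvalue off the leading monomial *)

Section EigenUnique.
Context (R : realFieldType) (N : nat) (theta : R).
Notation S := {mpoly R[N]}.
Implicit Types (h g : S) (m : 'X_{1..N}).

Lemma mcoeff_euler i h k : ('X_i * h^`M(i))@_k = (k i)%:R * h@_k.
Proof.
elim/mpolyind: h => [|c m h _ _ IH]; first by rewrite mderiv0 mulr0 !mcoeff0 mulr0.
rewrite mderivD mulrDr !mcoeffD IH mulrDr; congr (_ + _).
rewrite mderivZ -scalerAr mulX_mderivX scalerA !mcoeffZ mcoeffX.
by case: eqP => [->|]; rewrite ?mulr1 ?mulr0 // mulrC.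
Qed.

Lemma mlead_XsubX (a b : 'I_N) : (a < b)%N ->
  mlead ('X_a - 'X_b : S) = U_(a)%MM /\ ('X_a - 'X_b : S)@_U_(a) = 1.
Proof.
move=> ab; have ba : (U_(b)%MM < U_(a)%MM :> 'X_{1..N})%O.
  apply/ltmcP; rewrite ?mdeg1 //; exists a => [j ja|].
    by rewrite !mnm1E -!val_eqE /= !gtn_eqF // (ltn_trans ja).
  by rewrite !mnm1E eqxx -val_eqE /= gtn_eqF.
split; first by rewrite mleadDl ?mleadN ?mleadXm.
by rewrite mcoeffB !mcoeffX eqxx eq_mnm1 -val_eqE /= gtn_eqF // subr0.
Qed.

(* Multiplying by the discriminant clears the denominators of [dop]. *)
Definition vdm : S := \prod_(p : 'I_N * 'I_N | p.1 != p.2) ('X_p.1 - 'X_p.2).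
Definition vdm2 (i j : 'I_N) : S :=
  \prod_(p : 'I_N * 'I_N | (p.1 != p.2) && (p != (i, j))) ('X_p.1 - 'X_p.2).

Lemma vdmE i j : i != j -> vdm = vdm2 i j * ('X_i - 'X_j).
Proof. by move=> ij; rewrite /vdm (bigD1 (i, j)) //= mulrC. Qed.

Lemma XsubX_neq0 (a b : 'I_N) : a != b -> 'X_a - 'X_b != 0 :> S.
Proof.
move=> ab; rewrite subr_eq0; apply: contraNneq ab => E.
have := congr1 (mcoeff U_(a)%MM) E; rewrite !mcoeffX eqxx eq_mnm1 eq_sym.
by case: eqP => // _ /eqP; rewrite oner_eq0.
Qed.

Lemma vdm2_neq0 i j : vdm2 i j != 0.
Proof. by apply/prodf_neq0 => p /andP[p12 _]; exact: XsubX_neq0. Qed.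

Lemma vdm_neq0 : vdm != 0.
Proof. by apply/prodf_neq0 => p; exact: XsubX_neq0. Qed.

(** On leading monomials [x_i / (x_i - x_j)] acts as [1] if [i < j] and as [0] if [j < i], since the
    variable of smaller index dominates. Thus the first-order term of [i] is counted [N - i.+1]
    times. *)
Lemma eigen_lead_coef (lam : R) h :
  (forall z, pos_incr z -> dop theta h z = lam * h.@[z]) ->
  h != 0 -> eigE theta (mlead h) = lam.
Proof.
move=> Hh h0; pose M := mlead h.
pose e i g : S := 'X_i * g^`M(i).
(* This is [vdm] times [D_2 h - lam h]; the difference [e i (e i h) - e i h] is [x_i^2] times the
   second derivative. *)
pose Q : S := vdm * (\sum_i (e i (e i h) - e i h) - lam *: h) +
  (2 * theta) *: \sum_i \sum_(j | j != i) vdm2 i j * ('X_i * e i h).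
have Q0 : Q = 0.
  apply: mpoly_zero_on_pos_incr => z Hz; have injz := pos_incr_inj Hz.
  have V0 (i j : 'I_N) : j != i -> (vdm2 i j).@[z] = vdm.@[z] / (z i - z j).
    move=> ji; have d0 : z i - z j != 0.
      by rewrite subr_eq0; apply: contraNneq ji => /injz ->.
    have ij : i != j by rewrite eq_sym.
    by rewrite (vdmE ij) mevalM mevalB !mevalXU mulfK.
  rewrite /Q mevalD mevalM mevalB !mevalZ !meval_sum.
  have -> : \sum_i (\sum_(j | j != i) vdm2 i j * ('X_i * e i h)).@[z] =
     vdm.@[z] * \sum_(i < N) \sum_(j < N | j != i) z i ^+ 2 / (z i - z j) * h^`M(i).@[z].
    rewrite mulr_sumr; apply: eq_bigr => i _; rewrite meval_sum mulr_sumr.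
    apply: eq_bigr => j ji; rewrite /e !mevalM V0 // mevalXU.
    by move: (h^`M(i)).@[z] => A; ring.
  have -> : \sum_i (e i (e i h) - e i h).@[z] = \sum_(i < N) z i ^+ 2 * h^`M(i)^`M(i).@[z].
    apply: eq_bigr => i _; rewrite /e mderivM mderivX mnmE eqxx scale1r.
    have -> : (U_(i) - U_(i))%MM = 0%MM :> 'X_{1..N}.
      by apply/mnmP => k; rewrite mnmBE subnn mnm0E.
    rewrite mpolyX0 mul1r mevalB !mevalM mevalD !mevalM mevalXU.
    by move: (h^`M(i)).@[z] (h^`M(i)^`M(i)).@[z] => A B; ring.
  have := Hh z Hz; rewrite /dop => E.
  transitivity (vdm.@[z] * (\sum_(i < N) z i ^+ 2 * h^`M(i)^`M(i).@[z] +
    2 * theta * (\sum_(i < N) \sum_(j < N | j != i) z i ^+ 2 / (z i - z j) * h^`M(i).@[z])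
     - lam * h.@[z])); first by ring.
  by rewrite E subrr mulr0.
pose D := mlead vdm.
have le g : (forall k, g@_k != 0 -> h@_k != 0) -> (mlead g <= M)%O.
  move=> H; have [->|g0] := eqVneq g 0; first by rewrite mlead0 le0m.
  by apply: msupp_le_mlead; rewrite mcoeff_msupp H // -mcoeff_msupp mlead_supp.
have ele i : (mlead (e i h) <= M)%O.
  by apply: le => k; rewrite mcoeff_euler mulf_eq0 negb_or => /andP[].
have c1 : (vdm * (\sum_i (e i (e i h) - e i h) - lam *: h))@_(D + M) =
   vdm@_D * ((\sum_i (M i)%:R * ((M i)%:R - 1) - lam) * h@_M).
  have C k : (\sum_i (e i (e i h) - e i h) - lam *: h)@_k =
      (\sum_i (k i)%:R * ((k i)%:R - 1) - lam) * h@_k.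
    rewrite mcoeffB mcoeffZ raddf_sum mulrBl mulr_suml; congr (_ - _).
    by apply: eq_bigr => i _ /=; rewrite mcoeffB !mcoeff_euler; ring.
  rewrite mleadcMW ?C //; apply: le => k.
  by rewrite C mulf_eq0 negb_or => /andP[].
have c2 (i j : 'I_N) : (i < j)%N ->
    (vdm2 i j * ('X_i * e i h))@_(D + M) = vdm@_D * ((M i)%:R * h@_M).
  move=> ij; have nij : i != j by rewrite -val_eqE /= ltn_eqF.
  have [L1 L2] := mlead_XsubX ij.
  have DE : D = (mlead (vdm2 i j) + U_(i))%MM.
    by rewrite /D (vdmE nij) mleadM ?vdm2_neq0 ?XsubX_neq0 // L1.
  have -> : vdm@_D = (vdm2 i j)@_(mlead (vdm2 i j)).
    by rewrite DE (vdmE nij) mleadcMW ?L1 // L2 mulr1.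
  rewrite DE -addmA mleadcMW //; last first.
    by rewrite (le_trans (mleadM_le _ _)) // mleadXm lem_add.
  by rewrite mleadcMW ?mleadXm // mcoeffX eqxx mul1r mcoeff_euler.
(* Here the factor [x_i - x_j] of [vdm] has leading monomial [x_j], and putting [x_i] in its place
   lowers the product. *)
have c3 (i j : 'I_N) : (j < i)%N -> (vdm2 i j * ('X_i * e i h))@_(D + M) = 0.
  move=> ji; have nij : i != j by rewrite -val_eqE /= gtn_eqF.
  have [L1 _] := mlead_XsubX ji.
  have DE : D = (mlead (vdm2 i j) + U_(j))%MM.
    rewrite /D (vdmE nij) mleadM ?vdm2_neq0 ?XsubX_neq0 // -opprB mleadN L1 //.
  apply: mcoeff_gt_mlead; rewrite DE -addmA.
  have ltU : (U_(i)%MM < U_(j)%MM :> 'X_{1..N})%O.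
    apply/ltmcP; rewrite ?mdeg1 //; exists j => [k kj|].
      by rewrite !mnm1E -!val_eqE /= !gtn_eqF // (ltn_trans kj).
    by rewrite !mnm1E eqxx -val_eqE /= gtn_eqF.
  apply: (@le_lt_trans _ _ (mlead (vdm2 i j) + (U_(i) + M))%MM); last first.
    by rewrite ltmc_add2r ltmc_add2l.
  rewrite (le_trans (mleadM_le _ _)) // lem_add //.
  by rewrite (le_trans (mleadM_le _ _)) // mleadXm lem_add.
have := congr1 (mcoeff (D + M)%MM) Q0; rewrite mcoeff0 /Q mcoeffD mcoeffZ c1.
have -> : (\sum_i \sum_(j | j != i) vdm2 i j * ('X_i * e i h))@_(D + M)%MM =
    vdm@_D * h@_M * \sum_(i < N) (N - i.+1)%:R * (M i)%:R.
  rewrite raddf_sum mulr_sumr; apply: eq_bigr => i _.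
  rewrite raddf_sum /= (bigID (fun j : 'I_N => (i < j)%N)) /= [X in _ + X]big1 ?addr0; last first.
    move=> j /andP[ji]; rewrite -leqNgt leq_eqVlt val_eqE (negbTE ji) /=; exact: c3.
  rewrite (eq_bigl (fun j : 'I_N => j \in ~: initseg N i.+1)); last first.
    move=> j; rewrite !inE ltnS -ltnNge andbC; case: ltnP => //= ij.
    by rewrite -val_eqE /= gtn_eqF.
  rewrite (eq_bigr (fun=> vdm@_D * ((M i)%:R * h@_M))); last first.
    by move=> j; rewrite !inE ltnS -ltnNge; exact: c2.
  by rewrite sumr_const cardsCs setCK card_initseg // card_ord -mulr_natl; ring.
move=> E.
have V0 : vdm@_D != 0 by rewrite mleadc_eq0 vdm_neq0.
have H0 : h@_M != 0 by rewrite mleadc_eq0.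
apply/eqP; rewrite -subr_eq0; apply/eqP; apply: (mulfI V0); apply: (mulfI H0).
by rewrite !mulr0 -{}E /eigE -/M; ring.
Qed.

End EigenUnique.

(** * Averaging over the weights *)

Section Intertwining.
Context (R : realFieldType) (N : nat) (theta s0 : R).
Hypotheses (theta_gt0 : 0 < theta) (s0_gt0 : 0 < s0).
Notation S := {mpoly R[N]}.
Implicit Types (F : {mpoly S[N]}) (z w y : 'I_N -> R).

Definition average F : S := map_mpoly (dirf theta s0) F.

Lemma mcoeff_average F m : (average F)@_m = dirf theta s0 F@_m.
Proof. exact: mcoeff_map_mpoly. Qed.

Lemma average_step (c : S) m F :
  average (c *: 'X_[m] + F) = dirf theta s0 c *: 'X_[m] + average F.
Proof.
apply/mpolyP => k; rewrite mcoeffD mcoeffZ !mcoeff_average mcoeffD mcoeffZ dirfD !mcoeffX.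
by case: eqP => _; rewrite ?mulr1 // !mulr0 dirf0.
Qed.

Lemma average0 : average 0 = 0.
Proof. by apply/mpolyP => k; rewrite mcoeff_average !mcoeff0 dirf0. Qed.

Lemma evw_step w (c : S) m F :
  evw w (c *: 'X_[m] + F) = c.@[w] *: 'X_[m] + evw w F.
Proof. by rewrite /evw raddfD /= map_mpolyZ map_mpolyX. Qed.

Lemma meval_average F z : (average F).@[z] = dirf theta s0 (evz z F).
Proof.
elim/mpolyind: F => [|c m F _ _ IH]; first by rewrite average0 evz0 meval0 dirf0.
rewrite average_step mevalD mevalZ IH mevalX.
have -> : evz z (c *: 'X_[m] + F) = (\prod_(i < N) z i ^+ m i) *: c + evz z F.
  rewrite /evz mevalD mevalZ mevalX mulrC -mul_mpolyC rmorph_prod /=; congr (_ * _ + _).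
  by apply: eq_bigr => i _; rewrite rmorphXn.
by rewrite dirf_lin mulrC.
Qed.

(** A linear functional in the points may be applied before the mean over the weights is taken; the
    result is a polynomial [G] in the weights, so that [dirf] makes sense on it. *)
Lemma average_functional (D : S -> R) F :
  (forall c f g, D (c *: f + g) = c * D f + D g) ->
  exists2 G : S, D (average F) = dirf theta s0 G & forall w, D (evw w F) = G.@[w].
Proof.
move=> Dlin.
have D0 : D 0 = 0.
  by have := Dlin 1 0 0; rewrite scaler0 addr0 mul1r -[LHS]addr0 => /addrI.
elim/mpolyind: F => [|c m F _ _ [G G1 G2]].
  by exists 0 => [|w]; rewrite ?average0 ?dirf0 ?evw0 ?meval0.
exists (D 'X_[m] *: c + G) => [|w].
  by rewrite average_step Dlin dirf_lin G1 mulrC.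
by rewrite evw_step Dlin G2 mevalD mevalZ mulrC.
Qed.

(** The analytic input, to be supplied over the real numbers: [Omega] will be the open simplex,
    which carries the Dirichlet distribution and where the roots are real and distinct. *)
Variable Omega : ('I_N -> R) -> Prop.
Hypothesis dirf_supp : forall g : S, (forall w, Omega w -> g.@[w] = 0) -> dirf theta s0 g = 0.
Hypothesis roots_exist : forall z, pos_incr z -> forall w, Omega w ->
  exists2 y : 'I_N -> R, injective y & genfun y (fun=> 0 : R) = genfun z w.

Lemma jop_w0 y F : jop theta y (fun=> 0) F = dop theta (evw (fun=> 0) F) y.
Proof.
rewrite /jop kop_ksum /ksum big1 ?subr0 // => i _; rewrite big1 // => j _.
by rewrite !mul0r mulr0 addr0 mulr0.
Qed.

Lemma average_eigen F (lam : R) :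
  (forall z w z' w', genfun z w = genfun z' w' -> (evw w F).@[z] = (evw w' F).@[z']) ->
  (forall z w z' w', genfun z w = genfun z' w' -> injective z -> injective z' ->
    jop theta z w F = jop theta z' w' F) ->
  (forall y, injective y ->
    dop theta (evw (fun=> 0) F) y = lam * (evw (fun=> 0) F).@[y]) ->
  forall z, pos_incr z -> dop theta (average F) z = lam * (average F).@[z].
Proof.
move=> Hev Hj He z Hz.
pose D f := dop theta f z - lam * f.@[z].
have Dlin c f g : D (c *: f + g) = c * D f + D g.
  by rewrite /D dop_lin mevalD mevalZ; move: (dop _ f z) (dop _ g z) => A B; ring.
have [G G1 G2] := average_functional F Dlin.
apply/eqP; rewrite -subr_eq0; apply/eqP; rewrite -/(D (average F)) G1.
(* The mean of the [kop] term is zero, and the remaining difference vanishes at every [w] in [Omega]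
   by transfer to the roots. *)
have -> : G = (G - kop theta z (evz z F)) + kop theta z (evz z F) by rewrite subrK.
rewrite dirfD dirf_kop // addr0; apply: dirf_supp => w Ow.
have [y injy Ey] := roots_exist Hz Ow.
rewrite mevalB -G2 /D.
have E1 : jop theta z w F = lam * (evw w F).@[z].
  rewrite (Hj _ _ _ _ (esym Ey) (pos_incr_inj Hz) injy) jop_w0 (He _ injy).
  by rewrite (Hev _ _ _ _ Ey).
by rewrite addrAC -[X in X - _]/(jop theta z w F) E1 subrr.
Qed.

Theorem jack_lift (mu : 'X_{1..N}) (P : S) : msorted mu -> P \is symmetric ->
  (forall m, m \in msupp P -> domle m mu) ->
  (forall y, injective y -> dop theta P y = eigE theta mu * P.@[y]) ->
  exists F : {mpoly S[N]},
    (forall z w y, genfun z w = genfun y (fun=> 0 : R) -> (evz z F).@[w] = P.@[y]) /\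
    (forall z, dirf theta s0 (evz z F) =
      cfact N theta s0 (fun i => nth 0%N mu i) * P.@[z]).
Proof.
move=> musort Psym Psupp Peig.
have [F [F1 F2 F3 F4 F5]] := sym_lift theta_gt0 s0_gt0 musort Psym Psupp.
exists F; split.
  by move=> z w y E; rewrite ev_comm (F2 _ _ _ _ E) F1.
move=> z; rewrite -meval_average -mevalZ; congr (_.@[z]).
pose c := cfact N theta s0 (fun i => nth 0%N mu i); rewrite -/c.
pose h := average F - c *: P.
apply/eqP; rewrite -subr_eq0 -/h; apply: contraT => h0.
have hsupp m : m \in msupp h -> domle m mu.
  move=> /msuppB_le; rewrite mem_cat => /orP[|/msuppZ_le /Psupp //].
  rewrite mcoeff_msupp mcoeff_average => H; apply: F4; rewrite mcoeff_msupp.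
  by apply: contraNneq H => ->; rewrite dirf0.
have heig x : pos_incr x -> dop theta h x = eigE theta mu * h.@[x].
  move=> Hx; have E1 := @average_eigen F (eigE theta mu) F2 F3.
  rewrite F1 in E1; have {}E1 := E1 Peig x Hx.
  have E2 := Peig x (pos_incr_inj Hx).
  have -> : h = - c *: P + average F by rewrite scaleNr addrC.
  rewrite dop_lin mevalD mevalZ E1 E2.
  by move: P.@[x] (average F).@[x] => A B; ring.
have E := eigen_lead_coef heig h0.
have lh := mlead_supp h0.
(* [sym_lift] gives the average the same coefficient of [mu] as [c *: P], so [mu] does not occur in
   [h]. *)
have ne : mlead h <> mu.
  move=> e; move: lh; rewrite e mcoeff_msupp /h mcoeffB mcoeffZ mcoeff_average F5.
  by rewrite subrr eqxx.
by have := eigE_lt theta_gt0 (hsupp _ lh) ne; rewrite E ltxx.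
Qed.

End Intertwining.

(** * Rearrangements and dominance *)

Section Rearrangement.
Context (N : nat).
Implicit Types (m : 'X_{1..N}) (I : {set 'I_N}).

Lemma msorted_tsum m I : msorted m -> (\sum_(i in I) m i <= tsum m #|I|)%N.
Proof.
move=> ms; rewrite -sumn_minn_cols ?card_leN //.
have -> : (\sum_(i in I) m i = \sum_(i in I) \sum_(c <- cols m) (i < c)%N)%N.
  by apply: eq_bigr => i _; rewrite -(count_cols _ ms) -sum1_count big_mkcond.
rewrite exchange_big sumnE big_map; apply: leq_sum => c _.
have h1 : (\sum_(i in I) (i < c) <= #|I|)%N.
  by rewrite -sum1_card; apply: leq_sum => i _; case: ltnP.
rewrite leq_min h1 /=.
have [cN|Nc] := leqP c N; last first.
  exact: leq_trans h1 (leq_trans (card_leN I) (ltnW Nc)).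
rewrite -{2}(card_initseg cN) -sum1_card [X in (_ <= X)%N]big_mkcond /=.
rewrite big_mkcond; apply: leq_sum => i _; rewrite inE.
by case: ifP; case: ltnP.
Qed.

Lemma domle_perm m m' (s : {perm 'I_N}) : msorted m ->
  (forall i, m' i = m (s i)) -> domle m' m.
Proof.
move=> ms mE; split.
  by rewrite !mdegE [RHS](reindex_inj (@perm_inj _ s)); apply: eq_bigr => i _; exact: mE.
move=> I; rewrite -(card_imset I (@perm_inj _ s)).
apply: leq_trans (msorted_tsum _ ms); rewrite big_imset /=; last by move=> i j _ _; exact: perm_inj.
by rewrite leq_eqVlt; apply/orP; left; apply/eqP; apply: eq_bigr => i _; exact: mE.
Qed.

Lemma domle_of_tsum m m' : msorted m -> mdeg m = mdeg m' ->
  (forall r, (r <= N)%N -> (tsum m r <= tsum m' r)%N) -> domle m m'.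
Proof.
move=> ms d h; split=> // I.
exact: leq_trans (msorted_tsum I ms) (h _ (card_leN I)).
Qed.

End Rearrangement.

End JackLift.

From mathcomp Require Import (coercions, canonicals) mpoly.
From mathcomp Require Import all_classical all_reals all_analysis.
From mathcomp Require Import measurable_realfun.
Import JackLift.
Import Order.TTheory GRing.Theory Num.Theory.
Import numFieldNormedType.Exports.
Local Open Scope classical_set_scope.
Local Open Scope ring_scope.

(** * Euler integrals *)

Section EulerIntegrals.
Context (R : realType).
Notation mu := (@lebesgue_measure R).
Implicit Types (a b r t v : R).

Lemma lebesgue_affine (c d : R) (c0 : 0 < c) (A : set (measurableTypeR R)) :
  measurable A ->
  pushforward (mscale (NngNum (ltW c0)) mu)
    (fun x : measurableTypeR R => (c * x + d : measurableTypeR R)) A = mu A.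
Proof.
have mphi : measurable_fun setT (fun x : measurableTypeR R => (c * x + d : measurableTypeR R)).
  by apply: measurable_funD => //; apply: measurable_funM.
move=> mA; apply/esym/lebesgue_measure_unique => //= _ [[u v]] _ <-.
rewrite /pushforward /mscale /=.
have -> : (fun x : R => c * x + d) @^-1` `]u, v] = `](u - d) / c, (v - d) / c]%classic.
  apply/seteqP; split => x /=; rewrite !in_itv /= ltr_pdivrMr // ler_pdivlMr // ltrBlDr lerBrDr mulrC //.
rewrite !lebesgue_measure_itv /= !lte_fin ltr_pM2r ?invr_gt0 // ltrD2r.
case: ifP => _; last by rewrite mule0.
by rewrite -!EFinD -EFinM; congr EFin; field; rewrite gt_eqF.
Qed.

Lemma ge0_integral_affine (c d : R) (f : measurableTypeR R -> \bar R) : 0 < c ->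
  measurable_fun setT f -> (forall x, 0 <= f x)%E ->
  (\int[mu]_x f x = c%:E * \int[mu]_x f (c * x + d)%R)%E.
Proof.
move=> c0 mf f0.
have mphi : measurable_fun setT (fun x : measurableTypeR R => (c * x + d : measurableTypeR R)).
  by apply: measurable_funD => //; apply: measurable_funM.
transitivity (\int[pushforward (mscale (NngNum (ltW c0)) mu)
    (fun x : measurableTypeR R => (c * x + d)%R : measurableTypeR R)]_x f x)%E.
  by apply: eq_measure_integral => A mA _; apply/esym/lebesgue_affine.
rewrite ge0_integral_pushforward // preimage_setT ge0_integral_mscale //.
  exact: (measurableT_comp mf mphi).
by move=> x _; exact: f0.
Qed.

(** Because it vanishes for [t <= 0], integrals over intervals and simplices become integrals over
    the whole space, and Beta integrals become convolutions. *)
Definition gpow (a t : R) : R := if 0 < t then t `^ (a - 1) else 0.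

Lemma measurable_gpow a : measurable_fun setT (gpow a).
Proof.
apply: measurable_fun_if => //.
- by apply: measurable_fun_ltr.
- by apply: measurable_funTS; exact: measurable_powR.
Qed.

Lemma gpow_ge0 a t : 0 <= gpow a t.
Proof. by rewrite /gpow; case: ifP => // _; exact: powR_ge0. Qed.

Lemma gpowM a r t : 0 < r -> gpow a (r * t) = r `^ (a - 1) * gpow a t.
Proof.
move=> r0; rewrite /gpow pmulr_rgt0 //; case: ifP => t0; last by rewrite mulr0.
by rewrite powRM // ltW.
Qed.

Definition gammaE a : \bar R := (\int[mu]_t (gpow a t * expR (- t))%:E)%E.
Definition betaE a b : \bar R := (\int[mu]_v (gpow a v * gpow b (1 - v))%:E)%E.

Lemma measurable_gpow_comp d (T : measurableType d) a (f : T -> R) :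
  measurable_fun setT f -> measurable_fun setT (fun x => gpow a (f x)).
Proof. by move=> mf; exact: (measurableT_comp (measurable_gpow a) mf). Qed.

Lemma measurable_expN : measurable_fun setT (fun t : R => expR (- t)).
Proof. by apply: measurableT_comp => //; exact: measurable_expR. Qed.

Lemma convE a b r : 0 < r ->
  (\int[mu]_v (gpow a v * gpow b (r - v))%:E = (r `^ (a + b - 1))%:E * betaE a b)%E.
Proof.
move=> r0.
have mg s : measurable_fun setT (fun v => (gpow a v * gpow b (s - v))%:E).
  apply/measurable_EFinP; apply: measurable_funM; first exact: measurable_gpow.
  by apply: measurable_gpow_comp; apply: measurable_funB.
have g0 s v : (0 <= (gpow a v * gpow b (s - v))%:E)%E by rewrite lee_fin mulr_ge0 ?gpow_ge0.
rewrite (ge0_integral_affine 0 r0 (mg r) (g0 r)).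
rewrite (_ : (fun x => _) = (fun x => (r `^ (a - 1) * r `^ (b - 1))%:E * (gpow a x * gpow b (1 - x))%:E)%E); last first.
  apply/funext => x; rewrite addr0 -{2}[r]mulr1 -mulrBr !gpowM // -EFinM; congr EFin; ring.
rewrite ge0_integralZl_EFin //; last 2 first.
- exact: mg.
- by rewrite mulr_ge0 ?powR_ge0.
rewrite muleA -EFinM; congr (_%:E * _)%E.
have rn0 : r != 0 by rewrite gt_eqF.
rewrite -powRD ?rn0 ?implybT // mulrC -[X in _ * X]powRr1 ?(ltW r0) // -powRD ?rn0 ?implybT //.
by congr (_ `^ _); ring.
Qed.

Lemma convE0 a b r : r <= 0 ->
  (\int[mu]_v (gpow a v * gpow b (r - v))%:E = 0)%E.
Proof.
move=> r0; apply: integral0_eq => v _; congr EFin; rewrite /gpow.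
case: ifP => v0; last by rewrite mul0r.
by rewrite ifF ?mulr0 //; apply/negbTE; rewrite -leNgt; lra.
Qed.

(** Tonelli, with the sum [r] of the two variables as new variable. The values are extended reals,
    so finiteness can be deduced from this identity later. *)
Lemma gammaE_mul a b : (gammaE a * gammaE b = gammaE (a + b) * betaE a b)%E.
Proof.
have m1 c : measurable_fun setT (fun t : R => gpow c t * expR (- t)).
  by apply: measurable_funM; [exact: measurable_gpow|exact: measurable_expN].
have p1 c t : 0 <= gpow c t * expR (- t) by rewrite mulr_ge0 ?gpow_ge0 ?expR_ge0.
have mE c : measurable_fun setT (fun t : measurableTypeR R => (gpow c t * expR (- t))%:E).
  by apply/measurable_EFinP; exact: m1.
have pE c : forall t : measurableTypeR R, [set: measurableTypeR R] t -> (0 <= (gpow c t * expR (- t))%:E)%E.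
  by move=> t _; rewrite lee_fin.
have gE c : (0 <= gammaE c)%E by apply: integral_ge0 => t _; rewrite lee_fin.
have bE : (0 <= betaE a b)%E by apply: integral_ge0 => t _; rewrite lee_fin mulr_ge0 ?gpow_ge0.
pose f (p : measurableTypeR R * measurableTypeR R) : \bar R :=
  (gpow a p.1 * gpow b (p.2 - p.1) * expR (- p.2))%:E.
have mf : measurable_fun setT f.
  apply/measurable_EFinP; apply: measurable_funM; first apply: measurable_funM.
  - exact: measurable_gpow_comp.
  - by apply: measurable_gpow_comp; apply: measurable_funB.
  - by apply: measurableT_comp measurable_expN _.
have f0 p : (0 <= f p)%E by rewrite lee_fin !mulr_ge0 ?gpow_ge0 ?expR_ge0.
transitivity (\int[mu]_v \int[mu]_r f (v, r))%E.
  rewrite {1}/gammaE -(ge0_integralZr mu measurableT (mE a) (pE a) (gE b)).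
  apply: eq_integral => v _.
  have pv : (0 <= (gpow a v * expR (- v))%:E)%E by rewrite lee_fin.
  rewrite /gammaE -(ge0_integralZl mu measurableT (mE b) (pE b) pv).
  have mv : measurable_fun setT (fun t : measurableTypeR R =>
      ((gpow a v * expR (- v))%:E * (gpow b t * expR (- t))%:E)%E).
    by apply/measurable_EFinP/measurable_funM => //; exact: m1.
  rewrite (ge0_integral_affine (- v) (@ltr01 R) mv); last first.
    by move=> x; rewrite -EFinM lee_fin mulr_ge0.
  rewrite mul1e; apply: eq_integral => r _; rewrite mul1r -EFinM; congr EFin.
  have -> : expR (- r) = expR (- v) * expR (- (r - v)) by rewrite -expRD; congr expR; ring.
  by rewrite /=; ring.
rewrite (fubini_tonelli _ mf) //.
rewrite {1}/gammaE -(ge0_integralZr mu measurableT (mE (a + b)) (pE (a + b)) bE).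
apply: eq_integral => r _.
transitivity (\int[mu]_v (gpow a v * gpow b (r - v))%:E * (expR (- r))%:E)%E.
  have mg : measurable_fun setT (fun v : measurableTypeR R => (gpow a v * gpow b (r - v))%:E).
    apply/measurable_EFinP; apply: measurable_funM; first exact: measurable_gpow.
    by apply: measurable_gpow_comp; apply: measurable_funB.
  have g0 (v : measurableTypeR R) : [set: measurableTypeR R] v -> (0 <= (gpow a v * gpow b (r - v))%:E)%E.
    by rewrite lee_fin mulr_ge0 ?gpow_ge0.
  have e0 : (0 <= (expR (- r))%:E)%E by rewrite lee_fin expR_ge0.
  by rewrite -(ge0_integralZr mu measurableT mg g0 e0).
have [r0|r0] := leP (r : R) 0.
  by rewrite (convE0 _ _ r0) [gpow (a + b) r]/gpow ltNge r0 /= mul0r !mul0e.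
by rewrite (convE _ _ r0) [gpow (a + b) r]/gpow r0 muleAC -EFinM.
Qed.

Lemma gammaE_ge0 a : (0 <= gammaE a)%E.
Proof. by apply: integral_ge0 => t _; rewrite lee_fin mulr_ge0 ?gpow_ge0 ?expR_ge0. Qed.

End EulerIntegrals.

Section EulerGamma.
Context (R : realType).
Notation mu := (@lebesgue_measure R).
Implicit Types (a b r t v : R).

Lemma integral_powR_seg (a q : R) : 0 < a -> 0 < q -> q < 1 ->
  (\int[mu]_(t in `[q, 1%R]) (t `^ (a - 1))%:E = ((1 - q `^ a) / a)%:E)%E.
Proof.
move=> a0 q0 q1.
have D (x : R) : 0 < x -> is_derive x (1:R) (fun t : R => t `^ a / a) (x `^ (a - 1)).
  move=> x0; have := is_derive1_powR a x0 => H.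
  have HZ := is_deriveZ a^-1 H.
  have E : (fun t : R => t `^ a / a) = a^-1 \*: ((powR (R:=R))^~ a) by apply/funext => t /=; rewrite mulrC.
  rewrite E; apply: (is_derive_eq HZ).
  by rewrite /GRing.scale /= mulrA mulVf ?mul1r // gt_eqF.
have C b (x : R) : 0 < x -> {for x, continuous (fun t : R => t `^ b)}.
  move=> x0; apply: differentiable_continuous; apply/derivable1_diffP.
  by apply: derivable_powR; rewrite in_itv /= x0.
rewrite (@continuous_FTC2 _ _ (fun t : R => t `^ a / a)) //.
- by rewrite -EFinD powR1 mulrBl.
- apply: continuous_in_subspaceT => x; rewrite inE /= in_itv /= => /andP[qx _].
  by apply: C; apply: lt_le_trans qx.
- split.
  + by move=> x; rewrite in_itv /= => /andP[qx _]; apply: ex_derive; apply: D; apply: lt_trans qx.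
  + apply: cvg_at_right_filter.
    by apply: cvgM; [apply: C|apply: cvg_cst].
  + apply: cvg_at_left_filter.
    by apply: cvgM; [apply: C|apply: cvg_cst].
- move=> x; rewrite in_itv /= => /andP[qx _].
  have x0 : 0 < x by apply: lt_trans qx.
  by rewrite derive1E; have := D x x0 => -[_ ->].
Qed.

Lemma integral_powR01 a : 0 < a ->
  (\int[mu]_(t in `]0%R, 1%R]) (t `^ (a - 1))%:E = (a^-1)%:E)%E.
Proof.
move=> a0.
(* The integrand may be unbounded at [0], whence the exhaustion of []0, 1]]; [n.+2] keeps the left
   end below [1]. *)
pose F (n : nat) : set (measurableTypeR R) := `[(n.+2%:R^-1 : R), 1%R]%classic.
have EF : \bigcup_n F n = `]0%R, 1%R]%classic.
  apply/seteqP; split => x /=.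
    by move=> [n _] /=; rewrite /F /= !in_itv /= => /andP[nx ->]; rewrite andbT (lt_le_trans _ nx) // invr_gt0.
  rewrite in_itv /= => /andP[x0 x1].
  have [n nx] : exists n : nat, x^-1 < n%:R by exists (Num.truncn x^-1).+1; rewrite truncnS_gt.
  exists n => //; rewrite /F /= in_itv /= x1 andbT invf_ple ?posrE //.
  by rewrite (le_trans (ltW nx)) // ler_nat; lia.
rewrite -EF.
have H : (\int[mu]_(x in F i) (x `^ (a - 1))%:E @[i --> \oo] -->
    \int[mu]_(x in \bigcup_i F i) (x `^ (a - 1))%:E)%E.
  apply: ge0_nondecreasing_set_cvg_integral.
  - move=> m n mn; apply/subsetPset => x; rewrite /F /= !in_itv /= => /andP[mx ->]; rewrite andbT.
    by rewrite (le_trans _ mx) // lef_pV2 ?posrE // ler_nat.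
  - by move=> n; exact: measurable_itv.
  - by move=> n; apply/measurable_EFinP; apply: measurable_funTS; exact: measurable_powR.
  - by move=> n x _; rewrite lee_fin powR_ge0.
have E n : (\int[mu]_(x in F n) (x `^ (a - 1))%:E = ((1 - n.+2%:R^-1 `^ a) / a)%:E)%E.
  by apply: integral_powR_seg => //; rewrite ?invr_gt0 // invf_lt1 // ltr1n.
have H2 : ((1 - n.+2%:R^-1 `^ a) / a)%:E @[n --> \oo] --> (a^-1)%:E.
  apply: cvg_EFin; first by near=> n.
  rewrite [X in _ --> X](_ : _ = (1 - 0) / a); last by rewrite subr0 mul1r.
  rewrite (_ : _ \o _ = (fun n : nat => (1 - n.+2%:R^-1 `^ a) / a)); last by apply/funext => n.
  apply: cvgM; last exact: cvg_cst.
  apply: cvgB; first exact: cvg_cst.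
  suff S : (n.+2%:R^-1 : R) @[n --> \oo] --> 0^'+ by exact: (cvg_comp _ _ S (powR_cvg0 a0)).
  move=> A [e /= e0 He]; change (\forall n \near \oo, A (n.+2%:R^-1)); near=> n.
  have n0 : 0 < n.+2%:R^-1 :> R by rewrite invr_gt0.
  apply: (He _ _ n0) => /=.
  rewrite sub0r normrN ger0_norm ?invr_ge0 // invf_plt ?posrE //.
  apply: (@lt_trans _ _ n%:R); last by rewrite ltr_nat; lia.
  by near: n; apply: nbhs_infty_gtr.
by rewrite -(funext E) in H2; rewrite -(cvg_lim _ H2) // (cvg_lim _ H).
Unshelve. all: end_near. Qed.

Lemma gammaE_restrict a :
  (gammaE a = \int[mu]_(t in `]0%R, +oo[) (t `^ (a - 1) * expR (- t))%:E)%E.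
Proof.
rewrite [RHS]integral_mkcond; apply: eq_integral => t _.
rewrite patchE /gpow; case: ifPn => t0; case: ifPn => //.
- by rewrite notin_setE /= in_itv /= t0.
- by rewrite inE /= in_itv /= andbT (negbTE t0).
- by rewrite mul0r.
Qed.

Lemma betaEx1 a : 0 < a -> betaE a 1 = (a^-1)%:E.
Proof.
move=> a0; rewrite -(integral_powR01 a0) -integral_itv_bndo_bndc; last first.
  by apply/measurable_EFinP; apply: measurable_funTS; exact: measurable_powR.
rewrite [RHS]integral_mkcond; apply: eq_integral => t _.
rewrite patchE /gpow subrr powRr0 subr_gt0; case: ifPn => t0; case: ifPn => t1; case: ifPn => //.
- by rewrite mulr1.
- by rewrite notin_setE /= in_itv /= t0 t1.
- by rewrite inE /= in_itv /= (negbTE t1) andbF.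
- by rewrite mulr0.
- by rewrite inE /= in_itv /= (negbTE t0).
- by rewrite mul0r.
- by rewrite inE /= in_itv /= (negbTE t0).
- by rewrite mul0r.
Qed.

Lemma gammaE1 : gammaE 1 = 1%E :> \bar R.
Proof.
rewrite -(@integral_exponential_pdf R 1 ltr01) gammaE_restrict.
transitivity (\int[mu]_(x in `[0%R, +oo[) (expR (- x))%:E)%E; last first.
  rewrite integral_mkcond; apply: eq_integral => x _.
  rewrite /exponential_pdf !patchE; case: ifP => // _.
  by rewrite mul1r mulN1r.
rewrite -integral_itv_obnd_cbnd; last first.
  by apply/measurable_EFinP; apply: measurable_funTS; exact: measurable_expN.
by apply: eq_integral => x _; rewrite subrr powRr0 mul1r.
Qed.

(** The case [b = 1] of [gammaE_mul], since [betaE a 1] is the inverse of [a]; it replaces the usual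
    integration by parts. *)
Lemma gammaES a : 0 < a -> (gammaE (a + 1) = a%:E * gammaE a)%E.
Proof.
move=> a0; have := gammaE_mul a 1.
rewrite gammaE1 mule1 betaEx1 // => ->.
by rewrite muleCA -EFinM mulfV ?gt_eqF // mule1.
Qed.

Lemma gammaE_gt0 a : 0 < a -> (0 < gammaE a)%E.
Proof.
move=> a0.
have k0 : 0 <= expR (-1) :> R by exact: expR_ge0.
(* On []0, 1]] the exponential is at least [expR (-1)], and the power integrates to the inverse of
   [a]. *)
apply: (@lt_le_trans _ _ ((expR (-1))%:E * (a^-1)%:E)%E).
  by rewrite -EFinM lte_fin mulr_gt0 ?expR_gt0 ?invr_gt0.
rewrite -(integral_powR01 a0) integral_mkcond.
have mp : measurable_fun [set: measurableTypeR R]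
   ((fun t : measurableTypeR R => (t `^ (a - 1))%:E) \_ `]0%R, 1%R]).
  apply: (iffLR (measurable_restrictT _ _)) => //.
  by apply/measurable_EFinP; apply: measurable_funTS; exact: measurable_powR.
have pp (t : measurableTypeR R) : [set: measurableTypeR R] t ->
   (0 <= ((fun t : measurableTypeR R => (t `^ (a - 1))%:E) \_ `]0%R, 1%R]) t)%E.
  by move=> _; rewrite patchE; case: ifP => // _; rewrite lee_fin powR_ge0.
have k0E : (0 <= (expR (-1))%:E :> \bar R)%E by rewrite lee_fin.
rewrite -(ge0_integralZl mu measurableT mp pp k0E).
apply: ge0_le_integral => //.
- by move=> t _; rewrite mule_ge0 //; exact: pp.
- by apply: emeasurable_funM.
- apply/measurable_EFinP; apply: measurable_funM; first exact: measurable_gpow.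
  exact: measurable_expN.
- move=> t _; rewrite patchE; case: ifPn; last first.
    by rewrite mule0 lee_fin mulr_ge0 ?gpow_ge0 ?expR_ge0.
  rewrite inE /= in_itv /= => /andP[t0 t1].
  by rewrite -EFinM lee_fin /gpow t0 mulrC ler_wpM2l ?powR_ge0 // ler_expR lerN2.
Qed.

(** The functional equation reduces to [a <= 1], where the integrand is at most the power on []0,
    1]] and at most the exponential beyond. *)
Lemma gammaE_lty a : 0 < a -> (gammaE a < +oo)%E.
Proof.
move=> a0; have [n an] : exists n : nat, a <= n.+1%:R.
  by exists (Num.truncn a).+1; rewrite ltW // (lt_le_trans (truncnS_gt a)) // ler_nat.
elim: n a a0 an => [|n IH] a a0 an; last first.
  have [a1|a1] := leP a n.+1%:R; first exact: IH.
  have b0 : 0 < a - 1 by rewrite subr_gt0 (le_lt_trans _ a1) // ler1n.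
  rewrite -(subrK 1 a) gammaES //.
  by rewrite lte_mul_pinfty ?lee_fin ?(ltW b0) //; apply: IH => //; rewrite lerBlDr natr1.
have p1 : measurable_fun [set: measurableTypeR R]
   ((fun t : measurableTypeR R => (t `^ (a - 1))%:E) \_ `]0%R, 1%R]).
  apply: (iffLR (measurable_restrictT _ _)) => //.
  by apply/measurable_EFinP; apply: measurable_funTS; exact: measurable_powR.
have pp (t : measurableTypeR R) : [set: measurableTypeR R] t ->
   (0 <= ((fun t : measurableTypeR R => (t `^ (a - 1))%:E) \_ `]0%R, 1%R]) t)%E.
  by move=> _; rewrite patchE; case: ifP => // _; rewrite lee_fin powR_ge0.
have m2 c : measurable_fun [set: measurableTypeR R]
    (fun t : measurableTypeR R => (gpow c t * expR (- t))%:E).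
  apply/measurable_EFinP; apply: measurable_funM; first exact: measurable_gpow.
  exact: measurable_expN.
have p2 c (t : measurableTypeR R) : [set: measurableTypeR R] t ->
   (0 <= (gpow c t * expR (- t))%:E)%E.
  by move=> _; rewrite lee_fin mulr_ge0 ?gpow_ge0 ?expR_ge0.
apply: (@le_lt_trans _ _ ((a^-1)%:E + gammaE 1)%E); last by rewrite gammaE1 ltry.
rewrite -(integral_powR01 a0) integral_mkcond /gammaE.
rewrite -(ge0_integralD mu measurableT pp p1 (p2 1) (m2 1)).
apply: ge0_le_integral => //.
- exact: p2.
- by apply: emeasurable_funD => //; exact: m2.
- move=> t _; rewrite patchE /gpow subrr powRr0; case: (ltP 0 t) => t0.
    case: ifPn => [t1|]; last first.
      rewrite notin_setE /= in_itv /= t0 /= => /negP; rewrite -ltNge => t1.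
      rewrite add0e lee_fin ler_wpM2r ?expR_ge0 //.
      have := @ler_powR _ _ (ltW t1) (a - 1) 0; rewrite powRr0; apply.
      by rewrite subr_le0.
    rewrite -EFinD lee_fin mul1r -[X in X <= _]addr0 lerD ?expR_ge0 //.
    by rewrite ler_piMr ?powR_ge0 // expR_le1; lra.
  rewrite mul0r; case: ifPn => _; last by rewrite adde0.
  by rewrite adde0 lee_fin powR_ge0.
Qed.

Lemma GammaE a : 0 < a -> gammaE a = (Gamma a)%:E.
Proof.
move=> a0; rewrite /Gamma /Rintegral -gammaE_restrict fineK //.
by rewrite ge0_fin_numE ?gammaE_ge0 // gammaE_lty.
Qed.

Lemma Gamma_gt0 a : 0 < a -> 0 < Gamma a.
Proof. by move=> a0; rewrite -lte_fin -GammaE // gammaE_gt0. Qed.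

Lemma GammaS a : 0 < a -> Gamma (a + 1) = a * Gamma a.
Proof.
move=> a0; have := gammaES a0; rewrite !GammaE ?addr_gt0 //.
by rewrite -EFinM => -[].
Qed.

Lemma poch_prod a n : 0 < a -> poch a n = \prod_(j < n) (a + j%:R).
Proof.
move=> a0; rewrite /poch; elim: n => [|n IH].
  by rewrite big_ord0 addr0 divff // gt_eqF // Gamma_gt0.
rewrite big_ord_recr /= -IH -natr1 addrA GammaS ?ltr_wpDr //.
by rewrite [RHS]mulrC mulrA.
Qed.

Lemma betaE_Gamma a b : 0 < a -> 0 < b ->
  betaE a b = (Gamma a * Gamma b / Gamma (a + b))%:E.
Proof.
move=> a0 b0; have ab0 : 0 < a + b by rewrite addr_gt0.
have := gammaE_mul a b; rewrite !GammaE // => E.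
have G0 : Gamma (a + b) != 0 by rewrite gt_eqF // Gamma_gt0.
rewrite -[LHS]mul1e -(mulVf G0) EFinM -muleA -E -!EFinM; congr EFin.
by rewrite mulrC.
Qed.

End EulerGamma.

(** * The Dirichlet density *)

Section Density.
Context d (T : measurableType d) (R : realType) (m : {measure set T -> \bar R}).
Variables (G : T -> R) (mG : measurable_fun setT G) (G0 : forall x, 0 <= G x).

(** Made a measure in its own right, so that the kernel is a pushforward measure and obeys a change
    of variables. *)
Definition mdensity (A : set T) : \bar R := (\int[m]_(x in A) (G x)%:E)%E.

Let mdensity0 : mdensity set0 = 0%E.
Proof. by rewrite /mdensity integral_set0. Qed.

Let mdensity_ge0 A : (0 <= mdensity A)%E.
Proof. by apply: integral_ge0 => x _; rewrite lee_fin. Qed.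

Let mdensity_sigma_additive : semi_sigma_additive mdensity.
Proof.
move=> /= F mF tF mUF; rewrite /mdensity; apply: cvg_toP.
  apply: ereal_nondecreasing_is_cvgn => n k nk.
  by apply: lee_sum_nneg_natr => // i _ _; exact: mdensity_ge0.
rewrite ge0_integral_bigcup //=; last by move=> x _; rewrite lee_fin.
by apply/measurable_EFinP; exact: measurable_funTS.
Qed.

HB.instance Definition _ := isMeasure.Build _ _ _
  mdensity mdensity0 mdensity_ge0 mdensity_sigma_additive.

Import HBNNSimple.

Lemma ge0_integral_mdensity (f : T -> \bar R) :
  measurable_fun setT f -> (forall x, 0 <= f x)%E ->
  (\int[mdensity]_x f x = \int[m]_x (f x * (G x)%:E))%E.
Proof.
move=> mf f0; pose h := nnsfun_approx measurableT mf.
have mGE : measurable_fun setT (fun x => (G x)%:E) by apply/measurable_EFinP.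
have -> : (\int[mdensity]_x f x =
    lim (\int[mdensity]_x (EFin \o h n) x @[n --> \oo]))%E.
  have fE x : setT x -> f x = lim ((EFin \o h n) x @[n --> \oo]).
    by move=> Ex; apply/esym/cvg_lim => //; apply: cvg_nnsfun_approx.
  under eq_integral => x /[!inE] /fE -> //.
  apply: monotone_convergence => //.
  - by move=> n; apply/measurable_EFinP; exact/measurable_funP.
  - by move=> n x Ex //=; rewrite lee_fin.
  - by move=> x Ex a b ab; rewrite lee_fin; exact/lefP/nd_nnsfun_approx.
have -> : (\int[m]_x (f x * (G x)%:E) =
    lim (\int[m]_x ((EFin \o h n) x * (G x)%:E) @[n --> \oo]))%E.
  have fg x : setT x -> (f x * (G x)%:E)%E = lim ((EFin \o h n) x * (G x)%:E @[n --> \oo])%E.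
    by move=> Ex; apply/esym/cvg_lim => //; apply: cvgeZr => //; apply: cvg_nnsfun_approx.
  under eq_integral => x /[!inE] /fg -> //.
  apply: monotone_convergence => [//| | |].
  - by move=> n; apply/emeasurable_funM => //; exact/measurable_EFinP.
  - by move=> n x Ex /=; rewrite mule_ge0 ?lee_fin.
  - by move=> x Ex a b ab/=; rewrite lee_wpmul2r ?lee_fin //; exact/lefP/nd_nnsfun_approx.
suff suf n : (\int[m]_x ((EFin \o h n) x * (G x)%:E) = \int[mdensity]_x (EFin \o h n) x)%E.
  by congr (limn _); apply/funext => n; rewrite suf.
transitivity (\int[mdensity]_x
   (\sum_(y \in range (h n)) (y * \1_(h n @^-1` [set y]) x)%:E))%E; last first.
  by apply: eq_integral => t tE; rewrite /= fimfunE -fsumEFin.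
have indich k r : measurable_fun setT (fun x => (r * \1_(h k @^-1` [set r]) x)%:E).
  by apply: (measurable_comp measurableT) => //; exact: measurable_funM.
rewrite ge0_integral_fsum//; last by move=> k y Ey; exact: nnfun_muleindic_ge0.
transitivity (\int[m]_x (\sum_(y \in range (h n))
    (y * \1_(h n @^-1` [set y]) x)%:E * (G x)%:E))%E.
  under [RHS]eq_integral => x xE.
    rewrite -ge0_mule_fsuml => [|y]; last exact: nnfun_muleindic_ge0.
    rewrite fsumEFin // -(fimfunE _ x); over.
  by [].
rewrite ge0_integral_fsum//; last 2 first.
  - by move=> y; apply: emeasurable_funM.
  - by move=> k y Ey; rewrite mule_ge0 ?lee_fin // -lee_fin EFinM nnfun_muleindic_ge0.
apply: eq_fsbigr => r rhn.
under [RHS]eq_integral do rewrite EFinM.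
rewrite integralZl_indic_nnsfun => //.
under eq_integral do rewrite EFinM -muleA.
have r0 : 0 <= r by move: rhn; rewrite inE => -[x _ <-].
rewrite ge0_integralZl//.
- under eq_integral do rewrite muleC.
  rewrite (eq_integral ((fun x => (G x)%:E) \_ (h n @^-1` [set r]))); last first.
    by move=> x xE; rewrite epatch_indic.
  by rewrite -integral_mkcondr setTI integral_indic// setIT.
- by apply: emeasurable_funM => //; exact/measurable_EFinP.
- by move=> x _; rewrite mule_ge0 ?lee_fin.
Qed.

Lemma integral_pushforward_mdensity d' (T' : measurableType d') (phi : T -> T')
    (f : T' -> R) :
  measurable_fun setT phi -> measurable_fun setT f ->
  (\int[pushforward mdensity phi]_y (f y)%:E =
   \int[m]_x (f (phi x) * G x)%:E)%E.
Proof.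
move=> mphi mf.
have mfE : measurable_fun setT (fun y => (f y)%:E) by apply/measurable_EFinP.
have key (g : T' -> \bar R) : measurable_fun setT g -> (forall y, 0 <= g y)%E ->
    (\int[pushforward mdensity phi]_y g y = \int[m]_x (g (phi x) * (G x)%:E))%E.
  move=> mg g0; rewrite ge0_integral_pushforward // ?preimage_setT.
  exact: (ge0_integral_mdensity (measurableT_comp mg mphi) (fun x => g0 (phi x))).
rewrite [LHS]integralE [RHS]integralE key; [|exact: measurable_funepos|exact: funepos_ge0].
rewrite key; [|exact: measurable_funeneg|exact: funeneg_ge0].
congr (_ - _)%E; apply: eq_integral => x _.
  by rewrite !funeposE maxe_pMl ?lee_fin // mul0e.
by rewrite !funenegE maxe_pMl ?lee_fin // mul0e EFinM mulNe.
Qed.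

End Density.

Lemma sigma_finite_product d1 d2 (T1 : measurableType d1) (T2 : measurableType d2)
  (R : realType) (m1 : {sigma_finite_measure set T1 -> \bar R})
  (m2 : {sigma_finite_measure set T2 -> \bar R}) : sigma_finite setT (m1 \x m2)%E.
Proof.
have /sigma_finiteP[F [TF ndF Foo]] := sigma_finiteT m1.
have /sigma_finiteP[G [TG ndG Goo]] := sigma_finiteT m2.
exists (fun n => F n `*` G n).
  apply/esym/eq_set => -[x y]; apply/propext; split => // _.
  have [i _ Fi] : (\bigcup_i F i) x by rewrite -TF.
  have [j _ Gj] : (\bigcup_i G i) y by rewrite -TG.
  exists (maxn i j) => //; split => /=.
    by move: x Fi; exact/subsetPset/ndF/leq_maxl.
  by move: y Gj; exact/subsetPset/ndG/leq_maxr.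
move=> k; have [mF Fk] := Foo k; have [mG Gk] := Goo k.
split; first exact: measurableX.
by rewrite product_measure1E // lte_mul_pinfty // ge0_fin_numE.
Qed.

(** * Lebesgue measure on tuples *)

Section LebesgueTuple.
Context (R : realType).
Notation mu := (@lebesgue_measure R).

Lemma measurable_cons_pair n :
  measurable_fun setT (fun p : measurableTypeR R * n.-tuple (measurableTypeR R) =>
                 [tuple of p.1 :: p.2]).
Proof. by apply: measurable_cons. Qed.

(** The recursive [lebesgue_tuple] is a bare set function; Tonelli in each further dimension
    requires it to be a sigma-finite measure. *)
Lemma lebesgue_tuple_measure n :
  exists m : {sigma_finite_measure set (n.-tuple (measurableTypeR R)) -> \bar R},
    @lebesgue_tuple R n = m.
Proof.
elim: n => [|n [m IH]].
  by exists (\d_ ([tuple] : 0.-tuple (measurableTypeR R))).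
rewrite /= IH.
pose phi (p : measurableTypeR R * n.-tuple (measurableTypeR R)) : n.+1.-tuple (measurableTypeR R) := [tuple of p.1 :: p.2].
have mphi : measurable_fun setT phi by exact: measurable_cons_pair.
pose psi (v : n.+1.-tuple (measurableTypeR R)) : measurableTypeR R * n.-tuple (measurableTypeR R) := (thead v, [tuple of behead v]).
have mpsi : measurable_fun setT psi.
  apply: measurable_fun_pair; first exact: measurable_tnth.
  exact: measurable_behead.
have phiK p : psi (phi p) = p.
  by case: p => a b; congr (_, _); apply: val_inj.
pose P0 : {measure set (n.+1.-tuple (measurableTypeR R)) -> \bar R} := pushforward (mu \x m)%E phi.
pose P := P0 mphi.
have sP : sigma_finite setT P.
  have [F FT FP] := sigma_finite_product mu m.
  exists (fun i => psi @^-1` F i).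
    by rewrite -preimage_bigcup -FT preimage_setT.
  move=> i; have [mF Foo] := FP i; split.
    by rewrite -[X in measurable X]setTI; exact: mpsi.
  rewrite /P /= /pushforward (_ : _ @^-1` _ = F i) //.
  by apply/seteqP; split => p /=; rewrite phiK.
pose S := Measure_isSigmaFinite.Build _ _ _ P sP.
pose Q : {sigma_finite_measure set (n.+1.-tuple (measurableTypeR R)) -> \bar R} := HB.pack_for {sigma_finite_measure set (n.+1.-tuple (measurableTypeR R)) -> \bar R} (P : set _ -> \bar R) P S.
by exists Q.
Qed.

End LebesgueTuple.

Section DirichletIntegral.
Context (R : realType).
Notation mu := (@lebesgue_measure R).

Definition leb n : {sigma_finite_measure set (n.-tuple (measurableTypeR R)) -> \bar R} :=
  sval (cid (lebesgue_tuple_measure R n)).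

Lemma lebE n : @lebesgue_tuple R n = leb n.
Proof. exact: svalP (cid (lebesgue_tuple_measure R n)). Qed.

Lemma ge0_integral_lebS n (f : n.+1.-tuple (measurableTypeR R) -> \bar R) :
  measurable_fun setT f -> (forall v, 0 <= f v)%E ->
  (\int[leb n.+1]_v f v =
   \int[mu]_t \int[leb n]_v f [tuple of (t : measurableTypeR R) :: v])%E.
Proof.
move=> mf f0; rewrite -[in LHS]lebE /= lebE.
rewrite (ge0_integral_pushforward (measurable_cons_pair (R := R) (n := n))) //.
rewrite preimage_setT fubini_tonelli1 //.
  exact: (measurableT_comp mf (measurable_cons_pair (R := R) (n := n))).
by move=> x; exact: f0.
Qed.

(* The unnormalized Dirichlet density on the simplex of total mass [r]; it
   vanishes off the simplex, because [gpow] vanishes on nonpositive numbers. *)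
Definition gdir n (s0 : R) (s : 'I_n -> R) (r : R) (v : n.-tuple (measurableTypeR R)) : R :=
  gpow s0 (r - \sum_i tnth v i) * \prod_i gpow (s i) (tnth v i).

Lemma measurable_gdir n s0 (s : 'I_n -> R) r : measurable_fun setT (gdir s0 s r).
Proof.
apply: measurable_funM.
  apply: measurable_gpow_comp; apply: measurable_funB => //.
  by apply: measurable_sum => i; exact: measurable_tnth.
by apply: measurable_prod => i _; apply: measurable_gpow_comp; exact: measurable_tnth.
Qed.

Lemma gdir_ge0 n s0 (s : 'I_n -> R) r v : 0 <= gdir s0 s r v.
Proof. by rewrite mulr_ge0 ?gpow_ge0 // prodr_ge0 // => i _; exact: gpow_ge0. Qed.

Lemma gdir_cons n s0 (s : 'I_n.+1 -> R) r t (v : n.-tuple (measurableTypeR R)) :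
  gdir s0 s r [tuple of t :: v] =
  gpow (s ord0) t * gdir s0 (s \o lift ord0) (r - t) v.
Proof.
rewrite /gdir !big_ord_recl !tnth0 opprD addrA.
have E i : tnth [tuple of t :: v] (lift ord0 i) = tnth v i by rewrite !(tnth_nth t).
rewrite (eq_bigr _ (fun i _ => E i)) mulrCA; congr (_ * (_ * _)).
by apply: eq_bigr => i _; rewrite E.
Qed.

(** When the first coordinate is [t], the others range over the simplex of mass [r - t], which is
    why [r] is arbitrary; the integral over [t] is then the Beta convolution [convE]. *)
Lemma dirichlet_integral n s0 (s : 'I_n -> R) r : 0 < s0 -> (forall i, 0 < s i) ->
  (\int[leb n]_v (gdir s0 s r v)%:E = (gpow (s0 + \sum_i s i) r *
   (Gamma s0 * (\prod_i Gamma (s i)) / Gamma (s0 + \sum_i s i)))%:E)%E.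
Proof.
move=> s0_gt0; elim: n s r => [|n IH] s r s_gt0.
  rewrite -[in LHS]lebE /= integral_dirac //; last by apply/measurable_EFinP; exact: measurable_gdir.
  rewrite diracE in_setT mul1e /gdir !big_ord0 subr0 !mulr1 addr0.
  by rewrite divff ?mulr1 // gt_eqF // Gamma_gt0.
have sum_gt0 : 0 < s0 + \sum_i s (lift ord0 i).
  by rewrite ltr_wpDr // sumr_ge0 // => i _; exact: ltW.
rewrite ge0_integral_lebS; last 2 first.
- by apply/measurable_EFinP; exact: measurable_gdir.
- by move=> v; rewrite lee_fin gdir_ge0.
set S := s0 + _ in sum_gt0.
pose K := Gamma s0 * (\prod_i Gamma (s (lift ord0 i))) / Gamma S.
have K0 : 0 <= K.
  rewrite divr_ge0 ?mulr_ge0 ?prodr_ge0 ?ltW ?Gamma_gt0 // => i _.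
  by rewrite ltW // Gamma_gt0.
transitivity (\int[mu]_t ((gpow (s ord0) t * gpow S (r - t))%:E * K%:E))%E.
  apply: eq_integral => t _.
  under eq_integral do rewrite gdir_cons EFinM.
  rewrite ge0_integralZl //; last 3 first.
  - by apply/measurable_EFinP; exact: measurable_gdir.
  - by move=> v _; rewrite lee_fin gdir_ge0.
  - by rewrite lee_fin gpow_ge0.
  by rewrite (IH _ _ (fun i => s_gt0 (lift ord0 i))) -!EFinM; congr EFin; exact: mulrA.
have mc : measurable_fun setT (fun t : measurableTypeR R => (gpow (s ord0) t * gpow S (r - t))%:E).
  apply/measurable_EFinP; apply: measurable_funM; first exact: measurable_gpow.
  by apply: measurable_gpow_comp; apply: measurable_funB.
have c0 : forall t : measurableTypeR R, [set: measurableTypeR R] t ->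
    (0 <= (gpow (s ord0) t * gpow S (r - t))%:E)%E.
  by move=> t _; rewrite lee_fin mulr_ge0 ?gpow_ge0.
have K0E : (0 <= K%:E :> \bar R)%E by rewrite lee_fin.
rewrite (ge0_integralZr mu measurableT mc c0 K0E).
have -> : s0 + \sum_i s i = s ord0 + S by rewrite big_ord_recl /S addrCA.
rewrite [X in Gamma s0 * X]big_ord_recl.
have [r0|r0] := leP (r : R) 0.
  by rewrite (convE0 _ _ r0) mul0e [gpow (_ + _) r]/gpow ltNge r0 /= mul0r.
rewrite (convE _ _ r0) (betaE_Gamma (s_gt0 ord0) sum_gt0) [gpow (_ + _) r]/gpow r0 -!EFinM.
have alg (q g1 i2 g3 g4 p : R) : g1 != 0 ->
    q * (g3 * g1 * i2) * (g4 * p / g1) = q * (g4 * (g3 * p) * i2) by move=> g10; field.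
congr EFin; exact: (alg _ _ _ _ _ _ (lt0r_neq0 (Gamma_gt0 sum_gt0))).
Qed.

End DirichletIntegral.

Section DirichletMoments.
Context (R : realType) (N : nat) (theta s0 : R).
Hypotheses (theta_gt0 : 0 < theta) (s0_gt0 : 0 < s0).

Lemma gpow_shift (a t : R) k : t ^+ k * gpow a t = gpow (a + k%:R) t.
Proof.
rewrite /gpow; case: ifPn => t0; last by rewrite mulr0.
rewrite -powR_mulrn ?(ltW t0) // -powRD ?(gt_eqF t0) ?implybT //.
by congr (_ `^ _); ring.
Qed.

Lemma Gamma_rise (a : R) k : 0 < a -> Gamma (a + k%:R) = rise a k * Gamma a.
Proof.
move=> a0; rewrite /rise -poch_prod // /poch divfK // gt_eqF // Gamma_gt0 //.
Qed.

Definition gdens (v : N.-tuple (measurableTypeR R)) : R :=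
  Gamma (s0 + N%:R * theta) / (Gamma s0 * \prod_(i < N) Gamma theta) *
  gdir s0 (fun=> theta) 1 v.

Let prodG_gt0 : 0 < \prod_(i < N) Gamma theta.
Proof. by apply: prodr_gt0 => i _; exact: Gamma_gt0. Qed.

Let S_gt0 : 0 < s0 + N%:R * theta.
Proof. by rewrite ltr_wpDr // mulr_ge0 // ltW. Qed.

Let normK_ge0 : 0 <= Gamma (s0 + N%:R * theta) / (Gamma s0 * \prod_(i < N) Gamma theta).
Proof.
apply: divr_ge0; first by apply: ltW; exact: Gamma_gt0.
by apply: ltW; apply: mulr_gt0 => //; exact: Gamma_gt0.
Qed.

Lemma gdens_ge0 v : 0 <= gdens v.
Proof. by apply: mulr_ge0 => //; exact: gdir_ge0. Qed.

Lemma measurable_gdens : measurable_fun setT gdens.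
Proof. by apply: measurable_funM => //; exact: measurable_gdir. Qed.

Lemma gdens_moment (m : mpoly.multinom N) (v : N.-tuple (measurableTypeR R)) :
  (\prod_i tnth v i ^+ m i) * gdens v =
  Gamma (s0 + N%:R * theta) / (Gamma s0 * \prod_(i < N) Gamma theta) *
  gdir s0 (fun i => theta + (m i)%:R) 1 v.
Proof.
rewrite /gdens /gdir mulrCA; congr (_ * _); rewrite mulrCA; congr (_ * _).
by rewrite -big_split; apply: eq_bigr => i _; exact: gpow_shift.
Qed.

Lemma dirichlet_moment (m : mpoly.multinom N) :
  (\int[leb R N]_v ((\prod_i tnth v i ^+ m i) * gdens v)%:E
   = (dmom theta s0 m)%:E)%E.
Proof.
have Gt : Gamma theta != 0 by rewrite gt_eqF // Gamma_gt0.
have Gs : Gamma s0 != 0 by rewrite gt_eqF // Gamma_gt0.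
have GS : Gamma (s0 + N%:R * theta) != 0 by rewrite gt_eqF // Gamma_gt0.
have Gp : \prod_(i < N) Gamma theta != 0 by rewrite gt_eqF.
under eq_integral do rewrite gdens_moment EFinM.
rewrite ge0_integralZl; last 4 first.
- by [].
- by apply/measurable_EFinP; exact: measurable_gdir.
- by move=> v _; rewrite lee_fin gdir_ge0.
- by rewrite lee_fin.
rewrite dirichlet_integral //; last by move=> i; rewrite ltr_wpDr.
have sE : s0 + \sum_i (theta + (m i)%:R) = s0 + N%:R * theta + (mpoly.mdeg m)%:R.
  rewrite big_split /= sumr_const card_ord mulr_natl addrA; congr (_ + _).
  by rewrite mpoly.mdegE natr_sum.
rewrite sE -EFinM; congr EFin; rewrite /gpow ltr01 powR1 mul1r.
rewrite Gamma_rise // [X in _ * (_ * X / _)](eq_bigr (fun i => rise theta (m i) * Gamma theta)); last first.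
  by move=> i _; exact: Gamma_rise.
rewrite big_split /= /dmom.
have R0 : rise (s0 + N%:R * theta) (mpoly.mdeg m) != 0 by rewrite gt_eqF // rise_gt0.
move: (rise (s0 + _) _) (Gamma (s0 + _)) (Gamma s0) (\prod_(i < N) Gamma theta) (\prod_(i < N) rise _ _) GS Gs Gp R0.
by move=> g1 g2 g3 g4 g5 h2 h3 h4 h1; field; rewrite h1 h2 h3 h4.
Qed.

(** Integrability is part of the induction because the integral of a sum is split at each step. *)
Lemma poly_moment (Q : mpoly.mpoly N R) :
  (leb R N).-integrable setT (fun v => (mpoly.meval (tnth v) Q * gdens v)%:E) /\
  (\int[leb R N]_v (mpoly.meval (tnth v) Q * gdens v)%:E = (dirf theta s0 Q)%:E)%E.
Proof.
elim/mpoly.mpolyind: Q => [|c m Q _ _ [iQ EQ]].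
  have E : (fun v : N.-tuple (measurableTypeR R) => (mpoly.meval (tnth v) (0 : mpoly.mpoly N R) * gdens v)%:E) = cst 0%E.
    by apply/funext => v; rewrite mpoly.meval0 mul0r.
  rewrite E; split; first exact: integrable0.
  by rewrite integral0 /dirf mpoly.msupp0 big_nil.
have iX : (leb R N).-integrable setT (fun v => ((\prod_i tnth v i ^+ m i) * gdens v)%:E).
  apply/integrableP; split.
    apply/measurable_EFinP; apply: measurable_funM; last exact: measurable_gdens.
    by apply: measurable_prod => i _; apply: measurable_funX; exact: measurable_tnth.
  under eq_integral => v _.
    rewrite gee0_abs; last first.
      by rewrite lee_fin gdens_moment mulr_ge0 ?gdir_ge0.
    over.
  by rewrite dirichlet_moment ltry.
have E (v : N.-tuple (measurableTypeR R)) :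
    (mpoly.meval (tnth v) (c *: mpoly.mpolyX R m + Q) * gdens v)%:E =
    (c%:E * ((\prod_i tnth v i ^+ m i) * gdens v)%:E + (mpoly.meval (tnth v) Q * gdens v)%:E)%E.
  by rewrite -EFinM -EFinD mpoly.mevalD mpoly.mevalZ mpoly.mevalX mulrDl -mulrA.
rewrite (funext E); split.
  by apply: integrableD => //; apply: integrableZl.
rewrite integralD //; last exact: integrableZl.
by rewrite integralZl // dirichlet_moment EQ dirf_lin dirfX -EFinM -EFinD.
Qed.

End DirichletMoments.

(** * Interlacing and measurability of the roots *)

Section InterlacedRoots.
Context (R : rcfType).
Implicit Types (s : seq (R * R)) (y : seq R).

Definition nodepoly s : {poly R} := \prod_(a <- s) ('X - a.1%:P).

(* [\sum_(a in s) a.2 \prod_(b != a) ('X - b.1)], for the pairs (point, weight). *)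
Fixpoint wsum s : {poly R} :=
  if s is a :: s' then a.2 *: nodepoly s' + ('X - a.1%:P) * wsum s' else 0.

Lemma nodepoly_cons a s : nodepoly (a :: s) = ('X - a.1%:P) * nodepoly s.
Proof. by rewrite /nodepoly big_cons. Qed.

Lemma nodepoly_cat s1 s2 : nodepoly (s1 ++ s2) = nodepoly s1 * nodepoly s2.
Proof. by rewrite /nodepoly big_cat. Qed.

Lemma nodepoly_tie x u v s1 s2 :
  nodepoly (s1 ++ (x, u) :: (x, v) :: s2) =
  ('X - x%:P) * nodepoly (s1 ++ (x, u + v) :: s2).
Proof.
by rewrite /nodepoly !big_cat !big_cons /= mulrCA.
Qed.

(* Coinciding points merge their weights and split off a root. *)
Lemma wsum_tie x u v s1 s2 :
  wsum (s1 ++ (x, u) :: (x, v) :: s2) =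
  ('X - x%:P) * wsum (s1 ++ (x, u + v) :: s2).
Proof.
elim: s1 => [|a s1 IH] /=.
  by rewrite nodepoly_cons /= scalerDl -!mul_polyC; ring.
by rewrite nodepoly_tie IH mulrDr scalerAr mulrCA.
Qed.

Lemma nodepoly_monic s : nodepoly s \is monic.
Proof. exact: monic_prod_XsubC. Qed.

Lemma size_nodepoly s : size (nodepoly s) = (size s).+1.
Proof. exact: size_prod_XsubC. Qed.

Lemma wsum_size_lead s : (size (wsum s) <= size s)%N /\
  (wsum s)`_(size s).-1 = \sum_(a <- s) a.2.
Proof.
elim: s => [|a s [IHs IHl]]; first by rewrite /= size_poly0 big_nil coef0.
rewrite big_cons /=; split.
  rewrite (leq_trans (size_polyD _ _)) // geq_max.
  rewrite (leq_trans (size_scale_leq _ _)) ?size_nodepoly //=.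
  by rewrite (leq_trans (size_polyMleq _ _)) // size_XsubC.
rewrite coefD coefZ mulrBl coefB coefXM coefCM.
have -> : (nodepoly s)`_(size s) = 1.
  by have /monicP := nodepoly_monic s; rewrite lead_coefE size_nodepoly.
rewrite (nth_default 0 IHs) mulr0 subr0 mulr1; case: s {IHs} IHl => [|b s] /= IHl; first by rewrite big_nil.
by rewrite IHl.
Qed.

Lemma wsum_node s1 a s2 :
  (wsum (s1 ++ a :: s2)).[a.1] = a.2 * (nodepoly s1).[a.1] * (nodepoly s2).[a.1].
Proof.
elim: s1 => [|b s1 IH] /=.
  by rewrite !hornerE subrr mul0r addr0 /nodepoly big_nil hornerE mulr1.
rewrite !hornerE IH nodepoly_cat !nodepoly_cons !hornerM !hornerE subrr /=.
by ring.
Qed.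

Lemma nodepoly_gt0 (x : R) s : (forall b, b \in s -> b.1 < x) -> 0 < (nodepoly s).[x].
Proof.
move=> h; rewrite /nodepoly horner_prod big_seq; apply: prodr_gt0 => b bs.
by rewrite !hornerE subr_gt0 h.
Qed.

Lemma nodepoly_sign (x : R) s : (forall b, b \in s -> x < b.1) ->
  0 < (-1) ^+ size s * (nodepoly s).[x].
Proof.
elim: s => [|a s IH] h; first by rewrite /nodepoly big_nil !hornerE ltr01.
have h1 : 0 < (-1) ^+ size s * (nodepoly s).[x].
  by apply: IH => b bs; apply: h; rewrite inE bs orbT.
have h2 : 0 < a.1 - x by rewrite subr_gt0 h // mem_head.
rewrite nodepoly_cons hornerM !hornerE /= exprS.
rewrite (_ : _ * _ = (a.1 - x) * ((-1) ^+ size s * (nodepoly s).[x])); last by ring.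
exact: mulr_gt0.
Qed.

Definition le1 (a b : R * R) := a.1 <= b.1.

(** The weak inequalities allow coinciding points; the strict ones make the roots distinct when the
    points are. *)
Definition interlaced s y := forall k, (k < size y)%N ->
  let a := (nth (0, 0) s k).1 in let b := (nth (0, 0) s k.+1).1 in
  (a <= nth 0 y k <= b) /\ (a < b -> a < nth 0 y k < b).

(** Two coinciding points are merged by [wsum_tie], and their common value is a root. If all points
    differ, the signs of [wsum s] at them alternate, so each gap contains a root, and the degree
    leaves room for no others. *)
Lemma interlaced_roots s : sorted le1 s -> all (fun a => 0 < a.2) s -> s != [::] ->
  exists y, [/\ size y = (size s).-1,
    wsum s = (\sum_(a <- s) a.2) *: \prod_(r <- y) ('X - r%:P) & interlaced s y].
Proof.
have [n] := ubnP (size s); elim: n s => // n IH s sn ss ws s0.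
have [/fintype.existsP[[k kn] /= /eqP kE]|/fintype.existsPn strict] :=
    boolP [exists k : 'I_(size s).-1, (nth (0, 0) s k).1 == (nth (0, 0) s k.+1).1].
  have kS : (k.+1 < size s)%N by rewrite -ltn_predRL.
  set x := (nth (0,0) s k).1 in kE; pose u := (nth (0,0) s k).2; pose v := (nth (0,0) s k.+1).2.
  pose s1 := take k s; pose s2 := drop k.+2 s.
  have sE : s = s1 ++ (x, u) :: (x, v) :: s2.
    rewrite -[LHS](cat_take_drop k s) (drop_nth (0, 0) (ltnW kS)) (drop_nth (0, 0) kS).
    by rewrite {2}kE -!surjective_pairing.
  have ks1 : size s1 = k by rewrite size_takel //; lia.
  pose s' := s1 ++ (x, u + v) :: s2.
  have Ss' : (size s').+1 = size s by rewrite sE /s' !size_cat /=; lia.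
  have [||||y' [Sy' Ey' Iy']] := IH s'.
  - lia.
  - have L t : sorted le1 t = sorted <=%R (map fst t) by rewrite sorted_map.
    rewrite L; apply: (subseq_sorted le_trans _ (s2 := map fst s)); last by rewrite -L.
    rewrite sE /s' !map_cat /= cat_subseq ?subseq_refl //=.
    by rewrite eqxx; exact: subseq_cons.
  - move: ws; rewrite sE /s' !all_cat /= => /andP[-> /and3P[u0 v0 ->]].
    by rewrite addr_gt0.
  - by rewrite /s'; case: (s1).
  have ky' : (k <= size y')%N by rewrite Sy'; lia.
  exists (take k y' ++ x :: drop k y'); split.
  - by rewrite size_cat /= size_takel // size_drop Sy'; lia.
  - rewrite {1}sE wsum_tie -/s' Ey' -{1}(cat_take_drop k y') !big_cat !big_cons /=.
    rewrite -scalerAr mulrCA; congr (_ *: _).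
    by rewrite sE big_cat !big_cons /= -addrA.
  have X1 j : (j <= k)%N -> (nth (0, 0) s' j).1 = (nth (0, 0) s j).1.
    rewrite sE /s' !nth_cat ks1 => jk; case: ltnP => // kj.
    by have -> : (j - k = 0)%N by lia.
  have X2 j : (k <= j)%N -> (nth (0, 0) s' j).1 = (nth (0, 0) s j.+1).1.
    rewrite sE /s' !nth_cat ks1 => jk; rewrite ltnNge jk /= ltnNge (leqW jk) /=.
    by rewrite subSn //; case: (j - k)%N.
  move=> j; rewrite size_cat /= size_takel // size_drop => jS.
  rewrite nth_cat size_takel //; case: ltngtP => jk.
  - rewrite nth_take // -(X1 j (ltnW jk)) -(X1 j.+1 jk); apply: Iy'; lia.
  - case: j jS jk => // i iS; rewrite ltnS => ki.
    rewrite subSn //= nth_drop subnKC // -(X2 i ki) -(X2 i.+1 (leqW ki)).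
    by apply: Iy'; lia.
  - rewrite jk subnn /= -kE -/x lexx; split => //.
    by rewrite ltxx.
pose S := (size s).-1.
have Ss : size s = S.+1 by rewrite prednK // lt0n size_eq0.
have X k : (k < S)%N -> (nth (0, 0) s k).1 < (nth (0, 0) s k.+1).1.
  move=> kS; rewrite lt_neqAle (strict (Ordinal kS)) /=.
  by move/(sortedP (0, 0)): ss => /(_ k); apply; rewrite Ss ltnS.
have Xm i j : (i < j)%N -> (j <= S)%N -> (nth (0, 0) s i).1 < (nth (0, 0) s j).1.
  elim: j => // j IHj; rewrite ltnS leq_eqVlt => /orP[/eqP ->|ij] jS; first exact: X.
  by apply: lt_trans (X j jS); apply: IHj => //; apply: ltnW.
(* At the [k]-th point only the [S - k] factors of the larger points are negative. *)
have sgn k : (k <= S)%N -> 0 < (-1) ^+ (S - k) * (wsum s).[(nth (0,0) s k).1].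
  move=> kS; set xk := nth _ _ _.
  have sE : s = take k s ++ xk :: drop k.+1 s.
    by rewrite -[LHS](cat_take_drop k s) (drop_nth (0, 0)) // Ss ltnS.
  have w0 : 0 < xk.2 by move/allP: ws => /(_ xk); apply; rewrite mem_nth // Ss ltnS.
  have h1 : 0 < (nodepoly (take k s)).[xk.1].
    apply: nodepoly_gt0 => b /(nthP (0, 0))[i]; rewrite size_takel ?Ss ?leqW // => ik <-.
    by rewrite nth_take //; apply: Xm.
  have h2 : 0 < (-1) ^+ (S - k) * (nodepoly (drop k.+1 s)).[xk.1].
    have -> : (S - k = size (drop k.+1 s))%N by rewrite size_drop Ss subSS.
    apply: nodepoly_sign => b /(nthP (0, 0))[i]; rewrite size_drop Ss subSS => ik <-.
    by rewrite nth_drop; apply: Xm; lia.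
  rewrite [in wsum _]sE wsum_node.
  rewrite mulrCA; apply: mulr_gt0 => //.
  exact: mulr_gt0.
(* The bound on [k] stands under the existential so that [choice] yields a function on all of
   [nat]. *)
have root_ex k : exists r, (k < S)%N -> 
    (nth (0,0) s k).1 < r < (nth (0,0) s k.+1).1 /\ root (wsum s) r.
  have [kS|kS] := ltnP k S; last by exists 0.
  set a := (nth (0,0) s k).1; set b := (nth (0,0) s k.+1).1.
  have ab : a < b by exact: X.
  pose q := - (-1) ^+ (S - k) *: wsum s.
  have qa : q.[a] < 0 by rewrite hornerZ mulNr oppr_lt0; apply: sgn; apply: ltnW.
  have qb : 0 < q.[b].
    have := sgn k.+1 kS; rewrite -/b hornerZ.
    by rewrite (_ : S - k = (S - k.+1).+1)%N; [rewrite exprS mulN1r opprK|lia].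
  have [r] : exists2 r, a <= r <= b & root q r.
    by apply: poly_ivt; rewrite ?ltW //; apply/andP; split; apply: ltW.
  move=> /andP[ar rb] rq; exists r => _; split.
    rewrite !lt_neqAle ar rb !andbT; apply/andP; split; apply/eqP => E.
      by move: rq; rewrite -E rootE lt_eqF.
    by move: rq; rewrite E rootE gt_eqF.
  by move: rq; rewrite rootZ // oppr_eq0 signr_eq0.
have [f fP] := choice root_ex.
exists (mkseq f S); rewrite size_mkseq; split=> //.
  have [szle lc] := wsum_size_lead s.
  have lc0 : 0 < \sum_(a <- s) a.2.
    rewrite big_seq; case: (s) ws s0 => // c s' /= /andP[c0 /allP s'0] _.
    rewrite -big_seq big_cons ltr_wpDr // big_seq sumr_ge0 // => i /s'0.
    exact: ltW.
  have sz : size (wsum s) = size s.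
    apply/eqP; rewrite eqn_leq szle /=.
    rewrite Ss -/S in lc *; rewrite ltnNge; apply/negP => sle.
    by move: lc0; rewrite -lc nth_default // ltxx.
  have -> : \sum_(a <- s) a.2 = lead_coef (wsum s) by rewrite lead_coefE sz lc.
  apply: all_roots_prod_XsubC.
  - by rewrite size_mkseq sz Ss.
  - apply/allP => r /mapP[k]; rewrite mem_iota add0n /= => kS ->.
    by have [] := fP k kS.
  - rewrite uniq_rootsE; apply: (sorted_uniq lt_trans ltxx).
    apply/(sortedP 0) => k; rewrite size_mkseq => kS.
    rewrite (nth_mkseq _ _ kS) (nth_mkseq _ _ (ltnW kS)).
    have [/andP[_ h1] _] := fP k (ltnW kS).
    have [/andP[h2 _] _] := fP k.+1 kS.
    exact: lt_trans h1 h2.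
move=> k; rewrite size_mkseq => kS a b; rewrite nth_mkseq //.
have [/andP[h1 h2] _] := fP k kS.
by split => [|_]; rewrite ?h1 ?h2 // !ltW.
Qed.

End InterlacedRoots.

Section Roots.
Context (R : realType) (N : nat).
Implicit Types (x y : N.-tuple R) (w : 'I_N -> R).

Definition open_simplex w : Prop := (forall i, 0 < w i) /\ \sum_i w i < 1.

Lemma nodepoly_map (z w : 'I_N -> R) (r : seq 'I_N) :
  nodepoly [seq (z i, w i) | i <- r] = \prod_(i <- r) ('X - (z i)%:P).
Proof. by rewrite /nodepoly big_map. Qed.

Lemma wsum_map (z w : 'I_N -> R) (r : seq 'I_N) : uniq r ->
  wsum [seq (z i, w i) | i <- r] =
  \sum_(i <- r) w i *: \prod_(j <- r | j != i) ('X - (z j)%:P).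
Proof.
elim: r => [|a r IH] /=; first by rewrite big_nil.
move=> /andP[ar ur]; rewrite IH // nodepoly_map !big_cons eqxx /=.
have E i : i \in r -> (i != a).
  by move=> ir; apply: contraNneq ar => <-.
congr (_ *: _ + _).
  by rewrite big_seq [RHS]big_seq_cond; apply: eq_bigl => i; case ir: (i \in r) => //=; rewrite E.
rewrite mulr_sumr !big_seq; apply: eq_bigr => i ir.
by rewrite big_cons eq_sym E // -scalerAr.
Qed.

Definition nodes (z w : 'I_N -> R) : seq (R * R) :=
  (0, 1 - \sum_i w i) :: [seq (z i, w i) | i <- enum 'I_N].

Lemma genfun_wsum (z w : 'I_N -> R) : genfun z w = wsum (nodes z w).
Proof.
rewrite /= wsum_map ?enum_uniq // nodepoly_map subr0 big_enum /genfun mulr_sumr big_enum /=.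
congr (_ *: _ + _); apply: eq_bigr => i _; rewrite -scalerAr; congr (_ *: (_ * _)).
by rewrite big_enum_cond.
Qed.

Lemma genfun0 (y : 'I_N -> R) : genfun y (fun=> 0) = \prod_j ('X - (y j)%:P).
Proof.
rewrite /genfun [X in 1 - X]big1 // subr0 scale1r [X in _ + X]big1 ?addr0 // => i _.
by rewrite scale0r.
Qed.

Lemma nth_nodes x w k : (nth (0, 0) (nodes (tnth x) w) k).1 = nth 0 (0 :: x) k.
Proof.
have fstE (s : seq (R * R)) j : (nth (0, 0) s j).1 = nth 0 (map fst s) j.
  by elim: s j => [|a s IH] [|j] //=; rewrite nth_nil.
by rewrite fstE /nodes /= -map_comp (eq_map (_ : _ =1 tnth x)) // map_tnth_enum.
Qed.

(** [nth 0 (0 :: x) k] is the point preceding [tnth x k], and the extra point [0] if [k = 0]. *)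
Definition separated x y := forall k : 'I_N,
  let a := nth 0 (0 :: x) k in let b := tnth x k in
  (a <= tnth y k <= b) /\ (a < b -> a < tnth y k < b).

Lemma weyl_nth x : @weyl R N x -> forall i j, (i <= j)%N -> (j <= N)%N ->
  nth 0 (0 :: x) i <= nth 0 (0 :: x) j.
Proof.
move=> [/allP x0 xs] i j ij jN.
have s : sorted <=%R (0 :: (x : seq R)).
  rewrite /= path_min_sorted //; exact/allP.
by apply: (sorted_leq_nth le_trans lexx 0 s) => //; rewrite inE /= size_tuple; lia.
Qed.

Lemma separated_roots x w : @weyl R N x -> open_simplex w ->
  exists y, [/\ sorted <=%R y, genfun (tnth x) w = \prod_(i < N) ('X - (tnth y i)%:P)
    & separated x y].
Proof.
move=> xW [w0 w1].
have szn : size (nodes (tnth x) w) = N.+1 by rewrite /= size_map size_enum_ord.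
have [||//|y [Sy Ey Iy]] := @interlaced_roots R (nodes (tnth x) w).
- apply/(sortedP (0, 0)) => k; rewrite szn => kN.
  by rewrite /le1 !nth_nodes; apply: weyl_nth => //; lia.
- rewrite /= subr_gt0 w1 /=; apply/allP => _ /mapP[i _ ->]; exact: w0.
rewrite szn /= in Sy.
have Sy' : size y == N by apply/eqP.
have sumE : \sum_(a <- nodes (tnth x) w) a.2 = 1.
  by rewrite /nodes big_cons big_map big_enum /= subrK.
have IyE (k : nat) : (k < N)%N -> let a := nth 0 (0 :: x) k in let b := nth 0 (0 :: x) k.+1 in
  (a <= nth 0 y k <= b) /\ (a < b -> a < nth 0 y k < b).
  by move=> kN; have := Iy k; rewrite Sy !nth_nodes => /(_ kN).
exists (Tuple Sy'); split.
- apply/(sortedP 0) => k; rewrite Sy => kN.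
  have [/andP[_ h1] _] := IyE k (ltnW kN).
  have [/andP[h2 _] _] := IyE k.+1 kN.
  exact: le_trans h1 h2.
- rewrite genfun_wsum Ey sumE scale1r -[y in LHS]/(tval (Tuple Sy')).
  by rewrite big_tuple.
- by move=> k a b; have := IyE k (ltn_ord k); rewrite /a /b !(tnth_nth 0).
Qed.

Lemma weighted_poly_genfun x (v : N.-tuple R) :
  weighted_poly x (simplex_chart v) = genfun (tnth x) (tnth v).
Proof.
rewrite /weighted_poly /genfun big_ord_recl.
have E i : tnth (simplex_chart v) (lift ord0 i) = tnth v i by rewrite !(tnth_nth 0).
have E' i : tnth [tuple of 0 :: x] (lift ord0 i) = tnth x i by rewrite !(tnth_nth 0).
congr (_ *: _ + _).
  rewrite big_mkcond big_ord_recl /= mul1r; apply: eq_bigr => i _.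
  by rewrite E'.
apply: eq_bigr => i _; rewrite E; congr (_ *: _).
rewrite big_mkcond big_ord_recl /= subr0; congr (_ * _).
rewrite [RHS]big_mkcond; apply: eq_bigr => j _.
by rewrite (inj_eq (@lift_inj _ ord0)) E'.
Qed.

Lemma ordered_rootsE (p : {poly R}) y : sorted <=%R y ->
  p = \prod_(i < N) ('X - (tnth y i)%:P) -> ordered_roots N p = y.
Proof.
move=> ys pE.
have mp : p \is monic by rewrite pE; apply: monic_prod_XsubC.
apply: xget_unique; first by split => //; rewrite (monicP mp) scale1r.
move=> z [zs zE]; apply: val_inj; apply: (sorted_eq le_trans le_anti) => //.
apply: prod_XsubC_eq; rewrite !big_tuple -pE [RHS]zE (monicP mp) scale1r //.
Qed.

Lemma separated_weyl x y : @weyl R N x -> sorted <=%R y -> separated x y -> @weyl R N y.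
Proof.
move=> xW ys sy; split => //; apply/allP => _ /tnthP[k ->].
have [/andP[h _] _] := sy k; apply: le_trans h.
have := weyl_nth xW (leq0n k); apply; exact: ltnW.
Qed.

Lemma separated_inj x y : (forall k, (k < N)%N -> nth 0 (0 :: x) k < nth 0 (0 :: x) k.+1) ->
  sorted <=%R y -> separated x y -> injective (tnth y).
Proof.
move=> xlt ys sy.
have I (k : 'I_N) : nth 0 (0 :: x) k < tnth y k < nth 0 (0 :: x) k.+1.
  have [_] := sy k; rewrite /= (tnth_nth 0 x k); apply.
  by have := xlt k (ltn_ord k).
have lt (i j : 'I_N) : (i < j)%N -> tnth y i < tnth y j.
  move=> ij; have /andP[_ h1] := I i; have /andP[h2 _] := I j.
  apply: lt_le_trans h1 _; apply: le_trans (ltW h2).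
  have xs : sorted <=%R (0 :: (x : seq R)).
    by apply/(sortedP 0) => k; rewrite /= size_tuple ltnS => kN; apply: ltW; exact: xlt.
  by apply: (sorted_leq_nth le_trans lexx 0 xs) => //; rewrite inE /= size_tuple ltnS // ltnW.
move=> i j e; apply/eqP; rewrite -val_eqE /=; case: ltngtP => // /lt; by rewrite e ltxx.
Qed.

End Roots.

(** * Measurability of the ordered roots *)

Section MeasurableRoots.
Context (R : realType) (N : nat).
Implicit Types (x : N.-tuple R) (v : N.-tuple (measurableTypeR R)).

Lemma measurable_lt_fun d (T : measurableType d) (f : T -> R) (t : R) :
  measurable_fun setT f -> measurable [set a | f a < t].
Proof.
move=> mf; rewrite (_ : [set a | _] = setT `&` f @^-1` `]-oo, t[%classic).
  by apply: mf => //; exact: measurable_itv.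
by rewrite setTI; apply/seteqP; split => a /=; rewrite in_itv.
Qed.

Lemma measurable_gt_fun d (T : measurableType d) (f : T -> R) (t : R) :
  measurable_fun setT f -> measurable [set a | t < f a].
Proof.
move=> mf; rewrite (_ : [set a | _] = setT `&` f @^-1` `]t, +oo[%classic).
  by apply: mf => //; exact: measurable_itv.
by rewrite setTI; apply/seteqP; split => a /=; rewrite in_itv /= andbT.
Qed.

Lemma measurable_forall_fin d (T : measurableType d) (I : finType) (A : I -> set T) :
  (forall i, measurable (A i)) -> measurable [set a | forall i, A i a].
Proof.
move=> mA; rewrite (_ : [set a | _] = \bigcap_(i in setT) A i).
  by apply: fin_bigcap_measurable => //; exact: finite_finset.
by apply/seteqP; split => a /= h i => //; exact: h.
Qed.

Lemma measurable_open_simplex :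
  measurable [set v : N.-tuple (measurableTypeR R) | open_simplex (tnth v)].
Proof.
apply: measurableI; last first.
  by apply: measurable_lt_fun; apply: measurable_sum => i; exact: measurable_tnth.
apply: measurable_forall_fin => i.
by apply: measurable_gt_fun; exact: measurable_tnth.
Qed.

Lemma measurable_weyl : measurable (@weyl R N : set (N.-tuple (measurableTypeR R))).
Proof.
rewrite (_ : @weyl R N = [set v | forall i, ~ tnth v i < 0] `&`
  [set v | forall i : 'I_N, forall j : 'I_N, ~ (i < j)%N \/ ~ tnth v j - tnth v i < 0]); last first.
  apply/seteqP; split => v /=.
    move=> [/allP v0 vs]; split => [i|i j].
      by apply/negP; rewrite -leNgt; apply: v0; exact: mem_tnth.
    have [ij|] := boolP (i < j)%N; [right|by left].
    apply/negP; rewrite -leNgt subr_ge0 !(tnth_nth 0).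
    by apply: (sorted_leq_nth le_trans lexx 0 vs) => //; rewrite ?inE ?size_tuple // ltnW.
  move=> [v0 vs]; split.
    by apply/allP => _ /tnthP[i ->]; rewrite leNgt; apply/negP; exact: v0.
  apply/(sortedP 0) => i; rewrite size_tuple => iN.
  have [|/negP] := vs (Ordinal (ltnW iN)) (Ordinal iN); first by move=> /=; rewrite ltnSn.
  by rewrite -leNgt subr_ge0 !(tnth_nth 0).
apply: measurableI; apply: measurable_forall_fin => i.
  by apply: measurableC; apply: measurable_lt_fun; exact: measurable_tnth.
apply: measurable_forall_fin => j; case: (ltnP i j) => ij.
  rewrite (_ : (fun _ => _) = ~` [set v | tnth v j - tnth v i < 0]).
    apply: measurableC; apply: measurable_lt_fun.
    by apply: measurable_funB; exact: measurable_tnth.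
  by apply/seteqP; split => v /=; [case|right].
rewrite (_ : (fun _ => _) = setT) //.
by apply/seteqP; split => v //= _; left.
Qed.

(* Off the simplex the value is irrelevant, and chosen for measurability. *)
Definition root_map x v : N.-tuple (measurableTypeR R) :=
  if `[< open_simplex (tnth v) >] then
    ordered_roots N (weighted_poly x (simplex_chart v))
  else [tuple of nseq N 0].

Lemma root_mapP x v : @weyl R N x -> open_simplex (tnth v) ->
  [/\ sorted <=%R (root_map x v),
      genfun (tnth x) (tnth v) = genfun (tnth (root_map x v)) (fun=> 0)
    & separated x (root_map x v)].
Proof.
move=> xW vO; have [y [ys yE sy]] := separated_roots xW vO.
have -> : root_map x v = y.
  by rewrite /root_map asboolT // weighted_poly_genfun; apply: ordered_rootsE.
by split=> //; rewrite genfun0.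
Qed.

Lemma root_map_weyl x v : @weyl R N x -> @weyl R N (root_map x v).
Proof.
move=> xW; case: (pselect (open_simplex (tnth v))) => vO.
  by have [ys _ sy] := root_mapP xW vO; exact: separated_weyl sy.
rewrite /root_map asboolF //; split; first by rewrite all_nseq lexx orbT.
by apply/(sortedP 0) => i _; rewrite /= !nth_nseq; do 2 case: ifP.
Qed.

Lemma measurable_genfun x (t : R) :
  measurable_fun setT (fun v => (genfun (tnth x) (tnth v)).[t]).
Proof.
rewrite (_ : (fun v => _) = (fun v => (1 - \sum_i tnth v i) * (\prod_j ('X - (tnth x j)%:P)).[t]
   + \sum_i tnth v i * ('X * \prod_(j | j != i) ('X - (tnth x j)%:P)).[t])).
  apply: measurable_funD.
    apply: measurable_funM => //; apply: measurable_funB => //.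
    by apply: measurable_sum => i; exact: measurable_tnth.
  apply: measurable_sum => i; apply: measurable_funM => //; exact: measurable_tnth.
apply/funext => v; rewrite /genfun hornerD hornerZ horner_sum; congr (_ + _).
by apply: eq_bigr => i _; rewrite hornerZ.
Qed.

Definition side (k : 'I_N) : R := \prod_(j < N | j != k) (if (k < j)%N then -1 else 1).

(** The factors of the other roots have a product of known sign [side k], so the value of the
    polynomial at [t], which depends measurably on the weights, decides on which side of [t] the
    [k]-th root lies. *)
Lemma root_lt_sign (y : N.-tuple R) (k : 'I_N) (t : R) :
  (forall j : 'I_N, (j < k)%N -> tnth y j < t) ->
  (forall j : 'I_N, (k < j)%N -> t < tnth y j) ->
  (tnth y k < t) = (0 < side k * (\prod_(i < N) ('X - (tnth y i)%:P)).[t]).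
Proof.
move=> lo hi.
have -> : (\prod_(i < N) ('X - (tnth y i)%:P)).[t] =
    (t - tnth y k) * \prod_(j < N | j != k) (t - tnth y j).
  rewrite horner_prod (bigD1 k) //= !hornerE; congr (_ * _).
  by apply: eq_bigr => j _; rewrite !hornerE.
rewrite mulrCA.
rewrite pmulr_lgt0 ?subr_gt0 //.
rewrite /side -big_split; apply: prodr_gt0 => j jk /=.
case: ltngtP => kj.
- by rewrite mulN1r oppr_gt0 subr_lt0 hi.
- by rewrite mul1r subr_gt0 lo.
- by move: jk; rewrite -val_eqE /= kj eqxx.
Qed.

Lemma measurable_root_map x : @weyl R N x -> measurable_fun setT (root_map x).
Proof.
move=> xW; apply/measurable_fun_tnthP => k.
apply: (measurability (@RGenInftyO.G R)) => [|/= _ [_ [t ->]] <-].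
  exact: RGenInftyO.measurableE.
rewrite setTI.
pose O := [set v : N.-tuple (measurableTypeR R) | open_simplex (tnth v)].
have mO : measurable O by exact: measurable_open_simplex.
rewrite (_ : _ @^-1` _ = (~` O `&` [set v | 0 < t]) `|`
   (O `&` [set v | tnth (root_map x v) k < t])); last first.
  apply/seteqP; split => v /=; rewrite in_itv /=; case: (pselect (O v)) => vO.
  - by right.
  - rewrite /root_map asboolF // tnth_nseq => t0; by left.
  - by case=> -[].
  - rewrite /root_map asboolF // tnth_nseq; by case=> -[].
apply: measurableU.
  apply: measurableI; first exact: measurableC.
  have [t0|t0] := boolP (0 < t).
    by rewrite (_ : [set v | _] = setT) //; apply/seteqP; split.
  by rewrite (_ : [set v | _] = set0) //; apply/seteqP; split.
(* For [t] below the gap of the [k]-th root the set is empty, and above the gap it is the whole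
   simplex; only inside the gap does the sign decide. *)
have [ta|at_] := leP t (nth 0 (0 :: x) k).
  rewrite (_ : _ `&` _ = set0) //; apply/seteqP; split => // v /= [vO].
  have [_ _ /(_ k)[/andP[h _] _]] := root_mapP xW vO.
  by apply/negP; rewrite -leNgt; apply: le_trans h.
have [bt|tb] := leP (tnth x k) t.
  rewrite (_ : _ `&` _ = O) //; apply/seteqP; split => v /=; first by case.
  move=> vO; split => //.
  have [_ _ /(_ k)[/andP[_ h1] h2]] := root_mapP xW vO.
  have [ab|ba] := ltP (nth 0 (0 :: x) k) (tnth x k).
    by have /andP[_ h] := h2 ab; apply: lt_le_trans bt.
  by apply: (le_lt_trans h1); apply: le_lt_trans at_.
rewrite (_ : _ `&` _ = O `&` [set v | 0 < side k * (genfun (tnth x) (tnth v)).[t]]).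
  apply: measurableI => //; apply: measurable_gt_fun.
  by apply: measurable_funM => //; exact: measurable_genfun.
apply/seteqP; split => v /= [vO]; have [_ gE sy] := root_mapP xW vO.
all: rewrite gE genfun0 -root_lt_sign //.
all: move=> j jk; have [/andP[h1 h2] _] := sy j.
1,3: apply: (le_lt_trans h2); apply: (le_lt_trans _ at_); rewrite (tnth_nth 0) -[nth 0 x j]/(nth 0 (0 :: x) j.+1); apply: weyl_nth => //; exact: ltnW.
all: apply: (lt_le_trans tb); apply: (le_trans _ h1); rewrite (tnth_nth 0) -[nth 0 x k]/(nth 0 (0 :: x) k.+1); apply: weyl_nth => //; exact: ltnW.
Qed.

End MeasurableRoots.

(** * The kernel on Jack polynomials *)

Section Partitions.
Context (N : nat).
Implicit Types (mu nu la : seq nat).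

Definition pmnm mu : mpoly.multinom N := mpoly.Multinom [tuple nth 0%N mu i | i < N].

Lemma pmnmE mu (i : 'I_N) : pmnm mu i = nth 0%N mu i.
Proof. by rewrite mpoly.multinomE tnth_mktuple. Qed.

Lemma partition_nth mu i j : is_partition mu -> (i <= j)%N -> (nth 0 mu j <= nth 0 mu i)%N.
Proof.
move=> /andP[s _] ij; have [jm|mj] := ltnP j (size mu); last by rewrite (nth_default _ mj).
have tr : transitive geq by move=> y x z xy yz; exact: leq_trans yz xy.
by apply: (sorted_leq_nth tr leqnn 0%N s) => //; rewrite inE (leq_ltn_trans ij).
Qed.

Lemma pmnm_sorted mu : is_partition mu -> msorted (pmnm mu).
Proof. by move=> mp i j ij; rewrite !pmnmE; exact: partition_nth. Qed.

Lemma sumn_take_nth mu r : sumn (take r mu) = (\sum_(i < r) nth 0 mu i)%N.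
Proof.
elim: mu r => [|a mu IH] [|r] //=; rewrite ?big_ord0 //.
  by rewrite big1 // => i _; rewrite nth_nil.
by rewrite big_ord_recl /= IH.
Qed.

Lemma tsum_pmnm mu r : (r <= N)%N -> tsum (pmnm mu) r = sumn (take r mu).
Proof.
move=> rN; rewrite sumn_take_nth /tsum (big_ord_widen _ (fun i => nth 0%N mu i) rN).
by apply: eq_bigr => i _; exact: pmnmE.
Qed.

Lemma mdeg_pmnm mu : (size mu <= N)%N -> mpoly.mdeg (pmnm mu) = sumn mu.
Proof.
move=> sN; rewrite -{2}(take_oversize sN) sumn_take_nth mpoly.mdegE.
by apply: eq_bigr => i _; exact: pmnmE.
Qed.

Lemma dominated_domle mu nu : is_partition nu -> (size nu <= N)%N -> (size mu <= N)%N ->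
  dominated nu mu -> domle (pmnm nu) (pmnm mu).
Proof.
move=> nup sn sm [d h]; apply: domle_of_tsum; first exact: pmnm_sorted.
  by rewrite !mdeg_pmnm.
by move=> r rN; rewrite !tsum_pmnm.
Qed.

Context (R : realType).

Lemma msym_support mu m : is_partition mu ->
  m \in mpoly.msupp (msym_monomial R N mu) -> domle m (pmnm mu).
Proof.
move=> mp /mpoly.msupp_sum_le /flattenP[u /mapP[t]].
rewrite mem_filter mem_permutations => tp ->; rewrite mpoly.msuppX mem_seq1 => /eqP ->.
have tE : mkseq (nth 0%N mu) N = [tuple nth 0%N mu i | i < N].
  by rewrite /mkseq -val_enum_ord -map_comp.
move: tp; rewrite tE => /perm.tuple_permP[p tE'].
apply: (@domle_perm _ _ _ p); first exact: pmnm_sorted.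
move=> i; rewrite [LHS]pmnmE tE' -tnth_nth tnth_mktuple pmnmE.
by rewrite tnth_mktuple.
Qed.

Lemma fsbig_msupp (A : set (seq nat)) (F : seq nat -> mpoly.mpoly N R) m :
  m \in mpoly.msupp (\sum_(nu \in A) F nu) -> exists2 nu, A nu & m \in mpoly.msupp (F nu).
Proof.
(* A sum of infinite support is [0] by convention and has no monomials. *)
case: finite_supportP => [_|X XA _ _]; first by rewrite big_nil mpoly.msupp0.
move=> /mpoly.msupp_sum_le /flattenP[u /mapP[nu]]; rewrite mem_filter /= => nuX ->.
by exists nu => //; exact: XA.
Qed.

Lemma jack_support theta mu (P : mpoly.mpoly N R) : is_partition mu -> (size mu <= N)%N ->
  is_jack theta mu P -> forall m, m \in mpoly.msupp P -> domle m (pmnm mu).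
Proof.
move=> mp sN [_ [c ->] _] m /mpoly.msuppD_le; rewrite mem_cat => /orP[|].
  exact: msym_support.
move=> /fsbig_msupp[nu [nup snu dom _]] /mpoly.msuppZ_le /(msym_support nup) h.
exact: domle_trans h (dominated_domle nup snu sN dom).
Qed.

Lemma B_statE mu : (size mu <= N)%N -> B_stat mu = (\sum_(i < N) i * nth 0 mu i)%N.
Proof.
move=> sN; rewrite /B_stat big_add1 big_mkord /=.
rewrite (big_ord_widen _ (fun i => i * nth 0%N mu i)%N sN) big_mkcond.
by apply: eq_bigr => i _; case: ltnP => // h; rewrite nth_default ?muln0.
Qed.

Lemma sumn_nth mu : (size mu <= N)%N -> sumn mu = (\sum_(i < N) nth 0 mu i)%N.
Proof. by move=> sN; rewrite -sumn_take_nth take_oversize. Qed.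

(** Double counting: the conjugate part numbered [i] from [0] counts the [j] with [i < mu_j], so
    [mu_j] contributes [0 + 1 + ... + (mu_j - 1)]. *)
Lemma B_stat_conj mu : is_partition mu -> (size mu <= N)%N ->
  (2 * B_stat (conj_part mu) = \sum_(i < N) nth 0 mu i * (nth 0 mu i).-1)%N.
Proof.
move=> mp sN; rewrite /B_stat size_map size_iota big_add1 big_mkord /=.
set h := head 0%N mu.
have E (i : 'I_h) : nth 0%N (conj_part mu) i = (\sum_(j < N) (i < nth 0 mu j))%N.
  rewrite (nth_map 0%N) ?size_iota // nth_iota // add1n.
  rewrite -sum1_count (big_nth 0%N) big_mkord big_mkcond.
  rewrite (big_ord_widen _ (fun j => if (i < nth 0 mu j)%N then 1 else 0)%N sN) big_mkcond.
  apply: eq_bigr => j _; case: (ltnP j (size mu)) => hj; first by case: ltnP.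
  by rewrite nth_default.
under eq_bigr => i _ do rewrite /part /= E big_distrr.
rewrite exchange_big big_distrr /=; apply: eq_bigr => j _.
have jh : (nth 0 mu j <= h)%N by rewrite /h -nth0; apply: partition_nth.
have -> : (\sum_(i < h) i * (i < nth 0 mu j) = \sum_(i < nth 0 mu j) i)%N.
  rewrite [RHS](big_ord_widen _ (fun i => i) jh) [RHS]big_mkcond; apply: eq_bigr => i _.
  by case: ltnP => _; rewrite ?muln1 ?muln0.
rewrite -(big_mkord predT (fun i => i)) bin2_sum bin2 mul2n.
rewrite -[RHS]odd_double_half (_ : odd _ = false) //.
by case: (nth 0%N mu j) => // n; rewrite oddM /= andNb.
Qed.

Lemma jack_eigenvalueE (theta : R) mu : is_partition mu -> (size mu <= N)%N ->
  jack_eigenvalue theta N mu = eigE theta (pmnm mu).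
Proof.
move=> mp sN; rewrite /jack_eigenvalue /eigE.
have -> : 2 * (B_stat (conj_part mu))%:R = \sum_(i < N) (pmnm mu i)%:R * ((pmnm mu i)%:R - 1) :> R.
  rewrite -natrM B_stat_conj // natr_sum; apply: eq_bigr => i _; rewrite natrM pmnmE.
  by case: (nth 0%N mu i) => [|n]; rewrite ?mul0r //; congr (_ * _); rewrite -natr1 addrK.
rewrite -addrA; congr (_ + _).
rewrite B_statE // sumn_nth // !natr_sum !mulr_sumr -sumrN -big_split /=.
apply: eq_bigr => i _; rewrite pmnmE natrM natrB //.
by rewrite -[in (i.+1)%:R]addn1 natrD; ring.
Qed.

End Partitions.

(** * The kernel as a mean over the weights *)

Section Kernel.
Context (R : realType) (N : nat) (theta alpha : R).
Hypotheses (theta_gt0 : 0 < theta) (alpha_gt : -1 < alpha).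
Let s0 := (alpha + 1) * theta.
Implicit Types (x : N.-tuple R) (v : N.-tuple (measurableTypeR R)).

Let s0_gt0 : 0 < s0.
Proof. by apply: mulr_gt0 => //; rewrite -ltrBlDr sub0r. Qed.

Lemma gdens_out v : ~ open_simplex (tnth v) -> gdens theta s0 v = 0.
Proof.
move=> vO; rewrite /gdens /gdir.
have [/fintype.forallP v0|] := boolP [forall i, 0 < tnth v i]; last first.
  rewrite negb_forall => /fintype.existsP[i /negbTE vi].
  have -> : \prod_i gpow theta (tnth v i) = 0.
    by rewrite (bigD1 i) //= [gpow _ (tnth v i)]/gpow vi mul0r.
  by rewrite !mulr0.
have [v1|/negbTE v1] := boolP (\sum_i tnth v i < 1); first by case: vO.
by rewrite [gpow s0 _]/gpow subr_gt0 v1 mul0r mulr0.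
Qed.

Lemma simplex_chart_gt0 v :
  (forall i, 0 < tnth (simplex_chart v) i) <-> open_simplex (tnth v).
Proof.
have E i : tnth (simplex_chart v) (lift ord0 i) = tnth v i by rewrite !(tnth_nth 0).
have E0 : tnth (simplex_chart v) ord0 = 1 - \sum_i tnth v i by rewrite (tnth_nth 0).
split=> [h|[h1 h2] i]; first split.
- by move=> i; rewrite -E.
- by have := h ord0; rewrite E0 subr_gt0.
- case: (unliftP ord0 i) => [j ->|->]; first by rewrite E.
  by rewrite E0 subr_gt0.
Qed.

Lemma dirichlet_density_gdens v : open_simplex (tnth v) ->
  dirichlet_density [tuple of s0 :: nseq N theta] (simplex_chart v) = gdens theta s0 v.
Proof.
move=> [v0 v1].
have E i : tnth (simplex_chart v) (lift ord0 i) = tnth v i by rewrite !(tnth_nth 0).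
have E0 : tnth (simplex_chart v) ord0 = 1 - \sum_i tnth v i by rewrite (tnth_nth 0).
have T i : tnth [tuple of s0 :: nseq N theta] (lift ord0 i) = theta.
  by rewrite (tnth_nth 0) /= nth_nseq ltn_ord.
have T0 : tnth [tuple of s0 :: nseq N theta] ord0 = s0 by rewrite (tnth_nth 0).
rewrite /dirichlet_density /gdens /gdir !big_ord_recl T0 E0.
have -> : \sum_(i < N) tnth [tuple of s0 :: nseq N theta] (lift ord0 i) = N%:R * theta.
  by rewrite (eq_bigr (fun=> theta)) // sumr_const card_ord mulr_natl.
have -> : \prod_(i < N) Gamma (tnth [tuple of s0 :: nseq N theta] (lift ord0 i)) =
    \prod_(i < N) Gamma theta by apply: eq_bigr => i _; rewrite T.
congr (_ * (_ * _)); first by rewrite /gpow subr_gt0 v1.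
by apply: eq_bigr => i _; rewrite E T /gpow v0.
Qed.

(** Both integrals may be taken over all [v]: off the open simplex [gdens] vanishes, whatever
    [root_map] is there. *)
Lemma LambdaE x : @Lambda R theta alpha N x =
  pushforward (@mdensity _ _ R (leb R N) (gdens theta s0)) (root_map x).
Proof.
apply/funext => B; rewrite /Lambda /pushforward /dirichlet /mdensity lebE.
rewrite [LHS]integral_mkcond [RHS]integral_mkcond; apply: eq_integral => v _.
rewrite !patchE; case: (pselect (open_simplex (tnth v))) => vO.
  have rE : root_map x v = ordered_roots N (weighted_poly x (simplex_chart v)).
    by rewrite /root_map asboolT.
  have [vB|vB] := pselect (B (root_map x v)).
    rewrite !ifT ?inE //; first by rewrite dirichlet_density_gdens.
    by split; [exact/simplex_chart_gt0|rewrite /= -rE].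
  rewrite !ifF //; apply/negbTE; rewrite notin_setE //=.
  by move=> [_]; rewrite /= -rE.
rewrite ifF; last by apply/negbTE; rewrite notin_setE /= => -[/simplex_chart_gt0].
by case: ifP => // _; rewrite gdens_out.
Qed.

Lemma kernel_act_integral x (f : N.-tuple R -> R) : @weyl R N x ->
  measurable_fun setT (f : N.-tuple (measurableTypeR R) -> R) ->
  (kernel_act (@Lambda R theta alpha N) f x =
   \int[leb R N]_v (f (root_map x v) * gdens theta s0 v)%:E)%E.
Proof.
move=> xW mf; rewrite /kernel_act LambdaE.
have mr := measurable_root_map xW.
have mg : measurable_fun setT (@gdens R N theta s0) by exact: measurable_gdens.
have g0 := @gdens_ge0 R N _ _ theta_gt0 s0_gt0.
pose g (y : N.-tuple (measurableTypeR R)) : R := f y * \1_(@weyl R N) y.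
have gm : measurable_fun setT g.
  by apply: measurable_funM => //; apply: measurable_indic; exact: measurable_weyl.
transitivity (\int[pushforward (@mdensity _ _ R (leb R N) (gdens theta s0)) (root_map x)]_y (g y)%:E)%E.
  rewrite integral_mkcond.
  apply: eq_integral => y _; rewrite /g patchE indicE.
  by case: ifP => _; rewrite ?mulr1 ?mulr0.
rewrite (integral_pushforward_mdensity _ mg g0 mr gm).
apply: eq_integral => v _; congr (_ * _)%:E.
by rewrite /g indicE mem_set ?mulr1 //; exact: root_map_weyl.
Qed.

Lemma kernel_act_poly x (f : N.-tuple R -> R) (Q : mpoly.mpoly N R) : @weyl R N x ->
  measurable_fun setT (f : N.-tuple (measurableTypeR R) -> R) ->
  (forall v, open_simplex (tnth v) -> f (root_map x v) = mpoly.meval (tnth v) Q) ->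
  kernel_act (@Lambda R theta alpha N) f x = (dirf theta s0 Q)%:E.
Proof.
move=> xW mf fQ; rewrite kernel_act_integral //.
have [_ <-] := poly_moment theta_gt0 s0_gt0 Q.
apply: eq_integral => v _; case: (pselect (open_simplex (tnth v))) => vO.
  by rewrite fQ.
by rewrite gdens_out // !mulr0.
Qed.

Lemma dirf_supp (g : mpoly.mpoly N R) :
  (forall w, open_simplex w -> mpoly.meval w g = 0) -> dirf theta s0 g = 0.
Proof.
move=> g0; apply: EFin_inj; have [_ <-] := poly_moment theta_gt0 s0_gt0 g.
apply: integral0_eq => v _; case: (pselect (open_simplex (tnth v))) => vO.
  by rewrite g0 // mul0r.
by rewrite gdens_out // mulr0.
Qed.

Lemma roots_exist (z : 'I_N -> R) : pos_incr z -> forall w, open_simplex w ->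
  exists2 y : 'I_N -> R, injective y & genfun y (fun=> 0 : R) = genfun z w.
Proof.
move=> [z0 zi] w wO; pose x := [tuple z i | i < N].
have xE : tnth x = z by apply/funext => i; rewrite tnth_mktuple.
have zE k (kN : (k < N)%N) : nth 0 (0 :: x) k.+1 = z (Ordinal kN).
  by rewrite -xE (tnth_nth 0).
have xlt k : (k < N)%N -> nth 0 (0 :: x) k < nth 0 (0 :: x) k.+1.
  case: k => [|k] kN; first by rewrite (zE 0%N kN) z0.
  by rewrite (zE k (ltnW kN)) (zE k.+1 kN) zi.
have xW : @weyl R N x.
  split; first by apply/allP => _ /tnthP[i ->]; rewrite xE ltW.
  by apply/(sortedP 0) => k; rewrite size_tuple => kN; apply: ltW; exact: (xlt k.+1).
have [y [ys yE sy]] := separated_roots xW wO.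
exists (tnth y); first exact: separated_inj xlt ys sy.
by rewrite genfun0 -yE xE.
Qed.

Lemma jack_lift_tuple (mu : seq nat) : is_partition mu -> (size mu <= N)%N ->
  exists F : N.-tuple R -> mpoly.mpoly N R, forall x, @weyl R N x ->
    (forall v, open_simplex (tnth v) ->
       jack_at theta mu (root_map x v) = mpoly.meval (tnth v) (F x)) /\
    dirf theta s0 (F x) = cfact N theta s0 (fun i => nth 0%N mu i) * jack_at theta mu x.
Proof.
move=> mp sN; rewrite /jack_at /jack; case: xgetP => [P _ jP|_]; last first.
  (* If no polynomial satisfies [is_jack], then [jack] is [0] and lifts to [0]. *)
  exists (fun=> 0) => x xW; split => [v _|].
    by rewrite !mpoly.meval0.
  by rewrite /dirf mpoly.msupp0 big_nil mpoly.meval0 mulr0.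
have [Psym Pexp Peig] := jP.
have [|F [F1 F2]] := jack_lift theta_gt0 s0_gt0 dirf_supp roots_exist
  (pmnm_sorted (N := N) mp) Psym (jack_support mp sN jP).
  by move=> y yi; rewrite -jack_eigenvalueE //; exact: Peig.
exists (fun x => evz (tnth x) F) => x xW; split => [v vO|].
  by have [_ gE _] := root_mapP xW vO; rewrite (F1 _ _ _ gE).
rewrite F2; congr (_ * _); apply: eq_bigr => i _.
by rewrite -[nth 0%N (pmnm N mu) i]/(nth 0%N (tval (mpoly.multinom_val (pmnm N mu))) i) -tnth_nth tnth_mktuple.
Qed.

Lemma measurable_meval (P : mpoly.mpoly N R) :
  measurable_fun setT (fun y : N.-tuple (measurableTypeR R) => mpoly.meval (tnth y) P).
Proof.
rewrite (_ : (fun y => _) = (fun y : N.-tuple (measurableTypeR R) =>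
  \sum_(m <- mpoly.msupp P) mpoly.mcoeff m P * \prod_i tnth y i ^+ m i)).
  apply: measurable_sum => m; apply: measurable_funM => //.
  by apply: measurable_prod => i _; apply: measurable_funX; exact: measurable_tnth.
by apply/funext => y; rewrite mpoly.mevalE.
Qed.

(** The lifts are combined before integrating, into one polynomial in the weights, so linearity is
    only used for [dirf]. *)
Lemma kernel_act_comb x (I : Type) (r : seq I) (Pp : pred I) (K : I -> R) (mu : I -> seq nat) :
  @weyl R N x ->
  (forall i, Pp i -> is_partition (mu i) && (size (mu i) <= N)%N) ->
  kernel_act (@Lambda R theta alpha N)
    (fun y => \sum_(i <- r | Pp i) K i * jack_at theta (mu i) y) x =
  (\sum_(i <- r | Pp i) K i *
     (cfact N theta s0 (fun j => nth 0%N (mu i) j) * jack_at theta (mu i) x))%:E.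
Proof.
move=> xW mP.
have H i : exists F : mpoly.mpoly N R, Pp i ->
    (forall v, open_simplex (tnth v) ->
       jack_at theta (mu i) (root_map x v) = mpoly.meval (tnth v) F) /\
    dirf theta s0 F = cfact N theta s0 (fun j => nth 0%N (mu i) j) * jack_at theta (mu i) x.
  have [/mP/andP[p1 p2]|] := boolP (Pp i); last by exists 0.
  by have [F HF] := jack_lift_tuple p1 p2; exists (F x) => _; exact: HF.
have [F HF] := choice H.
rewrite (@kernel_act_poly x _ (\sum_(i <- r | Pp i) K i *: F i)) //.
- congr EFin; rewrite dirf_sum; apply: eq_bigr => i /HF[_ <-].
  by have := dirf_lin theta s0 (K i) (F i) 0; rewrite addr0 /dirf mpoly.msupp0 big_nil addr0.
- rewrite (_ : (fun y => _) = (fun y : N.-tuple (measurableTypeR R) =>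
    \sum_(i <- r) (if Pp i then K i * jack_at theta (mu i) y else 0))); last first.
    by apply/funext => y; rewrite big_mkcond.
  apply: measurable_sum => i; case: (Pp i) => //.
  by apply: measurable_funM => //; exact: measurable_meval.
- move=> v vO; rewrite raddf_sum /=; apply: eq_bigr => i /HF[h _].
  by rewrite mpoly.mevalZ h.
Qed.

Lemma part_sub_nth (mu la : seq nat) i : part_sub mu la -> (nth 0 mu i <= nth 0 la i)%N.
Proof. by move=> /(_ i.+1 isT). Qed.

Lemma part_sub_size (mu la : seq nat) : is_partition mu -> part_sub mu la ->
  (size mu <= size la)%N.
Proof.
move=> /andP[_ mu0] ml; rewrite leqNgt; apply/negP => lt.
have := part_sub_nth (size la) ml; rewrite [X in (_ <= X)%N]nth_default // leqn0 => /eqP E.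
by move/negP: mu0; apply; rewrite -E mem_nth.
Qed.

(** Finiteness turns the sum over a set in [laguerre] into a sum over a list. A partition inside
    [la] is recovered from its first [size la] entries, each at most [sumn la], by deleting
    zeros. *)
Lemma finite_subpartitions (la : seq nat) :
  finite_set [set mu : seq nat | is_partition mu /\ part_sub mu la].
Proof.
pose M := sumn la.
pose g (f : {ffun 'I_(size la) -> 'I_M.+1}) : seq nat :=
  [seq k <- [seq (f i : nat) | i <- enum 'I_(size la)] | k != 0%N].
apply: (@sub_finite_set _ _ (g @` setT)); last by apply: finite_image; exact: finite_finset.
move=> mu /= [mp ml].
exists [ffun i : 'I_(size la) => inord (nth 0%N mu i)] => //.
have E : [seq ([ffun i : 'I_(size la) => inord (nth 0%N mu i)] i : 'I_M.+1) : nat | i <- enum 'I_(size la)]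
   = mkseq (nth 0%N mu) (size la).
  rewrite /mkseq -val_enum_ord -map_comp; apply: eq_map => i /=; rewrite ffunE inordK // ltnS.
  apply: leq_trans (part_sub_nth i ml) _.
  by rewrite /M sumnE (big_nth 0%N) big_mkord (bigD1 i) //= leq_addr.
rewrite /g E.
have -> : mkseq (nth 0%N mu) (size la) = mu ++ nseq (size la - size mu) 0%N.
  apply: (@eq_from_nth _ 0%N).
    by rewrite size_mkseq size_cat size_nseq subnKC // part_sub_size.
  move=> i; rewrite size_mkseq => il; rewrite nth_mkseq // nth_cat nth_nseq.
  by case: ltnP => // h; rewrite nth_default // if_same.
rewrite filter_cat filter_nseq /= cats0; apply/all_filterP.
by apply/allP => k kmu; apply: contraTneq kmu => ->; case/andP: mp.
Qed.

(** Both sides are [poch s l / poch t m]; positivity makes the cancelled factors nonzero. *)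
Lemma poch_ratio (s t : R) (l m : nat) : 0 < s -> 0 < t ->
  poch s l / poch s m * (poch s m / poch t m) = poch t l / poch t m * (poch s l / poch t l).
Proof.
move=> s_gt0 t_gt0.
have h (u : R) k : 0 < u -> poch u k != 0.
  by move=> u0; rewrite poch_prod // gt_eqF // prodr_gt0 // => j _; rewrite ltr_wpDr.
move: (h s m s_gt0) (h t l t_gt0) (h t m t_gt0).
by move: (poch s l) (poch s m) (poch t l) (poch t m) => w1 w2 w3 w4 h1 h2 h3; field; rewrite ?h1 ?h2 ?h3.
Qed.

Lemma cfact_poch (mu : seq nat) : cfact N theta s0 (fun j => nth 0%N mu j) =
  \prod_(1 <= i < N.+1) (poch ((N%:R + alpha + 1 - i%:R) * theta) (part mu i) /
    poch ((N%:R + alpha + 2 - i%:R) * theta) (part mu i)).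
Proof.
rewrite big_add1 big_mkord /cfact; apply: eq_bigr => i _.
have sE : sgi N theta s0 i = (N%:R + alpha + 1 - i.+1%:R) * theta.
  by rewrite /sgi natrB // /s0; ring.
have s1 : 0 < sgi N theta s0 i.
  by rewrite /sgi ltr_wpDr // mulr_ge0 // ltW.
have -> : (N%:R + alpha + 2 - i.+1%:R) * theta = sgi N theta s0 i + theta by rewrite sE; ring.
by rewrite -sE /rise !poch_prod // addr_gt0.
Qed.

Lemma laguerre_coef (la mu : seq nat) (a : R) : a = theta * (alpha + 1) - 1 ->
  (\prod_(1 <= i < N.+1)
       (poch (a + 1 + theta * (N%:R - i%:R)) (part la i) /
        poch (a + 1 + theta * (N%:R - i%:R)) (part mu i))) *
  cfact N theta s0 (fun j => nth 0%N mu j) =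
  (\prod_(1 <= i < N.+1)
       (poch (a + theta + 1 + theta * (N%:R - i%:R)) (part la i) /
        poch (a + theta + 1 + theta * (N%:R - i%:R)) (part mu i))) *
  c_const la N theta alpha.
Proof.
move=> ->; rewrite cfact_poch /c_const -[LHS]big_split -[RHS]big_split big_nat [RHS]big_nat.
apply: eq_bigr => i /andP[i1 iN].
have -> : theta * (alpha + 1) - 1 + 1 + theta * (N%:R - i%:R) =
    (N%:R + alpha + 1 - i%:R) * theta by ring.
have -> : theta * (alpha + 1) - 1 + theta + 1 + theta * (N%:R - i%:R) =
    (N%:R + alpha + 2 - i%:R) * theta by ring.
have Ni : 0 <= N%:R - i%:R :> R by rewrite subr_ge0 ler_nat.
have al : 0 < alpha + 1 by rewrite -ltrBlDr sub0r.
by apply: poch_ratio; apply: mulr_gt0 => //; lra.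
Qed.

End Kernel.

Theorem theoremA2 (R : realType) (theta alpha : R) (N : nat) (a : R)
  (htheta : 0 < theta) (halpha : -1 < alpha)
  (ha : a = theta * (alpha + 1) - 1)
  (la : seq nat) (hla : is_partition la) (hlaN : (size la <= N)%N)
  (x : N.-tuple R) (hx : @weyl R N x) :
  kernel_act (@Lambda R theta alpha N) (@laguerre R theta a N la) x
  = (@laguerre R theta (a + theta) N la x * c_const la N theta alpha)%:E.
Proof.
pose A := [set mu : seq nat | is_partition mu /\ part_sub mu la].
have /finite_seqP[r rE] : finite_set A by exact: finite_subpartitions.
pose coef (b : R) mu := (-1) ^+ sumn mu * gbinom theta N la mu *
    (\prod_(1 <= i < N.+1)
       (poch (b + 1 + theta * (N%:R - i%:R)) (part la i) /
        poch (b + 1 + theta * (N%:R - i%:R)) (part mu i))).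
pose K b mu := ((sumn la)`!%:R)^-1 * (coef b mu / jack_at theta mu (ones R N)).
have LE (b : R) (y : N.-tuple R) : @laguerre R theta b N la y =
    \sum_(mu <- undup r | mu \in A) K b mu * jack_at theta mu y.
  rewrite /laguerre -/A (fsbigE (undup r)) ?undup_uniq //.
  - rewrite mulr_sumr; apply: eq_bigr => mu _.
    rewrite /K /normalized_jack -/(coef b mu).
    by move: (coef b mu) (jack_at theta mu y) ((jack_at theta mu (ones R N))^-1) => c j o; ring.
  - by move=> mu; rewrite /= mem_undup rE.
  - by move=> mu; rewrite rE /= mem_undup => ->.
rewrite (_ : laguerre theta a la = fun y => \sum_(mu <- undup r | mu \in A) K a mu * jack_at theta mu y); last first.
  by apply/funext => y; exact: LE.
rewrite (@kernel_act_comb R N theta alpha htheta halpha x _ _ _ _ id hx); last first.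
  move=> mu; rewrite inE => -[mp ml]; rewrite mp /=.
  exact: leq_trans (part_sub_size mp ml) hlaN.
congr EFin; rewrite LE mulr_suml; apply: eq_bigr => mu _.
have alg (f c p o q cf cc j : R) : p * cf = q * cc ->
    f * (c * p * o) * (cf * j) = f * (c * q * o) * j * cc.
  by move=> E; transitivity (f * c * o * j * (p * cf)); [ring|rewrite E; ring].
exact: alg (@laguerre_coef R N theta alpha htheta halpha la mu a ha).
Qed.
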